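(* Let $c>0$ and $B<3$ be fixed constants and let $m=m(n)$ satisfy $m(n)\in[cn,Bn]$ for all large $n$. Let $H_1,\ldots,H_l$ be fixed connected planar graphs each containing at most one cycle, and let $t$ be a fixed constant. Then there exist constants $\epsilon>0$ and $N$ such that for all $n\ge N$, $$\mathbf{P}\Big[\bigcap_{i=1}^{l}\big(P_{n,m}\text{ has at least } t \text{ components with an order-preserving isomorphism to } H_i\big)\Big]\ge\epsilon.$$
   Context: $\mathcal{P}(n,m)$ is the set of simple labelled planar graphs on vertex set $\{1,\ldots,n\}$ with exactly $m$ edges; $P_{n,m}$ is chosen uniformly at random from $\mathcal{P}(n,m)$. Each $H_i$ has vertex set $\{1,\ldots,|H_i|\}$. A component $C$ of a graph on $\{1,\ldots,n\}$ has an order-preserving isomorphism to $H$ (with $V(H)=\{1,\ldots,h\}$) if $|C|=h$ and the increasing bijection from $\{1,\ldots,h\}$ to $V(C)$ is an isomorphism between $H$ and $C$. *)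

(* Defs.v *)
From mathcomp Require Import all_boot all_order all_algebra.
From mathcomp Require Import all_classical all_reals all_analysis.
Import Order.TTheory GRing.Theory Num.Theory.
Import numFieldNormedType.Exports.

Set Implicit Arguments.
Unset Strict Implicit.
Unset Printing Implicit Defensive.

Local Open Scope classical_set_scope.
Local Open Scope ring_scope.

(* A graph on the vertices {1, .., n} is given by its edge set; the vertex
   k + 1 is represented by k : 'I_n, which preserves the vertex order. *)
Notation edge_set n := {set {set 'I_n}}.

Definition simple_graph n (E : edge_set n) : bool :=
  [forall e in E, #|e| == 2%N].

Definition adj n (E : edge_set n) : rel 'I_n :=
  fun x y => [set x; y]%SET \in E.

(* The null graph is not connected. *)
Definition connected_graph n (E : edge_set n) : bool :=
  (0 < n)%N && [forall x, forall y, connect (adj E) x y].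

(* The vertex sets of the connected components. *)
Definition components n (E : edge_set n) : {set {set 'I_n}} :=
  [set [set y | connect (adj E) x y]%SET | x : 'I_n]%SET.

Definition is_cycle n (E : edge_set n) (s : seq 'I_n) : bool :=
  (2 < size s)%N && ucycleb (adj E) s.

Definition cycle_edges n (s : seq 'I_n) : edge_set n :=
  [set [set x; next s x]%SET | x in s]%SET.

(* The same cycle is traversed by several vertex sequences (rotations and
   reversals), so cycles are compared as subgraphs, by their edge sets. *)
Definition at_most_one_cycle n (E : edge_set n) : Prop :=
  forall s1 s2 : seq 'I_n,
    is_cycle E s1 -> is_cycle E s2 -> cycle_edges s1 = cycle_edges s2.

(* Drawings in the Euclidean plane R x R: p places the vertices, and g e is a
   simple arc, parametrized by [0, 1], joining the two ends of the edge e. *)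
Definition plane_drawing (R : realType) n (E : edge_set n)
    (p : 'I_n -> R * R) (g : {set 'I_n} -> R -> R * R) : Prop :=
  [/\ injective p,
      forall e, e \in E ->
        [/\ {within `[0, 1], continuous (g e)},
            {in `[0, 1] &, injective (g e)} &
            [set g e 0; g e 1] = [set p x | x in [set` e]]],
      forall e x t, e \in E -> t \in `]0, 1[ -> g e t <> p x &
      forall e e' t t', e \in E -> e' \in E -> e != e' ->
        t \in `]0, 1[ -> t' \in `]0, 1[ -> g e t <> g e' t'].

Definition planar (R : realType) n (E : edge_set n) : Prop :=
  exists p g, @plane_drawing R n E p g.

(* P(n, m) *)
Definition planar_graphs (R : realType) (n m : nat) : {set edge_set n} :=
  [set E : edge_set n | [&& simple_graph E, #|E| == m & `[< planar R E >]]]%SET.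

(* The probability that P_{n,m}, uniform on P(n, m), has the property A; it is
   0 by convention when P(n, m) is empty. *)
Definition Pr_planar (R : realType) (n m : nat) (A : pred (edge_set n)) : R :=
  #|[set E in planar_graphs R n m | A E]%SET|%:R / #|planar_graphs R n m|%:R.

Definition order_iso h n (H : edge_set h) (E : edge_set n) (C : {set 'I_n})
  : bool :=
  [exists f : {ffun 'I_h -> 'I_n},
    [&& [forall i : 'I_h, forall j : 'I_h, (i < j)%N ==> (f i < f j)%N],
        [set f i | i : 'I_h]%SET == C &
        [forall i, forall j, adj E (f i) (f j) == adj H i j]]].

Definition num_order_iso_components h n (H : edge_set h) (E : edge_set n) : nat :=
  #|[set C in components E | order_iso H E C]%SET|.

(* Main.v *)
Require Import Defs.
From Stdlib Require Import Btauto.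
From mathcomp Require Import all_boot all_order all_algebra.
From mathcomp Require Import all_classical all_reals all_analysis.
From mathcomp Require Import fingroup perm zify ring lra.
Import Order.TTheory GRing.Theory Num.Theory.
Import numFieldNormedType.Exports.

(* Planarity is handled through a discrete substitute: minors of the square
   lattice, equivalently disjoint connected sets of lattice points that touch
   along the edges. It is equivalent to planarity by plane drawings: a lattice
   model is drawn and its trees are collapsed leaf by leaf by continuous maps of
   the plane; conversely the arcs of a drawing are followed on a fine lattice.
   Crossing parities exclude K5 and K33, and walking around the trees gives a
   rotation system, so Euler's inequality yields that a planar graph with n
   vertices and m edges has at least 3n - 6 - m edges that can be added.

   Let N(n, m) be the number of planar graphs. Up to constants, adding an edge
   gives N(n, m) <= C N(n, m + 1), and contracting a vertex of bounded degree
   gives N(n, m) <= C n N(n - 1, m - 1). The graphs H_i are treated one at a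
   time: from most of the planar graphs with K = t |H_i| fewer vertices and
   edges, one builds about n^K graphs with n vertices and m edges and many
   components H_i: if there are too many components H_i already, the
   K new vertices are attached as leaves; otherwise t new components H_i are
   added, together with t (|H_i| - e(H_i)) edges, a number that is nonnegative as
   H_i has at most one cycle. *)

Set Implicit Arguments.
Unset Strict Implicit.
Unset Printing Implicit Defensive.

Local Open Scope ring_scope.

(** * Minors of the square lattice *)

Definition pt := (int * int)%type.

Definition adjz (x y : pt) : bool :=
  ((x.1 == y.1) && ((x.2 == y.2 + 1) || (y.2 == x.2 + 1))) ||
  ((x.2 == y.2) && ((x.1 == y.1 + 1) || (y.1 == x.1 + 1))).

Lemma adjzC : symmetric adjz.
Proof. by move=> [a b] [c d]; rewrite /adjz /=; lia. Qed.

(* A list of lattice points built by adding neighbours one at a time; the head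
   is the point added last, so it is a leaf of the spanning tree described by
   the list. *)
Fixpoint grown (s : seq pt) : bool :=
  if s is x :: s' then nilp s' || [&& x \notin s', has (adjz x) s' & grown s']
  else false.

Definition touch (s t : seq pt) : bool := has (fun x => has (adjz x) t) s.

Definition model (V : finType) (e : rel V) (A : pred V) (B : V -> seq pt) :=
  [/\ forall v, A v -> grown (B v),
      forall u v x, A u -> A v -> x \in B u -> x \in B v -> u = v &
      forall u v, A u -> A v -> e u v -> touch (B u) (B v)].

(* Minors of finite pieces of the square lattice: a discrete substitute for
   planarity. *)
Definition pl (V : finType) (e : rel V) := exists B, model e predT B.

Lemma touchP s t :
  reflect (exists x y, [/\ x \in s, y \in t & adjz x y]) (touch s t).
Proof.
apply: (iffP hasP) => [[x xs /hasP [y yt xy]]|[x [y [xs yt xy]]]].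
  by exists x, y.
by exists x => //; apply/hasP; exists y.
Qed.

Lemma touchC s t : touch s t = touch t s.
Proof.
by apply/touchP/touchP => -[x [y [? ? ?]]]; exists y, x; split=> //; rewrite adjzC.
Qed.

Lemma grown_cons x y s : grown s -> y \in s -> adjz x y -> x \notin s ->
  grown (x :: s).
Proof.
move=> gs ys xy xs /=; rewrite xs gs andbT; apply/orP; right.
by apply/hasP; exists y.
Qed.

Lemma grown_path s x p : grown s -> x \in s -> path adjz x p ->
  exists2 s', grown s' & s' =i s ++ p.
Proof.
elim: p x s => [|y p IH] x s gs xs /=.
  by move=> _; exists s => // z; rewrite cats0.
case/andP=> xy py; have [ys|nys] := boolP (y \in s).
  have [s' gs' es'] := IH _ _ gs ys py; exists s' => // z.
  by rewrite es' !mem_cat inE; case: eqP => // ->; rewrite ys.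
have gy : grown (y :: s) by apply: (grown_cons gs xs) => //; rewrite adjzC.
have [s' gs' es'] := IH y _ gy (mem_head _ _) py; exists s' => // z.
by rewrite es' !mem_cat !inE; do !case: (_ \in _); rewrite ?orbT ?orbF.
Qed.

Lemma grown_conn s x y : grown s -> x \in s -> y \in s ->
  exists p, [/\ path adjz x p, last x p = y & {subset p <= s}].
Proof.
elim: s x y => [|z s IH] x y //= /orP [/nilP ->|/and3P [zs /hasP [w ws zw] gs]].
  rewrite !inE => /eqP -> /eqP ->; by exists [::].
rewrite !inE => /orP [/eqP ->|xs] /orP [/eqP ->|ys].
- by exists [::].
- have [p [pp lp sp]] := IH w y gs ws ys.
  exists (w :: p); split=> /=; rewrite ?zw //.
  by move=> a; rewrite !inE => /orP [/eqP ->|/sp ->]; rewrite ?ws orbT.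
- have [p [pp lp sp]] := IH x w gs xs ws.
  exists (rcons p z); split; first by rewrite rcons_path pp lp adjzC zw.
    by rewrite last_rcons.
  move=> a; rewrite mem_rcons !inE => /orP [->//|/sp ->]; by rewrite orbT.
- have [p [pp lp sp]] := IH x y gs xs ys.
  by exists p; split=> // a /sp as_; rewrite inE as_ orbT.
Qed.

Lemma grown_neq0 s : grown s -> exists x, x \in s.
Proof. by case: s => [|x s] // _; exists x; rewrite mem_head. Qed.

Lemma grown_cat s t : grown s -> grown t -> touch s t ->
  exists2 s', grown s' & s' =i s ++ t.
Proof.
move=> gs gt /touchP [x [y [xs yt xy]]].
have H : forall l : seq pt, {subset l <= t} -> exists2 s', grown s' &
    (forall z, (z \in s ++ y :: l -> z \in s') /\ (z \in s' -> z \in s ++ t)).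
  elim=> [_|z l IH sl].
    have px : path adjz x [:: y] by rewrite /= xy.
    have [s' gs' es'] := grown_path gs xs px.
    exists s' => // z; rewrite es'; split=> //.
    by rewrite !mem_cat inE => /orP [->//|/eqP ->]; rewrite yt orbT.
  have [|s' gs' es'] := IH; first by move=> a al; apply: sl; rewrite inE al orbT.
  have zt : z \in t by apply: sl; rewrite mem_head.
  have [p [pp lp sp]] := grown_conn gt yt zt.
  have ys' : y \in s' by apply: (es' y).1; rewrite mem_cat mem_head orbT.
  have [s2 gs2 es2] := grown_path gs' ys' pp.
  exists s2 => // a; rewrite es2; split.
    rewrite mem_cat !inE => H.
    have [ea|nea] := eqVneq a z; last first.
      rewrite mem_cat; apply/orP; left; apply: (es' a).1.
      by move: H; rewrite (negbTE nea) mem_cat inE.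
    rewrite ea -lp mem_cat; have := mem_last y p; rewrite inE => /orP [/eqP ->|->].
      by rewrite ys'.
    by rewrite orbT.
  rewrite mem_cat => /orP [/(es' a).2 //|/sp ap]; by rewrite mem_cat ap orbT.
have [s' gs' es'] := H t (fun _ h => h); exists s' => // z.
apply/idP/idP => [/(es' z).2 //|zst]; apply: (es' z).1.
by move: zst; rewrite !mem_cat inE => /orP [->//|->]; rewrite !orbT.
Qed.

Lemma pl_minor_star (V W : finType) (e : rel V) (e' : rel W)
    (k : W -> V) (f : V -> option W) :
  pl e -> (forall w, f (k w) = Some w) ->
  (forall v w, f v = Some w -> v = k w \/ e (k w) v) ->
  (forall w w', e' w w' -> exists v v', [/\ f v = Some w, f v' = Some w' & e v v']) ->
  pl e'.
Proof.
move=> [B [gB dB tB]] fk star ee'.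
have H : forall w, exists s, grown s /\
    (forall z, z \in s <-> exists2 v, f v = Some w & z \in B v).
  move=> w.
  have H : forall l : seq V, (forall v, v \in l -> f v = Some w) ->
      exists s, grown s /\ (forall z, z \in s <-> exists2 v, v \in k w :: l & z \in B v).
    elim=> [_|v l IH sl].
      exists (B (k w)); split; first exact: gB.
      move=> z; split=> [zB|[v]]; first by exists (k w); rewrite ?mem_head.
      by rewrite inE => /eqP ->.
    have [|s [gs es]] := IH; first by move=> a al; apply: sl; rewrite inE al orbT.
    have fv : f v = Some w by apply: sl; rewrite mem_head.
    case: (star v w fv) => [->|ekv].
      exists s; split=> // z; rewrite es; split=> -[u ul zu]; exists u => //.
        by move: ul; rewrite !inE => /orP [->//|->]; rewrite !orbT.
      by move: ul; rewrite !inE orbA orbb.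
    have tsv : touch s (B v).
      have /touchP [x [y [xk yv xy]]] := tB _ _ isT isT ekv.
      apply/touchP; exists x, y; split=> //; apply/es; exists (k w) => //.
      by rewrite mem_head.
    have [s' gs' es'] := grown_cat gs (gB v isT) tsv.
    exists s'; split=> // z; rewrite es' mem_cat; split.
      move=> /orP [/es [u ul zu]|zv]; last by exists v => //; rewrite !inE eqxx orbT.
      by exists u => //; move: ul; rewrite !inE => /orP [->//|->]; rewrite !orbT.
    move=> [u]; rewrite !inE => /or3P [/eqP ->|/eqP ->|ul] zu.
    - by apply/orP; left; apply/es; exists (k w); rewrite ?mem_head.
    - by rewrite zu orbT.
    - by apply/orP; left; apply/es; exists u; rewrite // inE ul orbT.
  have [|s [gs es]] := H (enum [pred v | f v == Some w]).
    by move=> v; rewrite mem_enum => /eqP.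
  exists s; split=> // z; rewrite es; split=> -[v vl zv]; exists v => //.
    by move: vl; rewrite inE => /orP [/eqP ->//|]; rewrite mem_enum => /eqP.
  by rewrite inE mem_enum inE vl eqxx orbT.
have [B' HB'] := boolp.choice H; exists B'; split.
- by move=> w _; case: (HB' w).
- move=> w w' x _ _ /(HB' w).2 [v fv xv] /(HB' w').2 [v' fv' xv'].
  by apply: Some_inj; rewrite -fv -fv' (dB v v' x).
- move=> w w' _ _ /ee' [v [v' [fv fv' evv']]].
  have /touchP [x [y [xv yv' xy]]] := tB _ _ isT isT evv'.
  apply/touchP; exists x, y; split=> //; first by apply/(HB' w).2; exists v.
  by apply/(HB' w').2; exists v'.
Qed.

Lemma pl_sub (V W : finType) (e : rel V) (e' : rel W) (k : W -> V) :
  injective k -> (forall w w', e' w w' -> e (k w) (k w')) -> pl e -> pl e'.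
Proof.
move=> ik ee' ple.
pose f v := [pick w | k w == v].
have fk w : f (k w) = Some w.
  rewrite /f; case: pickP => [w' /eqP /ik ->//|/(_ w)]; by rewrite eqxx.
apply: (pl_minor_star (k := k) (f := f) ple fk) => [v w|w w' h].
  by rewrite /f; case: pickP => // w' /eqP <- [<-]; left.
by exists (k w), (k w'); split=> //; apply: ee'.
Qed.

Definition trans (d x : pt) : pt := (x.1 + d.1, x.2 + d.2).

Lemma trans_inj d : injective (trans d).
Proof. by move=> [a b] [a' b'] [] /addIr -> /addIr ->. Qed.

Lemma adjz_trans d x y : adjz (trans d x) (trans d y) = adjz x y.
Proof. by case: x y d => [a b] [a' b'] [c c']; rewrite /adjz /trans /=; lia. Qed.

Lemma grown_trans d s : grown (map (trans d) s) = grown s.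
Proof.
elim: s => //= x s ->; rewrite mem_map; last exact: trans_inj.
rewrite has_map /nilp size_map; congr (_ || [&& _, _ & _]).
by apply: eq_has => y /=; rewrite adjz_trans.
Qed.

Lemma touch_trans d s t : touch (map (trans d) s) (map (trans d) t) = touch s t.
Proof.
rewrite /touch has_map; apply: eq_has => x /=; rewrite has_map.
by apply: eq_has => y /=; rewrite adjz_trans.
Qed.

Lemma max_pt (s : seq pt) x0 : x0 \in s ->
  exists2 x : pt, x \in s & forall y : pt, y \in s -> y.1 <= x.1.
Proof.
elim: s x0 => [|x s IH] x0 //; case: s IH => [|y s] IH _.
  by exists x; rewrite ?mem_head // => y; rewrite inE => /eqP ->.
have [z zs Hz] := IH y (mem_head _ _).
have [xz|zx] := lerP x.1 z.1.
  exists z; first by rewrite inE zs orbT.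
  by move=> a; rewrite inE => /orP [/eqP ->//|/Hz].
exists x; first by rewrite mem_head.
by move=> a; rewrite inE => /orP [/eqP ->//|/Hz]; lia.
Qed.

Lemma min_pt (s : seq pt) x0 : x0 \in s ->
  exists2 x : pt, x \in s & forall y : pt, y \in s -> x.1 <= y.1.
Proof.
move=> x0s; pose opp (x : pt) : pt := (- x.1, x.2).
have : opp x0 \in map opp s by apply: map_f.
move=> /max_pt [x /mapP [z zs ->] H]; exists z => // y ys.
by have := H (opp y) (map_f _ ys); rewrite /=; lia.
Qed.

(* The two drawings are translated so that a rightmost point of the first one
   is the left neighbour of a leftmost point of the second one. *)
Lemma pl_glue (V : finType) (e1 e2 : rel V) (A : pred V) a b :
  (exists B, model e1 A B) -> (exists B, model e2 (predC A) B) -> A a -> ~~ A b ->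
  exists u w, [/\ A u, ~~ A w &
    pl [rel x y | [|| A x && A y && e1 x y, ~~ A x && ~~ A y && e2 x y,
                     (x == u) && (y == w) | (x == w) && (y == u)]]].
Proof.
move=> [B1 [g1 d1 t1]] [B2 [g2 d2 t2]] Aa Ab.
pose s1 := flatten [seq B1 v | v <- enum V & A v].
pose s2 := flatten [seq B2 v | v <- enum V & ~~ A v].
have ms1 x : reflect (exists2 v, A v & x \in B1 v) (x \in s1).
  apply: (iffP flattenP) => [[s /mapP [v]]|[v Av xv]].
    by rewrite mem_filter => /andP [Av _] -> xv; exists v.
  by exists (B1 v) => //; apply: map_f; rewrite mem_filter Av mem_enum.
have ms2 x : reflect (exists2 v, ~~ A v & x \in B2 v) (x \in s2).
  apply: (iffP flattenP) => [[s /mapP [v]]|[v Av xv]].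
    by rewrite mem_filter => /andP [Av _] -> xv; exists v.
  by exists (B2 v) => //; apply: map_f; rewrite mem_filter Av mem_enum.
have [x0 x0a] := grown_neq0 (g1 a Aa); have [y0 y0b] := grown_neq0 (g2 b Ab).
have x0s : x0 \in s1 by apply/ms1; exists a.
have y0s : y0 \in s2 by apply/ms2; exists b.
have [x /ms1 [u Au xu] Hx] := max_pt x0s.
have [y /ms2 [w Aw yw] Hy] := min_pt y0s.
pose d : pt := (x.1 + 1 - y.1, x.2 - y.2).
exists u, w; split=> //; exists (fun v => if A v then B1 v else map (trans d) (B2 v)); split.
- by move=> v _; case: ifPn => Av; [apply: g1|rewrite grown_trans; apply: g2].
- move=> v v' z _ _.
  have X (p p' : V) : A p -> ~~ A p' -> z \in B1 p -> z \in map (trans d) (B2 p') -> p = p'.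
    move=> Ap Ap' zp /mapP [z' zp' ez].
    have : z.1 <= x.1 by apply: Hx; apply/ms1; exists p.
    have : y.1 <= z'.1 by apply: Hy; apply/ms2; exists p'.
    by rewrite ez /trans /d /= => h1 h2; exfalso; clear -h1 h2; lia.
  case: ifPn => Av; case: ifPn => Av'.
  + exact: d1 Av Av'.
  + exact: X.
  + by move=> h1 h2; apply/esym/X.
  + move=> /mapP [z1 zv1 ->] /mapP [z2 zv2 /trans_inj ez]; subst z2.
    exact: (d2 _ _ z1 Av Av').
- have tuw : touch (B1 u) (map (trans d) (B2 w)).
    apply/touchP; exists x, (trans d y); split=> //; first exact: map_f.
    by rewrite /adjz /trans /d /=; clear; lia.
  move=> v v' _ _ /= /or4P [/andP[/andP[Av Av'] ev]|/andP[/andP[Av Av'] ev]|/andP[/eqP -> /eqP ->]|/andP[/eqP -> /eqP ->]].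
  + by rewrite Av Av'; apply: t1.
  + by rewrite (negbTE Av) (negbTE Av') touch_trans; apply: t2.
  + by rewrite Au (negbTE Aw).
  + by rewrite Au (negbTE Aw) touchC.
Qed.

Lemma pl_model (V : finType) (e : rel V) (A : pred V) : pl e -> exists B, model e A B.
Proof.
by move=> [B [g d t]]; exists B; split=> [v _|u v x _ _|u v _ _]; [apply: g|apply: d|apply: t].
Qed.

Definition sum_rel (V W : finType) (e : rel V) (e' : rel W) : rel (V + W)%type :=
  fun x y => match x, y with
  | inl a, inl b => e a b
  | inr a, inr b => e' a b
  | _, _ => false
  end.

Lemma pl_union (V W : finType) (e : rel V) (e' : rel W) (v : V) (w : W) :
  pl e -> pl e' -> pl (sum_rel e e').
Proof.
move=> [B [g d t]] [B' [g' d' t']].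
have [||//|//|u0 [w0 [_ _ plg]]] := @pl_glue (V + W)%type (sum_rel e e') (sum_rel e e')
    (fun x => if x is inl _ then true else false) (inl v) (inr w).
- exists (fun x => if x is inl a then B a else [::]); split=> [[a|a]|[a|a] [b|b] x|[a|a] [b|b]] //= _.
  + exact: g.
  + by move=> _ xa xb; rewrite (d _ _ _ _ _ xa xb).
  + by move=> _; apply: t.
- exists (fun x => if x is inr a then B' a else [::]); split=> [[a|a]|[a|a] [b|b] x|[a|a] [b|b]] //= _.
  + exact: g'.
  + by move=> _ xa xb; rewrite (d' _ _ _ _ _ xa xb).
  + by move=> _; apply: t'.
by apply: (pl_sub (k := id) _ _ plg) => // -[a|a] [b|b] //= ->.
Qed.

(* The sign of a nonzero lattice vector for the lexicographic order, and the
   crossings of the half-line {0} x (0, +oo) by a unit step. *)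
Definition sgz2 (z : pt) : bool := (z.1 < 0) || ((z.1 == 0) && (z.2 < 0)).
Definition ptB (x y : pt) : pt := (x.1 - y.1, x.2 - y.2).
Definition chi (z z' : pt) : bool := (0 < z.2) && ((z.1 < 0) (+) (z'.1 < 0)).

Fixpoint crossing (y x : pt) (p : seq pt) : bool :=
  if p is x' :: p' then chi (ptB x y) (ptB x' y) (+) crossing y x' p' else false.

Lemma chi_square (i j s1 s2 t1 t2 : int) :
  adjz (0, 0) (s1, s2) -> adjz (0, 0) (t1, t2) ->
  (i, j) != (0, 0) -> (i + s1, j + s2) != (0, 0) ->
  (i + t1, j + t2) != (0, 0) -> (i + s1 + t1, j + s2 + t2) != (0, 0) ->
  chi (i, j) (i + s1, j + s2) (+) chi (i + t1, j + t2) (i + s1 + t1, j + s2 + t2) =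
  chi (i, j) (i + t1, j + t2) (+) chi (i + s1, j + s2) (i + s1 + t1, j + s2 + t2).
Proof.
have key (u v w : int) : u = 1 \/ u = -1 -> w = 1 \/ w = -1 ->
    (i, v) != (0, 0) -> (i + u, v) != (0, 0) -> (i, v + w) != (0, 0) ->
    (i + u, v + w) != (0, 0) ->
    ((0 < v) == (0 < v + w)) || ((i < 0) == (i + u < 0)).
  by rewrite !xpair_eqE => -[] -> [] -> /=; lia.
rewrite /chi /= => hs ht.
have [[-> es]|[es ->]] : (s1 = 0 /\ (s2 = 1 \/ s2 = -1)) \/ ((s1 = 1 \/ s1 = -1) /\ s2 = 0).
  by move: hs; rewrite /adjz /=; lia.
all: have [[-> et]|[et ->]] : (t1 = 0 /\ (t2 = 1 \/ t2 = -1)) \/ ((t1 = 1 \/ t1 = -1) /\ t2 = 0);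
  first by move: ht; rewrite /adjz /=; lia.
all: rewrite ?addr0 => n1 n2 n3 n4.
- by rewrite !addbb !andbF.
- have := key _ _ _ et es n1 n3 n2 n4; move: (0 < j) (0 < j + s2) (i < 0) (i + t1 < 0).
  by do 4!case.
- have := key _ _ _ es et n1 n2 n3 n4; move: (0 < j) (0 < j + t2) (i < 0) (i + s1 < 0).
  by do 4!case.
- move: (0 < j) (i < 0) (i + s1 < 0) (i + t1 < 0) (i + s1 + t1 < 0).
  by do 5!case.
Qed.

Lemma chi_cell (x x' y y' : pt) : adjz x x' -> adjz y y' ->
  x != y -> x != y' -> x' != y -> x' != y' ->
  chi (ptB x y) (ptB x' y) (+) chi (ptB x y') (ptB x' y') =
  chi (ptB x y) (ptB x y') (+) chi (ptB x' y) (ptB x' y').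
Proof.
case: x x' y y' => [a b] [a' b'] [c d] [c' d'] h1 h2.
have h3 : adjz (0, 0) (a' - a, b' - b) by move: h1; rewrite /adjz /=; lia.
have h4 : adjz (0, 0) (c - c', d - d') by move: h2; rewrite /adjz /=; lia.
have e1 : a - c + (a' - a) = a' - c by ring.
have e2 : b - d + (b' - b) = b' - d by ring.
have e3 : a - c + (c - c') = a - c' by ring.
have e4 : b - d + (d - d') = b - d' by ring.
have e5 : a' - c + (c - c') = a' - c' by ring.
have e6 : b' - d + (d - d') = b' - d' by ring.
have := chi_square h3 h4 (i := a - c) (j := b - d).
rewrite e1 e2 e3 e4 e5 e6 /ptB !xpair_eqE /= !subr_eq0 => H n1 n2 n3 n4.
exact: H.
Qed.

Lemma chi_opp (x y y' : pt) : adjz y y' -> x != y -> x != y' ->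
  chi (ptB x y) (ptB x y') =
  chi (ptB y x) (ptB y' x) (+) sgz2 (ptB x y) (+) sgz2 (ptB x y').
Proof.
case: x y y' => [a b] [c d] [c' d'].
rewrite /adjz /chi /sgz2 /ptB !xpair_eqE /=.
by case/orP=> /andP [/eqP -> /orP [/eqP ->|/eqP ->]]; lia.
Qed.

(** * The graphs K5 and K33 *)

Lemma crossing_step x p y y' : adjz y y' -> path adjz x p ->
  y \notin x :: p -> y' \notin x :: p ->
  crossing y x p (+) crossing y' x p =
  chi (ptB x y) (ptB x y') (+) chi (ptB (last x p) y) (ptB (last x p) y').
Proof.
move=> yy'; elim: p x => [|x' p IH] x /=; first by rewrite addbb.
case/andP=> xx' px'; rewrite inE negb_or => /andP [yx ny].
rewrite inE negb_or => /andP [yx' ny'].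
have n1 : x' != y by apply: contraNneq ny => ->; rewrite mem_head.
have n2 : x' != y' by apply: contraNneq ny' => ->; rewrite mem_head.
have := chi_cell xx' yy'; rewrite eq_sym yx eq_sym yx' n1 n2 => /(_ isT isT isT isT).
have := IH _ px' ny ny'.
move: (chi _ _) (crossing y x' p) (chi _ _) (crossing y' x' p) (chi _ _) (chi _ _) (chi _ _).
by do !case.
Qed.

Lemma crossing_walks x p y q : path adjz x p -> path adjz y q ->
  (forall z, z \in x :: p -> z \notin y :: q) ->
  crossing y x p (+) crossing (last y q) x p (+) crossing x y q (+) crossing (last x p) y q
  = sgz2 (ptB x y) (+) sgz2 (ptB x (last y q)) (+)
    sgz2 (ptB (last x p) y) (+) sgz2 (ptB (last x p) (last y q)).
Proof.
move=> px; elim: q y => [|y' q IH] y.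
  by move=> _ _ /=; rewrite addbb !addbF addbb addFb addbb.
move=> /= /andP [yy' py'] dis.
have lx := mem_last x p.
have dy z : z \in x :: p -> z != y.
  by move=> zx; apply: contraNneq (dis z zx) => ->; rewrite mem_head.
have dy' z : z \in x :: p -> z != y'.
  by move=> zx; apply: contraNneq (dis z zx) => ->; rewrite inE mem_head orbT.
have dd z : z \in x :: p -> z \notin y' :: q.
  by move=> /dis; rewrite inE negb_or => /andP [].
have nyx : y \notin x :: p by apply/negP => /dy; rewrite eqxx.
have nyx' : y' \notin x :: p by apply/negP => /dy'; rewrite eqxx.
have xh := mem_head x p.
have := crossing_step yy' px nyx nyx'.
rewrite (chi_opp yy' (dy _ xh) (dy' _ xh)) (chi_opp yy' (dy _ lx) (dy' _ lx)).
have := IH y' py' dd.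
move: (sgz2 (ptB x y)) (sgz2 (ptB x y')) (sgz2 (ptB x (last y' q)))
  (sgz2 (ptB (last x p) y)) (sgz2 (ptB (last x p) y')) (sgz2 (ptB (last x p) (last y' q)))
  (chi _ _) (chi _ _) (crossing y x p) (crossing y' x p) (crossing (last y' q) x p)
  (crossing x y' q) (crossing (last x p) y' q).
by do 13!case.
Qed.

Lemma sgz2C x y : x != y -> sgz2 (ptB y x) = ~~ sgz2 (ptB x y).
Proof. by case: x y => [a b] [c d]; rewrite xpair_eqE /sgz2 /ptB /=; lia. Qed.

Lemma pl_parity (V : finType) (e : rel V) : pl e ->
  exists (n : V -> V -> V -> bool) (s : V -> V -> bool),
    (forall u v, u != v -> s v u = ~~ s u v) /\
    (forall u v x y, uniq [:: u; v; x; y] -> e u v -> e x y ->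
      n u v x (+) n u v y (+) n x y u (+) n x y v =
      s u x (+) s u y (+) s v x (+) s v y).
Proof.
move=> [B [gB dB tB]].
have /boolp.choice [r rB] v : exists x, x \in B v := grown_neq0 (gB v isT).
have H uv : exists p, e uv.1 uv.2 ->
    [/\ path adjz (r uv.1) p, last (r uv.1) p = r uv.2 &
        forall z, z \in r uv.1 :: p -> (z \in B uv.1) || (z \in B uv.2)].
  case: uv => u v /=; case euv : (e u v); last by exists [::].
  have [s gs es] := grown_cat (gB u isT) (gB v isT) (tB _ _ isT isT euv).
  have [||p [pp lp sp]] := grown_conn (x := r u) (y := r v) gs.
  - by rewrite es mem_cat rB.
  - by rewrite es mem_cat rB orbT.
  exists p => _; split=> // z; rewrite inE => /orP [/eqP ->|/sp]; first by rewrite rB.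
  by rewrite es mem_cat.
have [W HW] := boolp.choice H.
exists (fun u v x => crossing (r x) (r u) (W (u, v))), (fun u v => sgz2 (ptB (r u) (r v))).
split=> [u v uv|u v x y U euv exy].
  by apply: sgz2C; apply: contraNneq uv => ruv; rewrite (dB u v (r u)) // ruv.
have [p1 l1 s1] := HW (u, v) euv; have [p2 l2 s2] := HW (x, y) exy.
rewrite /= in p1 l1 s1 p2 l2 s2.
have := crossing_walks p1 p2; rewrite l1 l2; apply.
move=> z /s1 z1; apply/negP => /s2 z2; move: U; rewrite /= !inE.
by case/orP: z1 => z1; case/orP: z2 => z2; rewrite (dB _ _ _ isT isT z1 z2) eqxx ?orbT ?andbF.
Qed.

Lemma K5_not_pl (V : finType) (e : rel V) a b c d f : pl e ->
  uniq [:: a; b; c; d; f] ->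
  [&& e a b, e a c, e a d & e a f] -> [&& e b c, e b d & e b f] ->
  [&& e c d, e c f & e d f] -> False.
Proof.
move=> /pl_parity [n [s [sC E]]] U.
case/and4P=> ab ac ad af /and3P [bc bd bf] /and3P [cd cf df].
have U' w x y z : subseq [:: w; x; y; z] [:: a; b; c; d; f] -> uniq [:: w; x; y; z].
  by move=> /subseq_uniq; apply.
move: U; rewrite /= !inE !negb_or => /and5P [/and4P [Uab Uac Uad Uaf] /and3P [Ubc Ubd Ubf] /andP [Ucd Ucf] Udf _].
have F x y z w : x != y -> x != z -> x != w -> y != z -> y != w -> z != w ->
   e x y -> e z w ->
   n x y z (+) n x y w (+) n z w x (+) n z w y (+)
   (s x z (+) s x w (+) s y z (+) s y w) = false.
  move=> h1 h2 h3 h4 h5 h6 h7 h8; rewrite E ?addbb //=.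
  by rewrite !inE !negb_or h1 h2 h3 h4 h5 h6.
have F1 := F a b c d Uab Uac Uad Ubc Ubd Ucd ab cd.
have F2 := F a b c f Uab Uac Uaf Ubc Ubf Ucf ab cf.
have F3 := F a b d f Uab Uad Uaf Ubd Ubf Udf ab df.
have Ucb : c != b by rewrite eq_sym. have Udb : d != b by rewrite eq_sym.
have Udc : d != c by rewrite eq_sym. have Ufb : f != b by rewrite eq_sym.
have Ufc : f != c by rewrite eq_sym. have Ufd : f != d by rewrite eq_sym.
have F4 := F a c b d Uac Uab Uad Ucb Ucd Ubd ac bd.
have F5 := F a c b f Uac Uab Uaf Ucb Ucf Ubf ac bf.
have F6 := F a c d f Uac Uad Uaf Ucd Ucf Udf ac df.
have F7 := F a d b c Uad Uab Uac Udb Udc Ubc ad bc.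
have F8 := F a d b f Uad Uab Uaf Udb Udf Ubf ad bf.
have F9 := F a d c f Uad Uac Uaf Udc Udf Ucf ad cf.
have F10 := F a f b c Uaf Uab Uac Ufb Ufc Ubc af bc.
have F11 := F a f b d Uaf Uab Uad Ufb Ufd Ubd af bd.
have F12 := F a f c d Uaf Uac Uad Ufc Ufd Ucd af cd.
have F13 := F b c d f Ubc Ubd Ubf Ucd Ucf Udf bc df.
have F14 := F b d c f Ubd Ubc Ubf Udc Udf Ucf bd cf.
have F15 := F b f c d Ubf Ubc Ubd Ufc Ufd Ucd bf cd.
have := congr2 addb F1 (congr2 addb F2 (congr2 addb F3 (congr2 addb F4 (congr2 addb F5
  (congr2 addb F6 (congr2 addb F7 (congr2 addb F8 (congr2 addb F9 (congr2 addb F10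
  (congr2 addb F11 (congr2 addb F12 (congr2 addb F13 (congr2 addb F14 F15))))))))))))).
rewrite !addbF (sC b c) // (sC b d) // (sC b f) // (sC c d) // (sC c f) // (sC d f) //.
have -> : addb = xorb by apply/funext => -[]; apply/funext => -[].
by move=> H; suff: true = false by []; rewrite -H; btauto.
Qed.

Lemma K33_not_pl (V : finType) (e : rel V) a b c x y z : pl e ->
  uniq [:: a; b; c; x; y; z] ->
  [&& e a x, e a y & e a z] -> [&& e b x, e b y & e b z] ->
  [&& e c x, e c y & e c z] -> False.
Proof.
move=> /pl_parity [n [s [sC E]]] U.
case/and3P=> ax ay az /and3P [bx by_ bz] /and3P [cx cy cz].
move: U; rewrite /= !inE !negb_or => /and5P [/and5P [Uab Uac Uax Uay Uaz]
  /and4P [Ubc Ubx Uby Ubz] /and3P [Ucx Ucy Ucz] /andP [Uxy Uxz] /andP [Uyz _]].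
have F p q r t : p != q -> p != r -> p != t -> q != r -> q != t -> r != t ->
   e p q -> e r t ->
   n p q r (+) n p q t (+) n r t p (+) n r t q (+)
   (s p r (+) s p t (+) s q r (+) s q t) = false.
  move=> h1 h2 h3 h4 h5 h6 h7 h8; rewrite E ?addbb //=.
  by rewrite !inE !negb_or h1 h2 h3 h4 h5 h6.
have Uxb : x != b by rewrite eq_sym. have Uyb : y != b by rewrite eq_sym.
have Uzb : z != b by rewrite eq_sym. have Uxc : x != c by rewrite eq_sym.
have Uyc : y != c by rewrite eq_sym. have Uzc : z != c by rewrite eq_sym.
have Uyx : y != x by rewrite eq_sym. have Uzx : z != x by rewrite eq_sym.
have Uzy : z != y by rewrite eq_sym.
have F1 := F a x b y Uax Uab Uay Uxb Uxy Uby ax by_.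
have F2 := F a x b z Uax Uab Uaz Uxb Uxz Ubz ax bz.
have F3 := F a y b x Uay Uab Uax Uyb Uyx Ubx ay bx.
have F4 := F a y b z Uay Uab Uaz Uyb Uyz Ubz ay bz.
have F5 := F a z b x Uaz Uab Uax Uzb Uzx Ubx az bx.
have F6 := F a z b y Uaz Uab Uay Uzb Uzy Uby az by_.
have G1 := F a x c y Uax Uac Uay Uxc Uxy Ucy ax cy.
have G2 := F a x c z Uax Uac Uaz Uxc Uxz Ucz ax cz.
have G3 := F a y c x Uay Uac Uax Uyc Uyx Ucx ay cx.
have G4 := F a y c z Uay Uac Uaz Uyc Uyz Ucz ay cz.
have G5 := F a z c x Uaz Uac Uax Uzc Uzx Ucx az cx.
have G6 := F a z c y Uaz Uac Uay Uzc Uzy Ucy az cy.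
have H1 := F b x c y Ubx Ubc Uby Uxc Uxy Ucy bx cy.
have H2 := F b x c z Ubx Ubc Ubz Uxc Uxz Ucz bx cz.
have H3 := F b y c x Uby Ubc Ubx Uyc Uyx Ucx by_ cx.
have H4 := F b y c z Uby Ubc Ubz Uyc Uyz Ucz by_ cz.
have H5 := F b z c x Ubz Ubc Ubx Uzc Uzx Ucx bz cx.
have H6 := F b z c y Ubz Ubc Uby Uzc Uzy Ucy bz cy.
have := congr2 addb F1 (congr2 addb F2 (congr2 addb F3 (congr2 addb F4 (congr2 addb F5
  (congr2 addb F6 (congr2 addb G1 (congr2 addb G2 (congr2 addb G3 (congr2 addb G4
  (congr2 addb G5 (congr2 addb G6 (congr2 addb H1 (congr2 addb H2 (congr2 addb H3
  (congr2 addb H4 (congr2 addb H5 H6)))))))))))))))).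
rewrite !addbF (sC b x) // (sC b y) // (sC b z) // (sC c x) // (sC c y) // (sC c z) //
  (sC x y) // (sC x z) // (sC y z) //.
have -> : addb = xorb by apply/funext => -[]; apply/funext => -[].
by move=> H; suff: true = false by []; rewrite -H; btauto.
Qed.

(** * Rotation systems of lattice minors *)

Definition dir (g : pt) : bool := adjz (0, 0) g.
Definition turnR (g : pt) : pt := (g.2, - g.1).
Definition turnL (g : pt) : pt := (- g.2, g.1).
Definition oppd (g : pt) : pt := (- g.1, - g.2).

(* The lattice is refined by a factor 3: a point becomes its centre, a stub
   (a point with a direction) has an arm next to the centre and two corners. *)
Definition cen (p : pt) : pt := (3 * p.1, 3 * p.2).
Definition arm (s : pt * pt) : pt := trans s.2 (cen s.1).
Definition lcor (s : pt * pt) : pt := trans (turnL s.2) (arm s).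
Definition rcor (s : pt * pt) : pt := trans (turnR s.2) (arm s).
Definition iscorner (z : pt) : bool := (modz z.1 3 != 0) && (modz z.2 3 != 0).

Lemma dirP g : dir g -> [\/ g = (0, 1), g = (1, 0), g = (0, -1) | g = (-1, 0)].
Proof.
case: g => [a b]; rewrite /dir /adjz /=.
case/orP=> /andP [/eqP <- /orP [/eqP h|/eqP h]].
- by have -> : b = -1 by [lia]; constructor.
- by rewrite h add0r; constructor.
- by have -> : a = -1 by [lia]; constructor.
- by rewrite h add0r; constructor.
Qed.

Lemma adj_dir p q : adjz p q -> dir (ptB q p).
Proof. by case: p q => [a b] [c d]; rewrite /dir /adjz /ptB /=; lia. Qed.

Lemma trans_ptB p q : trans (ptB q p) p = q.
Proof. by case: p q => [a b] [c d]; rewrite /trans /ptB /=; congr pair; ring. Qed.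

Lemma adjz_dir p g : dir g -> adjz p (trans g p).
Proof.
by case: p => [a b] /dirP [] ->; rewrite /adjz /trans /=; lia.
Qed.

Lemma cen_inj : injective cen.
Proof. by move=> [a b] [c d] [] h1 h2; congr pair; lia. Qed.

Lemma arm_inj p g q h : dir g -> dir h -> arm (p, g) = arm (q, h) -> p = q /\ g = h.
Proof.
case: p q => [a b] [c d]; rewrite /arm /cen /trans /=.
by case/dirP => -> /dirP [] -> [] h1 h2; split; (congr pair || exfalso); lia.
Qed.

Lemma cen_arm p q g : dir g -> cen p <> arm (q, g).
Proof.
case: p q => [a b] [c d]; rewrite /arm /cen /trans /=.
by case/dirP => -> [] h1 h2; lia.
Qed.

Lemma cen_corner p : iscorner (cen p) = false.
Proof. by rewrite /iscorner /cen /=; lia. Qed.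

Lemma arm_corner p g : dir g -> iscorner (arm (p, g)) = false.
Proof.
by case: p => [a b]; case/dirP => ->; rewrite /iscorner /arm /cen /trans /=; lia.
Qed.

Lemma lcor_corner p g : dir g -> iscorner (lcor (p, g)).
Proof.
case: p => [a b]; case/dirP => ->; rewrite /iscorner /lcor /arm /cen /trans /=; lia.
Qed.

Lemma rcor_corner p g : dir g -> iscorner (rcor (p, g)).
Proof.
case: p => [a b]; case/dirP => ->; rewrite /iscorner /rcor /arm /cen /trans /=; lia.
Qed.

Lemma adj_cen_arm p g : dir g -> adjz (cen p) (arm (p, g)).
Proof. exact: adjz_dir. Qed.

Lemma dir_turn g : dir g -> [/\ dir (turnL g), dir (turnR g) & dir (oppd g)].
Proof. by case/dirP => ->. Qed.

Lemma adj_arm_lcor p g : dir g -> adjz (arm (p, g)) (lcor (p, g)).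
Proof. by move=> /dir_turn [? ? ?]; apply: adjz_dir. Qed.

Lemma adj_arm_rcor p g : dir g -> adjz (arm (p, g)) (rcor (p, g)).
Proof. by move=> /dir_turn [? ? ?]; apply: adjz_dir. Qed.

Lemma adj_arms p g : dir g -> adjz (arm (p, g)) (arm (trans g p, oppd g)).
Proof.
case: p => [a b]; case/dirP => ->; rewrite /adjz /arm /cen /trans /=; lia.
Qed.

Lemma adj_lcor_rcor p g : dir g -> adjz (lcor (p, g)) (rcor (trans g p, oppd g)).
Proof.
case: p => [a b]; case/dirP => ->; rewrite /adjz /rcor /lcor /arm /cen /trans /=; lia.
Qed.

Lemma adj_lcor_turn p g : dir g -> adjz (lcor (p, g)) (lcor (trans g p, turnL g)).
Proof.
case: p => [a b]; case/dirP => ->; rewrite /adjz /lcor /arm /cen /trans /=; lia.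
Qed.

Lemma adj_rcor_turn p g : dir g -> adjz (rcor (p, g)) (rcor (trans g p, turnR g)).
Proof.
case: p => [a b]; case/dirP => ->; rewrite /adjz /rcor /arm /cen /trans /=; lia.
Qed.

Definition conn (Q : pt -> bool) (x y : pt) : Prop :=
  exists p, [/\ path adjz x p, last x p = y & all Q (x :: p)].

Lemma conn_refl (Q : pt -> bool) x : Q x -> conn Q x x.
Proof. by move=> Qx; exists [::]; rewrite /= Qx. Qed.

Lemma conn_adj (Q : pt -> bool) x y : Q x -> Q y -> adjz x y -> conn Q x y.
Proof. by move=> Qx Qy xy; exists [:: y]; rewrite /= Qx Qy xy. Qed.

Lemma conn_trans (Q : pt -> bool) x y z : conn Q x y -> conn Q y z -> conn Q x z.
Proof.
move=> [p [pp lp /= /andP [Qx Qp]]] [q [pq lq /= /andP [Qy Qq]]].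
exists (p ++ q); rewrite cat_path pp lp pq last_cat lp lq; split=> //=.
by rewrite Qx all_cat Qp.
Qed.

Lemma conn_sub (Q Q' : pt -> bool) x y : (forall z, Q z -> Q' z) -> conn Q x y -> conn Q' x y.
Proof.
move=> QQ [p [pp lp Qp]]; exists p; split=> //.
by apply/allP => z /(allP Qp) /QQ.
Qed.

Lemma conn_all (Q : pt -> bool) x y : conn Q x y -> Q x /\ Q y.
Proof.
move=> [p [_ <- Qp]]; split; first by case/andP: Qp.
exact: (allP Qp _ (mem_last _ _)).
Qed.

Lemma grown_targets (Q : pt -> bool) x0 (l : seq pt) : Q x0 ->
  (forall y, y \in l -> conn Q x0 y) ->
  exists s, [/\ grown s, all Q s & {subset x0 :: l <= s}].
Proof.
move=> Q0; elim: l => [|y l IH] H.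
  by exists [:: x0]; split; rewrite /= ?Q0.
have [|s [gs Qs sub]] := IH; first by move=> z zl; apply: H; rewrite inE zl orbT.
have [p [pp lp /= /andP [_ Qp]]] := H y (mem_head _ _).
have [s' gs' es'] := grown_path gs (sub _ (mem_head _ _)) pp.
exists s'; split=> //.
  by apply/allP => z; rewrite es' mem_cat => /orP [/(allP Qs)|/(allP Qp)].
move=> z; rewrite es' mem_cat !inE => /or3P [/eqP ->|/eqP ->|zl].
- by rewrite sub ?mem_head.
- rewrite -lp; have := mem_last x0 p; rewrite inE => /orP [/eqP ->|->].
    by rewrite sub ?mem_head.
  by rewrite orbT.
- by rewrite sub // inE zl orbT.
Qed.

Lemma grown_leaves s l : grown s ->
  (forall y, y \in l -> exists2 x, x \in s & adjz x y) ->
  exists2 s', grown s' & s' =i s ++ l.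
Proof.
move=> gs; elim: l => [|y l IH] H; first by exists s => // z; rewrite cats0.
have [|s1 gs1 es1] := IH; first by move=> z zl; apply: H; rewrite inE zl orbT.
have [x xs xy] := H y (mem_head _ _).
have px : path adjz x [:: y] by rewrite /= xy.
have [|s2 gs2 es2] := grown_path (x := x) gs1 _ px; first by rewrite es1 mem_cat xs.
exists s2 => // z; rewrite es2 !mem_cat es1 !mem_cat !inE.
by do !case: (_ \in _); rewrite ?orbT ?orbF.
Qed.

Lemma path_ends (T : eqType) (R : rel T) a b a' c :
  (forall t, R a t -> R b t) -> (forall t, R t a -> R t a') ->
  path R a (rcons c a) -> path R b (rcons c a').
Proof.
move=> H1 H2; rewrite !rcons_path => /andP [pc la].
case: c pc la => [|x c] /=; first by move=> _ /H1 /H2.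
by case/andP=> /H1 -> -> /H2 ->.
Qed.

Definition corner_next (s1 s2 : pt * pt) : bool :=
  `[< conn iscorner (rcor s1) (lcor s2) >].

(* The stubs leaving the spanning tree of a blob, in clockwise order; walking
   from one to the next only uses corners of the refined lattice. *)
Lemma contour s : grown s -> exists (cs : seq (pt * pt)) (tr : seq pt),
  [/\ uniq cs /\ path.cycle corner_next cs,
      forall p g, (p, g) \in cs -> [/\ p \in s, dir g & arm (p, g) \notin tr],
      forall p g, p \in s -> dir g -> trans g p \notin s -> (p, g) \in cs,
      grown tr /\ (forall p, p \in s -> cen p \in tr) &
      forall t, t \in tr -> (exists2 p, p \in s & t = cen p) \/
        exists p g, [/\ p \in s, dir g & t = arm (p, g)]].
Proof.
elim: s => [|x s IH] //= /orP [/nilP ->|/and3P [xs /hasP [y ys xy] gs]].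
  exists [:: (x, (0, 1)); (x, (1, 0)); (x, (0, -1)); (x, (-1, 0))], [:: cen x]; split.
  - split; first by rewrite /= !inE !xpair_eqE eqxx.
    have Q (g h : pt) : dir g -> rcor (x, g) = lcor (x, h) -> corner_next (x, g) (x, h).
      by move=> dg E; apply/asboolP; rewrite -E; apply: conn_refl; apply: rcor_corner.
    by rewrite /= !Q //; rewrite /rcor /lcor /arm /trans /cen /=; congr pair; ring.
  - move=> p g hp; have : [&& p == x & dir g].
      by move: hp; rewrite !inE => /or4P [] /eqP [-> ->]; rewrite eqxx.
    case/andP=> /eqP -> dg; split; rewrite ?mem_seq1 //.
    by apply/eqP => /esym; apply: cen_arm.
  - by move=> p g; rewrite inE => /eqP -> /dirP [] -> _; rewrite !inE !eqxx ?orbT.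
  - by split=> // p; rewrite !inE => /eqP ->.
  - by move=> t; rewrite inE => /eqP ->; left; exists x; rewrite ?mem_head.
have [cs [tr [[ucs ccs] mcs bcs [gtr ctr] ttr]]] := IH gs.
have [g [dg ex]] : exists g, dir g /\ x = trans g y.
  by exists (ptB x y); rewrite trans_ptB adj_dir // adjzC.
have ycs : (y, g) \in cs by apply: bcs => //; rewrite -ex.
have [dL dR dO] := dir_turn dg.
have [i c rc] := rot_to ycs.
have uc : uniq ((y, g) :: c) by rewrite -rc rot_uniq.
have mc st : (st \in (y, g) :: c) = (st \in cs) by rewrite -rc mem_rot.
have cc : path.cycle corner_next ((y, g) :: c) by rewrite -rc rot_cycle.
have e2 : arm (x, oppd g) = trans g (arm (y, g)).
  by rewrite ex /arm /trans /cen /oppd /=; congr pair; ring.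
have nx q h : q \in s -> (q, h) = (x, g) -> False.
  by move=> qs [eq _]; move: xs; rewrite -eq qs.
have gs1 : grown (arm (y, g) :: tr).
  have [_ _ n1] := mcs _ _ ycs.
  by apply: (grown_cons gtr (ctr _ ys)) => //; rewrite adjzC adj_cen_arm.
have n2 : arm (x, oppd g) \notin arm (y, g) :: tr.
  rewrite inE negb_or; apply/andP; split.
    by apply/eqP => /(arm_inj dO dg) [exy _]; move: xs; rewrite exy ys.
  apply/negP => /ttr [[p ps] /esym|[p [h [ps dh]]]].
    exact: cen_arm.
  by move=> /(arm_inj dO dh) [exy _]; move: xs; rewrite exy ps.
have gs2 : grown (arm (x, oppd g) :: arm (y, g) :: tr).
  apply: (grown_cons gs1 (mem_head _ _) _ n2).
  by rewrite e2 adjzC adjz_dir.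
have n3 : cen x \notin arm (x, oppd g) :: arm (y, g) :: tr.
  rewrite !inE !negb_or; apply/and3P; split.
  - by apply/eqP; apply: cen_arm.
  - by apply/eqP; apply: cen_arm.
  - apply/negP => /ttr [[p ps] /cen_inj exy|[p [h [ps dh]]]].
      by move: xs; rewrite exy ps.
    exact: cen_arm.
have gs3 : grown (cen x :: arm (x, oppd g) :: arm (y, g) :: tr).
  by apply: (grown_cons gs2 (mem_head _ _) _ n3); apply: adj_cen_arm.
exists [:: (x, turnL g), (x, g), (x, turnR g) & c],
  (cen x :: arm (x, oppd g) :: arm (y, g) :: tr); split.
- have xc h : (x, h) \notin c.
    apply/negP => hc; have : (x, h) \in cs by rewrite -mc inE hc orbT.
    by move=> /mcs [xs' _ _]; move: xs; rewrite xs'.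
  split.
    rewrite cons_uniq !inE !negb_or xc cons_uniq !inE negb_or xc cons_uniq xc.
    have /andP [_ ->] : ((y, g) \notin c) && uniq c := uc; rewrite !xpair_eqE eqxx /= !andbT.
    by case/dirP: dg => ->.
  have Q (h k : pt) : dir h -> rcor (x, h) = lcor (x, k) -> corner_next (x, h) (x, k).
    by move=> dh E; apply/asboolP; rewrite -E; apply: conn_refl; apply: rcor_corner.
  rewrite /= !Q //=; first last.
  + by case/dirP: dg => ->; rewrite /rcor /lcor /arm /trans /cen /=; congr pair; ring.
  + by case/dirP: dg => ->; rewrite /rcor /lcor /arm /trans /cen /=; congr pair; ring.
  apply: (path_ends _ _ cc) => t /asboolP H; apply/asboolP.
    have [h _] := conn_all H; apply: conn_trans H; apply: conn_adj => //.
      exact: rcor_corner.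
    by rewrite ex adjzC adj_rcor_turn.
  have [_ h] := conn_all H; apply: (conn_trans H); apply: conn_adj => //.
    exact: lcor_corner.
  by rewrite ex adj_lcor_turn.
- move=> p h; rewrite 3!inE => /or4P H.
  have {H}[[-> H]|hc] : (p = x /\ [\/ h = turnL g, h = g | h = turnR g]) \/ (p, h) \in c.
    case: H => [/eqP [-> ->]|/eqP [-> ->]|/eqP [-> ->]|]; last by right.
    - by left; split=> //; apply: Or31.
    - by left; split=> //; apply: Or32.
    - by left; split=> //; apply: Or33.
    have dh : dir h by case: H => ->.
    rewrite mem_head; split=> //; rewrite !inE !negb_or; apply/and4P; split.
    + by apply/eqP => /esym; apply: cen_arm.
    + apply/eqP => /(arm_inj dh dO) [_ eh].
      by move: H; rewrite eh; case/dirP: dg => -> [] /eqP.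
    + by apply/eqP => /(arm_inj dh dg) [exy _]; move: xs; rewrite exy ys.
    + apply/negP => /ttr [[q qs] /esym|[q [k [qs dk]]]]; first exact: cen_arm.
      by move=> /(arm_inj dh dk) [exy _]; move: xs; rewrite exy qs.
  have hcs : (p, h) \in cs by rewrite -mc inE hc orbT.
  have [ps dh ah] := mcs _ _ hcs.
  rewrite inE ps orbT; split=> //; rewrite !inE !negb_or ah andbT; apply/and3P; split.
  + by apply/eqP => /esym; apply: cen_arm.
  + by apply/eqP => /(arm_inj dh dO) [exy _]; move: xs; rewrite -exy ps.
  + apply/eqP => /(arm_inj dh dg) [e3 e4].
    by case/andP: uc; rewrite -e3 -e4 hc.
- move=> p h; rewrite 2!inE => /orP [/eqP ->|ps] dh; rewrite negb_or => /andP [n4 n5].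
    have e3 : trans (oppd g) x = y.
      by rewrite ex; case: (y) => [a b]; rewrite /trans /oppd /=; congr pair; ring.
    have : h <> oppd g by move=> eh; move: n5; rewrite eh e3 ys.
    rewrite !inE !xpair_eqE eqxx /=.
    by case/dirP: dh => ->; case/dirP: dg => -> //; rewrite /turnL /turnR /oppd /= ?eqxx ?orbT.
  have : (p, h) \in cs by exact: bcs.
  rewrite -mc !inE => /orP [/eqP [e3 e4]|->]; last by rewrite !orbT.
  by move: n4; rewrite e3 e4 -ex eqxx.
- split; first exact: gs3.
  move=> p; rewrite !inE => /orP [/eqP ->|/ctr ->]; rewrite ?eqxx ?orbT //.
- move=> t; rewrite !inE => /or4P [/eqP ->|/eqP ->|/eqP ->|/ttr].
  + by left; exists x; rewrite ?mem_head.
  + by right; exists x, (oppd g); rewrite mem_head.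
  + by right; exists y, g; rewrite inE ys orbT.
  + case=> [[p ps ->]|[p [h [ps dh ->]]]]; [left|right].
      by exists p; rewrite // inE ps orbT.
    by exists p, h; rewrite inE ps orbT.
Qed.

Lemma path_pmap (T U : eqType) (f : T -> option U) (g : U -> T) (R : rel T) x c b :
  (forall y u, f y = Some u -> g u = y) ->
  (forall y x z, f y = None -> R x y -> R y z -> R x z) ->
  path R x (rcons c (g b)) -> path R x (map g (rcons (pmap f c) b)).
Proof.
move=> fg tR; elim: c x => [|y c IH] x //= /andP [xy py].
have {}IH := IH _ py; case fy: (f y) => [a|] /=.
  by rewrite (fg _ _ fy) xy.
case: (pmap f c) IH => [|a l] /= /andP [ya pl]; rewrite ?pl andbT; exact: tR xy ya.
Qed.

Lemma cycle_pmap (T U : eqType) (f : T -> option U) (g : U -> T) (R : rel T) cs :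
  (forall y u, f y = Some u -> g u = y) ->
  (forall y x z, f y = None -> R x y -> R y z -> R x z) ->
  path.cycle R cs -> path.cycle (relpre g R) (pmap f cs).
Proof.
move=> fg tR.
have [/hasP [t tcs ft]|nh] := boolP (has (fun t => isSome (f t)) cs); last first.
  suff -> : pmap f cs = [::] by [].
  elim: cs nh => //= y c IH; rewrite negb_or => /andP [fy /IH ->].
  by case: (f y) fy.
have [i c rc] := rot_to tcs.
have erc : cs = take i cs ++ drop i cs by rewrite cat_take_drop.
rewrite -(rot_cycle i) rc erc pmap_cat cycle_catC -pmap_cat.
have -> : drop i cs ++ take i cs = t :: c by rewrite -rc.
move: ft; case ft: (f t) => [u|] // _.
rewrite /= ft -(fg _ _ ft) => /(path_pmap fg tR).
by rewrite path_map.
Qed.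

Definition ext (V : finType) (e : rel V) (O : pred V) : rel (option V) :=
  fun a b => match a, b with
  | Some x, Some y => e x y
  | Some x, None | None, Some x => O x
  | None, None => false
  end.

(* Darts are ordered pairs of neighbours; the faces are the orbits of [face]. *)
Definition face (V : eqType) (rot : V -> seq V) (d : V * V) : V * V :=
  (d.2, next (rot d.2) d.1).

Lemma rotation (V : finType) (e : rel V) : pl e -> symmetric e -> irreflexive e ->
  exists rot : V -> seq V, [/\ forall v, uniq (rot v),
    forall v w, (w \in rot v) = e v w &
    forall d, e d.1 d.2 -> pl (ext e [pred v | [exists w,
      e v w && fconnect (face rot) d (v, w)]])].
Proof.
move=> [B [gB dB tB]] se ie.
have H vw : exists pq : pt * pt, e vw.1 vw.2 ->
    [/\ pq.1 \in B vw.1, pq.2 \in B vw.2 & adjz pq.1 pq.2].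
  case: vw => v w /=; case evw : (e v w); last by exists ((0, 0), (0, 0)).
  have /touchP [x [y [xv yw xy]]] := tB _ _ isT isT evw.
  by exists (x, y).
have [f Hf] := boolp.choice H.
pose chp v w := if (enum_rank v < enum_rank w)%N then f (v, w) else ((f (w, v)).2, (f (w, v)).1).
have chpP v w : e v w -> [/\ (chp v w).1 \in B v, (chp v w).2 \in B w,
    adjz (chp v w).1 (chp v w).2 & chp w v = ((chp v w).2, (chp v w).1)].
  move=> evw; rewrite /chp; have [h1 h2 h3] := Hf (v, w) evw.
  have ewv : e w v by rewrite se.
  have [h4 h5 h6] := Hf (w, v) ewv.
  case: (ltngtP (enum_rank v) (enum_rank w)) => [_|_|/ord_inj/enum_rank_inj vw].
  - by split=> //; case: (f _).
  - by split=> //; rewrite 1?adjzC //; case: (f _).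
  - by move: evw; rewrite vw ie.
pose st v w : pt * pt := ((chp v w).1, ptB (chp v w).2 (chp v w).1).
have stP v w : e v w -> [/\ (st v w).1 \in B v, dir (st v w).2,
    trans (st v w).2 (st v w).1 \in B w &
    st w v = (trans (st v w).2 (st v w).1, oppd (st v w).2)].
  move=> /chpP [h1 h2 h3 h4]; split=> //; first exact: adj_dir.
    by rewrite trans_ptB.
  rewrite /st h4 trans_ptB /=; congr pair.
  by case: (chp v w) => [[a b] [a' b']]; rewrite /ptB /oppd /=; congr pair; ring.
have := fun v => contour (gB v isT); move/boolp.choice => [cs /boolp.choice [tr C]].
have C1 v : uniq (cs v) by have [[]] := C v.
have C2 v : path.cycle corner_next (cs v) by have [[]] := C v.
have C3 v p g : (p, g) \in cs v -> [/\ p \in B v, dir g & arm (p, g) \notin tr v].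
  by have [_ h _ _ _] := C v; apply: h.
have C4 v p g : p \in B v -> dir g -> trans g p \notin B v -> (p, g) \in cs v.
  by have [_ _ h _ _] := C v; apply: h.
have C5 v : grown (tr v) by have [_ _ _ []] := C v.
have C6 v p : p \in B v -> cen p \in tr v by have [_ _ _ [_ h] _] := C v; apply: h.
have C7 v t : t \in tr v -> (exists2 p, p \in B v & t = cen p) \/
        exists p g, [/\ p \in B v, dir g & t = arm (p, g)].
  by have [_ _ _ _ h] := C v; apply: h.
have stcs v w : e v w -> st v w \in cs v.
  move=> evw; have [h1 h2 h3 _] := stP _ _ evw.
  rewrite [st v w]surjective_pairing; apply: C4 => //; apply/negP => h4.
  by move: evw; rewrite (dB v w _ isT isT h4 h3) ie.
have st_inj v w w' : e v w -> e v w' -> st v w = st v w' -> w = w'.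
  move=> /stP [_ _ h1 _] /stP [_ _ h2 _] E.
  by apply: (dB w w' _ isT isT h1); rewrite E.
pose tgt v s := [pick w | e v w && (st v w == s)].
have tgtP v s w : tgt v s = Some w -> e v w /\ st v w = s.
  by rewrite /tgt; case: pickP => // w' /andP [h /eqP <-] [<-].
have tgt_st v w : e v w -> tgt v (st v w) = Some w.
  move=> evw; rewrite /tgt; case: pickP => [w' /andP [h1 /eqP h2]|/(_ w)].
    by rewrite (st_inj _ _ _ h1 evw h2).
  by rewrite evw eqxx.
pose rot v := pmap (tgt v) (cs v).
have mrot v w : (w \in rot v) = e v w.
  rewrite mem_pmap; apply/mapP/idP => [[s scs] /esym /tgtP [//]|evw].
  by exists (st v w); rewrite ?tgt_st ?stcs.
have urot v : uniq (rot v).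
  rewrite /rot; apply: (@pmap_uniq _ _ (tgt v) (st v)) => // s.
  by case E: (tgt v s) => [w|] //=; have [_ ->] := tgtP _ _ _ E.
exists rot; split=> // d ed.
pose Q z := iscorner z || `[< exists v s, [/\ s \in cs v, tgt v s = None & z = arm s] >].
have Qc z : iscorner z -> Q z by rewrite /Q => ->.
pose Rv : rel (pt * pt) := fun s1 s2 => `[< conn Q (rcor s1) (lcor s2) >].
have cyc v : path.cycle (relpre (st v) Rv) (rot v).
  pose R' : rel (pt * pt) := fun s1 s2 => [&& s1 \in cs v, s2 \in cs v & Rv s1 s2].
  have : path.cycle R' (cs v).
    refine (sub_in_cycle (P := mem (cs v)) (e := corner_next) _ _ (C2 v)); last by apply/allP.
    move=> s1 s2 s1c s2c /asboolP h; rewrite /R' s1c s2c /=; apply/asboolP.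
    exact: conn_sub h.
  move=> cR; have : path.cycle (relpre (st v) R') (rot v).
    apply: cycle_pmap cR => [y u /tgtP []//|y x z ty].
    move=> /and3P [xc yc /asboolP xy] /and3P [_ zc /asboolP yz].
    rewrite /R' xc zc /=; apply/asboolP; apply: (conn_trans xy).
    apply: conn_trans yz; clear xy; case: y yc ty => p g yc ty.
    have [pB dg _] := C3 _ _ _ yc.
    have Qa : Q (arm (p, g)).
      by apply/orP; right; apply/asboolP; exists v, (p, g).
    apply: (@conn_trans _ _ (arm (p, g))); apply: conn_adj => //.
    + by apply: Qc; apply: lcor_corner.
    + by rewrite adjzC; apply: adj_arm_lcor.
    + by apply: Qc; apply: rcor_corner.
    + by apply: adj_arm_rcor.
  by apply: sub_cycle => a b /and3P [].
have estep v w : e v w -> e w (next (rot w) v).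
  by move=> evw; rewrite -mrot mem_next mrot se.
have step v w : e v w -> conn Q (lcor (st v w)) (lcor (st w (next (rot w) v))).
  move=> evw; have [h1 h2 h3 h4] := stP _ _ evw.
  have vr : v \in rot w by rewrite mrot se.
  have /asboolP := next_cycle (cyc w) vr; apply: conn_trans.
  rewrite h4 [in lcor _](surjective_pairing (st v w)); apply: conn_adj.
  + by apply: Qc; apply: lcor_corner.
  + by apply: Qc; apply: rcor_corner; have [] := dir_turn h2.
  + exact: adj_lcor_rcor.
have orb k : e (iter k (face rot) d).1 (iter k (face rot) d).2 /\
    conn Q (lcor (st d.1 d.2)) (lcor (st (iter k (face rot) d).1 (iter k (face rot) d).2)).
  elim: k => [|k [h1 h2]]; first split=> //.
    apply: conn_refl; apply: Qc; rewrite [st _ _]surjective_pairing.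
    by apply: lcor_corner; have [] := stP _ _ ed.
  rewrite iterS /face /=; split; first exact: estep.
  exact: conn_trans h2 (step _ _ h1).
pose l := [seq lcor (st x.1 x.2) | x <- enum {: V * V} & fconnect (face rot) d x].
have [||blob [gb Qb sb]] := @grown_targets Q (lcor (st d.1 d.2)) l.
- by apply: Qc; rewrite [st _ _]surjective_pairing; apply: lcor_corner; have [] := stP _ _ ed.
- move=> y /mapP [x]; rewrite mem_filter => /andP [/iter_findex <- _] ->.
  by have [] := orb (findex (face rot) d x).
have : forall v, exists s, grown s /\
    s =i tr v ++ [seq arm (st v w) | w <- enum V & e v w].
  move=> v; have [|s gs es] := @grown_leaves _ [seq arm (st v w) | w <- enum V & e v w] (C5 v).
    move=> y /mapP [w]; rewrite mem_filter => /andP [evw _] ->.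
    have [h1 h2 _ _] := stP _ _ evw.
    exists (cen (st v w).1); first exact: C6.
    by rewrite [X in arm X]surjective_pairing; apply: adj_cen_arm.
  by exists s.
move/boolp.choice => [B' HB'].
have mB' v z : reflect (z \in tr v \/ exists2 w, e v w & z = arm (st v w)) (z \in B' v).
  have [_ ->] := HB' v; rewrite mem_cat; apply: (iffP orP) => -[zt|].
  - by left.
  - by move=> /mapP [w]; rewrite mem_filter => /andP [evw _] ->; right; exists w.
  - by left.
  - by case=> w evw ->; right; apply/mapP; exists w; rewrite // mem_filter evw mem_enum.
have rB' v z : z \in B' v -> (exists2 p, p \in B v & z = cen p) \/
    exists p g, [/\ p \in B v, dir g & z = arm (p, g)].
  move=> /mB' [/C7 //|[w evw ->]]; right; have [h1 h2 _ _] := stP _ _ evw.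
  by exists (st v w).1, (st v w).2; rewrite -surjective_pairing.
have dNone v z : z \in B' v -> z \in blob -> False.
  move=> zB /(allP Qb) /orP [zc|/asboolP [u [[p g] [scs ts ez]]]].
    case: (rB' _ _ zB) => [[p _ ez]|[p [g [_ dg ez]]]].
      by rewrite ez cen_corner in zc.
    by rewrite ez arm_corner in zc.
  have [pB dg nt] := C3 _ _ _ scs.
  case: (rB' _ _ zB) => [[q qB]|[q [h [qB dh]]]]; rewrite ez.
    by move=> /esym; apply: cen_arm.
  move=> /(arm_inj dg dh) [epq egh]; subst q h.
  have euv : v = u := dB _ _ _ isT isT qB pB; subst u.
  move/mB': zB; rewrite ez => -[h|[w evw]]; first by rewrite h in nt.
  have [h1 h2 _ _] := stP _ _ evw.
  rewrite [st v w]surjective_pairing => /(arm_inj dg h2) [ep eg].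
  by move: ts; rewrite ep eg -surjective_pairing tgt_st.
exists (fun o => if o is Some v then B' v else blob); split.
- by move=> [v|] _ //; have [] := HB' v.
- move=> [v|] [w|] z _ _ // zv zw.
  + congr Some; case: (rB' _ _ zv) => [[p pv ez]|[p [g [pv dg ez]]]];
    case: (rB' _ _ zw) => [[q qw]|[q [h [qw dh]]]]; rewrite ez.
    * by move=> /cen_inj epq; apply: (dB _ _ p) => //; rewrite epq.
    * by move=> /(cen_arm dh).
    * by move=> /esym /(cen_arm dg).
    * by move=> /(arm_inj dg dh) [epq _]; apply: (dB _ _ p) => //; rewrite epq.
  + by case: (dNone _ _ zv zw).
  + by case: (dNone _ _ zw zv).
- have tN v : [exists w, e v w && fconnect (face rot) d (v, w)] -> touch (B' v) blob.
    move=> /existsP [w /andP [evw cw]]; have [h1 h2 _ _] := stP _ _ evw.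
    apply/touchP; exists (arm (st v w)), (lcor (st v w)); split.
    + by apply/mB'; right; exists w.
    + apply: sb; rewrite inE; apply/orP; right.
      by apply/mapP; exists (v, w); rewrite // mem_filter cw mem_enum.
    + by rewrite [st v w]surjective_pairing; apply: adj_arm_lcor.
  move=> [v|] [w|] _ _ //=.
  + move=> evw; have [h1 h2 h3 h4] := stP _ _ evw.
    apply/touchP; exists (arm (st v w)), (arm (st w v)); split.
    * by apply/mB'; right; exists w.
    * by apply/mB'; right; exists v; rewrite // se.
    * by rewrite h4 [X in adjz (arm X) _]surjective_pairing; apply: adj_arms.
  + exact: tN.
  + by rewrite touchC; apply: tN.
Qed.

(** * Euler's inequality and edge-maximal graphs *)

Lemma connect_out (V : finType) (e : rel V) (A : {set V}) a b :
  connect e a b -> a \in A -> b \notin A ->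
  exists u w, [/\ u \in A, w \notin A & e u w].
Proof.
case/connectP=> p; elim: p a => [|x p IH] a /=; first by move=> _ -> ->.
case/andP=> ax px lb aA bA; have [xA|xA] := boolP (x \in A); first exact: IH px lb xA bA.
by exists a, x.
Qed.

Definition arcs (V : finType) (e : rel V) : nat := #|[set d : V * V | e d.1 d.2]%SET|.

(* The inequality V - E + F <= 2 holds for every rotation system of a connected
   graph. Composing with the transposition of an edge changes the number of
   cycles by one: it decreases along a spanning tree, and can only increase by
   one for each further edge. *)
Lemma euler_le (V : finType) (e : rel V) (rot : V -> seq V) :
  symmetric e -> irreflexive e -> (forall v, uniq (rot v)) ->
  (forall v w, (w \in rot v) = e v w) -> (forall v w, connect e v w) ->
  (0 < #|V|)%N -> (forall d, e d.1 d.2 -> iter 3 (face rot) d = d) ->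
  (6 * #|V| <= arcs e + 12)%N.
Proof.
move=> se ie ur mr ce V0 face3.
pose D := {d : V * V | e d.1 d.2}.
have mkP (d : V * V) : e d.1 d.2 -> e d.2 d.1 by rewrite se.
pose rv (d : D) : D := exist _ ((val d).2, (val d).1) (mkP _ (valP d)).
have nxP (d : D) : e (val d).1 (next (rot (val d).1) (val d).2).
  by rewrite -mr mem_next mr (valP d).
pose sg (d : D) : D := exist (fun d => e d.1 d.2) (_, _) (nxP d).
have sg_inj : injective sg.
  move=> d d' /(congr1 val) [e1 e2]; apply: val_inj.
  have e3 : (val d).2 = (val d').2.
    by rewrite -(prev_next (ur (val d).1) (val d).2) e2 e1 prev_next.
  by rewrite [val d]surjective_pairing [val d']surjective_pairing e1 e3.
have rvK : involutive rv by move=> d; apply: val_inj => /=; rewrite -surjective_pairing.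
pose rs (S : {set D}) (d : D) := if (d \in S) && (rv d \in S) then rv d else d.
have rs_inj S : injective (rs S).
  apply: (inv_inj (f := rs S)) => d; rewrite /rs.
  case h : ((d \in S) && (rv d \in S)); last by rewrite h.
  by rewrite rvK andbC h.
pose s (S : {set D}) : {perm D} := (perm (@rs_inj S) * perm sg_inj)%g.
have sE S d : s S d = sg (rs S d) by rewrite permM !permE.
have tail_sg d : (val (sg d)).1 = (val d).1 by [].
have n0 : (#|porbits (s finset.set0)| <= #|V|)%N.
  have tailP d d' : (d' \in porbit (s finset.set0) d) -> (val d').1 = (val d).1.
    case/porbitP=> i ->; elim: i => [|i IH]; first by rewrite expg0 perm1.
    by rewrite expgSr permM sE tail_sg /rs finset.in_set0 /= IH.
  have orbP d d' : (val d').1 = (val d).1 -> d' \in porbit (s finset.set0) d.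
    move=> tdd.
    have e2 : (val d').2 = iter (findex (next (rot (val d).1)) (val d).2 (val d').2)
                               (next (rot (val d).1)) (val d).2.
      rewrite iter_findex //.
      rewrite (fconnect_cycle (cycle_next (ur _))) mr ?(valP d) //.
      by rewrite -tdd (valP d').
    have itP i : val ((s finset.set0 ^+ i)%g d) =
        ((val d).1, iter i (next (rot (val d).1)) (val d).2).
      elim: i => [|i IH]; first by rewrite expg0 perm1 /= -surjective_pairing.
      by rewrite expgSr permM sE /rs finset.in_set0 /= IH.
    apply/porbitP; exists (findex (next (rot (val d).1)) (val d).2 (val d').2).
    by apply: val_inj; rewrite itP -e2 -tdd -surjective_pairing.
  pose g (v : V) : {set D} := [set d : D | (val d).1 == v]%SET.
  apply: leq_trans (leq_imset_card g V); apply: subset_leq_card.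
  apply/fintype.subsetP => O /imsetP [d _ ->]; apply/imsetP; exists (val d).1 => //.
  apply/finset.setP => d'; rewrite finset.inE; apply/idP/eqP; [exact: tailP|exact: orbP].
pose insd (S : {set D}) (x : D) : {set D} := (x |: (rv x |: S))%SET.
have sInsd (S : {set D}) x : x \notin S -> rv x \notin S ->
    s (insd S x) = (tperm x (rv x) * s S)%g.
  move=> xS rxS; apply/permP => d; rewrite permM !sE; congr sg.
  rewrite /rs /insd !finset.inE.
  case: tpermP => [->|->|/eqP dx /eqP drx].
  - by rewrite !eqxx orbT /= (negbTE rxS).
  - by rewrite rvK !eqxx orbT /= (negbTE xS).
  - have h1 : (rv d == x) = false by rewrite -(inj_eq (inv_inj rvK)) rvK (negbTE drx).
    have h2 : (rv d == rv x) = false by rewrite (inj_eq (inv_inj rvK)) (negbTE dx).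
    by rewrite h1 h2 (negbTE dx) (negbTE drx).
have rv_neq x : rv x != x.
  apply/eqP => /(congr1 (fun d => (val d).1)) /= e1.
  have : e (val x).1 (val x).2 := valP x.
  by rewrite /= e1 ie.
have card_insd (S : {set D}) x : x \notin S -> rv x \notin S -> #|insd S x| = #|S|.+2.
  by move=> xS rxS; rewrite /insd !cardsU1 rxS !finset.inE negb_or xS eq_sym rv_neq.
have tree k : (0 < k <= #|V|)%N -> exists (A : {set V}) (S : {set D}),
   [/\ #|A| = k, forall d, d \in S -> rv d \in S,
       forall d, d \in S -> (val d).1 \in A, #|S| = k.-1.*2 &
       (#|porbits (s S)| + k.-1 <= #|V|)%N].
  elim: k => // -[_ _|k IH /andP [_ kV]].
    have /card_gt0P [v _] := V0.
    exists [set v]%SET, finset.set0; split; rewrite ?cards1 ?cards0 ?addn0 // => d;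
      by rewrite finset.in_set0.
  have [|A [S [cA rS tS cS nS]]] := IH; first exact: ltnW.
  have /card_gt0P [a aA] : (0 < #|A|)%N by rewrite cA.
  have [b bA] : exists b, b \notin A.
    apply/existsP; rewrite -negb_forall; apply/negP => /forallP allA.
    have : (#|V| <= #|A|)%N by apply: subset_leq_card; apply/fintype.subsetP => x _.
    by rewrite cA leqNgt kV.
  have [u [w [uA wA uw]]] := connect_out (ce a b) aA bA.
  have wu : e w u by rewrite se.
  pose x : D := exist (fun d => e d.1 d.2) (w, u) wu.
  have xS : x \notin S by apply/negP => /tS; rewrite (negbTE wA).
  have rxS : rv x \notin S by apply/negP => /rS; rewrite rvK (negbTE xS).
  exists (w |: A)%SET, (insd S x); split.
  - by rewrite cardsU1 wA cA.
  - move=> d; rewrite !finset.inE => /or3P [/eqP ->|/eqP ->|/rS ->].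
    + by rewrite eqxx orbT.
    + by rewrite rvK eqxx.
    + by rewrite !orbT.
  - move=> d; rewrite !finset.inE => /or3P [/eqP ->|/eqP ->|/tS ->].
    + by rewrite eqxx.
    + by rewrite /= uA orbT.
    + by rewrite orbT.
  - by rewrite card_insd // cS.
  - have stay i : (val ((s S ^+ i)%g x)).1 = w.
      elim: i => [|i IHi]; first by rewrite expg0 perm1.
      rewrite expgSr permM sE tail_sg /rs.
      suff -> : ((s S ^+ i)%g x \in S) = false by [].
      by apply/negP => /tS; rewrite IHi (negbTE wA).
    have nyx : x \notin porbit (s S) (rv x).
      rewrite porbit_sym; apply/negP => /porbitP [i /(congr1 (fun d => (val d).1))].
      by rewrite stay /= => euw; rewrite -euw uA in wA.
    have := porbits_mul_tperm (s S) x (rv x); rewrite /= -sInsd // nyx eq_sym rv_neq /=.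
    move: nS; move: #|porbits (s S)| #|porbits (s (insd S x))| #|V| => a' b' c'.
    by clear; lia.
have full (A : {set V}) (S : {set D}) : #|A| = #|V| -> (forall d, d \in S -> rv d \in S) ->
    exists S' : {set D}, [/\ S' = finset.setT & (#|porbits (s S')|.*2 + #|S| <= #|porbits (s S)|.*2 + #|{: D}|)%N].
  move=> _; move eN : (#|{: D}| - #|S|)%N => N.
  elim/ltn_ind: N S eN => N IH S eN rS.
  have [SD|[x xS]] : S = finset.setT \/ exists x, x \notin S.
    have [/forallP allS|] := boolP [forall x, x \in S].
      by left; apply/finset.setP => x; rewrite finset.inE allS.
    by rewrite negb_forall => /existsP [x xS]; right; exists x.
    exists S; split=> //; rewrite leq_add2l; exact: max_card.
  have rxS : rv x \notin S by apply/negP => /rS; rewrite rvK (negbTE xS).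
  have cI := card_insd _ _ xS rxS.
  have cD : (#|insd S x| <= #|{: D}|)%N by apply: max_card.
  have [|||S' [eS' leS']] := IH (#|{: D}| - #|insd S x|)%N _ (insd S x).
  - by rewrite -eN cI; move: cD; rewrite cI; clear; lia.
  - by [].
  - move=> d; rewrite !finset.inE => /or3P [/eqP ->|/eqP ->|/rS ->].
    + by rewrite eqxx orbT.
    + by rewrite rvK eqxx.
    + by rewrite !orbT.
  exists S'; split=> //; have := porbits_mul_tperm (s S) x (rv x).
  rewrite /= -sInsd // => H; move: leS' H; rewrite cI; clear.
  by case: (_ \notin _); case: (_ != _); rewrite /=; lia.
have [|A [S [cA rS tS cS nS]]] := tree #|V|; first by rewrite V0 /=.
have [S' [eS' leS']] := full A S cA rS.
have sT d : val (s S' d) = face rot (val d).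
  by rewrite sE /rs eS' !finset.inE.
have orb3 (d : D) : (#|porbit (s S') d| <= 3)%N.
  have f3 : (s S' ^+ 3)%g d = d.
    have itv i : val ((s S' ^+ i)%g d) = iter i (face rot) (val d).
      elim: i => [|i IHi]; first by rewrite expg0 perm1.
      by rewrite expgSr permM sT IHi.
    by apply: val_inj; rewrite itv; apply: face3 (valP d).
  have sub : {subset porbit (s S') d <= [:: d; s S' d; s S' (s S' d)]}.
    move=> d' /porbitP [i ->]; rewrite (divn_eq i 3) expgD mulnC expgM permM.
    have -> : ((s S' ^+ 3) ^+ (i %/ 3))%g d = d.
      elim: (i %/ 3)%N => [|j IHj]; first by rewrite expg0 perm1.
      by rewrite expgSr permM IHj f3.
    have := ltn_pmod i (isT : (0 < 3)%N).
    case: (i %% 3)%N => [|[|[|//]]] _; rewrite ?expgS ?expg0 ?permM ?perm1 !inE ?eqxx ?orbT //.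
  apply: leq_trans (card_size [:: d; s S' d; s S' (s S' d)]).
  by apply: subset_leq_card; apply/fintype.subsetP.
have D3 : (#|{: D}| <= 3 * #|porbits (s S')|)%N.
  rewrite -[#|{: D}|]cardsT.
  have covT : (finset.setT : {set D}) \subset finset.cover (porbits (s S')).
    apply/fintype.subsetP => d _; apply/bigcupP; exists (porbit (s S') d).
      by apply: imset_f.
    exact: porbit_id.
  apply: leq_trans (subset_leq_card covT) _.
  apply: leq_trans (leq_card_cover _) _.
  rewrite mulnC -sum_nat_const; apply: leq_sum => O /imsetP [d _ ->]; exact: orb3.
have -> : arcs e = #|{: D}|.
  by rewrite /arcs cardsE card_sig; apply: eq_card => d; rewrite !inE.
move: nS leS' D3; rewrite cS; move: V0; clear.
move: #|V| #|{: D}| #|porbits (s S)| #|porbits (s S')| => n m a f.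
lia.
Qed.

Definition add_edge (V : finType) (e : rel V) (u v : V) : rel V :=
  [rel x y | [|| e x y, (x == u) && (y == v) | (x == v) && (y == u)]].

Lemma add_edge_sym (V : finType) (e : rel V) u v :
  symmetric e -> symmetric (add_edge e u v).
Proof.
move=> se x y; rewrite /add_edge /= se.
by case: (x == u); case: (y == v); case: (x == v); case: (y == u); case: (e y x).
Qed.

Lemma add_edge_irr (V : finType) (e : rel V) u v :
  irreflexive e -> u != v -> irreflexive (add_edge e u v).
Proof.
move=> ie uv x; rewrite /add_edge /= ie.
by have [->|_] := eqVneq x u; rewrite ?andbF ?(negbTE uv).
Qed.

Definition edge_maximal (V : finType) (e : rel V) : Prop :=
  forall u v, u != v -> ~~ e u v -> ~ pl (add_edge e u v).

Lemma maximal_connected (V : finType) (e : rel V) : pl e -> symmetric e ->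
  edge_maximal e -> forall a b, connect e a b.
Proof.
move=> ple se me a b; apply/negPn/negP => nab.
have [u [w [Au Aw plg]]] := @pl_glue V e e (connect e a) a b (pl_model _ ple) (pl_model _ ple) (connect0 _ _) nab.
apply: (me u w); first by apply: contraNneq Aw => <-.
  by apply: contra Aw => euw; apply: connect_trans Au (connect1 euw).
apply: (pl_sub (k := id) _ _ plg) => // x y /=.
have closedA p q : e p q -> connect e a p = connect e a q.
  move=> epq; apply/idP/idP => h; apply: connect_trans h (connect1 _) => //.
  by rewrite se.
case/orP=> [exy|->]; last by rewrite !orbT.
by rewrite (closedA _ _ exy) exy; case: (connect e a y); rewrite /= ?orbT.
Qed.

Lemma maximal_ext (V : finType) (e : rel V) (O : pred V) u v :
  edge_maximal e -> symmetric e -> pl (ext e O) -> O u -> O v -> u != v -> e u v.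
Proof.
move=> me se plo Ou Ov uv; apply/negPn/negP => neuv; apply: (me u v uv neuv).
apply: (pl_minor_star (k := Some) (f := fun o => if o is Some w then Some w else Some u) plo).
- by [].
- move=> [x|] w [<-]; [by left|by right].
- move=> x y /= /or3P [exy|/andP [/eqP -> /eqP ->]|/andP [/eqP -> /eqP ->]].
  + by exists (Some x), (Some y).
  + by exists None, (Some v).
  + by exists (Some v), None.
Qed.

(* Two vertices on a common face of a maximal graph are adjacent, and a new
   vertex can be joined to all the vertices of a face; so a face with four
   distinct vertices would give a planar K5. Hence all faces are triangles. *)
Lemma maximal_arcs (V : finType) (e : rel V) : pl e -> symmetric e -> irreflexive e ->
  edge_maximal e -> (2 < #|V|)%N -> (6 * #|V| <= arcs e + 12)%N.
Proof.
move=> ple se ie me V2.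
have ce := maximal_connected ple se me.
have [rot [ur mr plf]] := rotation ple se ie.
apply: (euler_le se ie ur mr ce); first by apply: leq_trans V2.
have estep v w : e v w -> e w (next (rot w) v).
  by move=> evw; rewrite -mr mem_next mr se.
pose O d : pred V := [pred v | [exists w, e v w && fconnect (face rot) d (v, w)]].
have OP d v w i : e v w -> iter i (face rot) d = (v, w) -> O d v.
  by move=> evw E; apply/existsP; exists w; rewrite evw -E fconnect_iter.
have adj d u v : e d.1 d.2 -> O d u -> O d v -> u != v -> e u v.
  move=> ed; exact: (maximal_ext me se (plf d ed)).
have nU a v : e a v -> next (rot v) a != a.
  move=> eav; apply/eqP => nva.
  have rv : forall w, e v w -> w = a.
    move=> w; rewrite -mr => wv.
    have av : a \in rot v by rewrite mr se.
    move: wv; rewrite -(fconnect_cycle (cycle_next (ur v)) av) => /iter_findex <-.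
    by elim: (findex _ _ _) => //= i ->.
  have eva : e v a by rewrite se.
  have [b [ba bv]] : exists b, b != a /\ b != v.
    apply: contrapT => H.
    suff : (#|V| <= #|[:: a; v]|)%N.
      by move/leq_trans=> /(_ _ (card_size _)) /=; rewrite leqNgt V2.
    apply: subset_leq_card; apply/fintype.subsetP => x _.
    rewrite !inE; apply/negPn/negP; rewrite negb_or => /andP [h1 h2].
    by apply: H; exists x.
  have [x xna exa] : exists2 x, x != v & e a x.
    have [||u [w [uA wA euw]]] := @connect_out V e [set a; v]%SET a b (ce a b).
    - by rewrite !finset.inE eqxx.
    - by rewrite !finset.inE negb_or ba bv.
    move: uA wA; rewrite !finset.inE negb_or => /orP [/eqP eu|/eqP eu] /andP [wa wv]; subst u.
      by exists w.
    by move: wa; rewrite (rv _ euw) eqxx.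
  have eax := estep _ _ eva; set y := next (rot a) v in eax.
  have yv : y != v.
    apply/eqP => yv; have : x = v; last by apply/eqP.
    have va : v \in rot a by rewrite mr.
    have : x \in rot a by rewrite mr.
    rewrite -(fconnect_cycle (cycle_next (ur a)) va) => /iter_findex <-.
    by elim: (findex _ _ _) => //= i ->.
  have evy : e v y.
    apply: (adj (a, v)) => //; last by rewrite eq_sym.
      by apply: (OP _ v a 1) => //; rewrite /= /face /= nva.
    apply: (OP _ y (next (rot y) a) 3); first by apply: estep.
    by rewrite /= /face /= nva.
  by move: (rv _ evy) eax => ->; rewrite ie.
have F a v : e a v -> next (rot (next (rot v) a)) v = a.
  move=> eav; set b := next (rot v) a.
  have evb : e v b := estep _ _ eav.
  set w := next (rot b) v; have ebw : e b w := estep _ _ evb.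
  have ba : b != a := nU _ _ eav.
  have wv : w != v := nU _ _ evb.
  have av : a != v by apply: contraTneq eav => ->; rewrite ie.
  have vb : v != b by apply: contraTneq evb => ->; rewrite ie.
  have bw : b != w by apply: contraTneq ebw => <-; rewrite ie.
  apply/eqP/negPn/negP => wa.
  have Oa : O (a, v) a by apply: (OP _ a v 0).
  have Ov : O (a, v) v by apply: (OP _ v b 1).
  have Ob : O (a, v) b by apply: (OP _ b w 2).
  have Ow : O (a, v) w by apply: (OP _ w (next (rot w) b) 3) => //; apply: estep.
  have A := adj (a, v) _ _ eav.
  apply: (K5_not_pl (a := Some a) (b := Some v) (c := Some b) (d := Some w) (f := None) (plf (a, v) eav)).
  - rewrite /= !inE /= !(inj_eq Some_inj) !negb_or av vb bw /= andbT.
    by rewrite eq_sym ba eq_sym wa eq_sym wv.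
  - by rewrite /= !A // eq_sym.
  - by rewrite /= !A // eq_sym.
  - by apply/and3P; split.
move=> [a v] /= eav; rewrite /face /=.
have Fa := F _ _ eav; have := F _ _ (estep _ _ eav); rewrite Fa => Fb.
by rewrite Fb.
Qed.

Lemma arcs_max (V : finType) (e : rel V) : (arcs e <= #|{: V * V}|)%N.
Proof. exact: max_card. Qed.

Lemma pl_extend (V : finType) (e : rel V) : pl e -> symmetric e -> irreflexive e ->
  (2 < #|V|)%N -> exists T : rel V, [/\ pl T, symmetric T, irreflexive T,
    subrel e T & (6 * #|V| <= arcs T + 12)%N].
Proof.
move eN : (#|{: V * V}| - arcs e)%N => N.
elim/ltn_ind: N e eN => N IH e eN ple se ie V2.
have [me|nme] := EM (edge_maximal e).
  by exists e; split=> //; apply: maximal_arcs.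
have [u [v [uv neuv pluv]]] : exists u v, [/\ u != v, ~~ e u v & pl (add_edge e u v)].
  apply: contrapT => H; apply: nme => u v uv neuv pluv; apply: H.
  by exists u, v.
have lt : (arcs e < arcs (add_edge e u v))%N.
  apply: proper_card; apply/properP; split.
    by apply/fintype.subsetP => d; rewrite !finset.inE => h; apply/orP; left.
  exists (u, v); first by rewrite finset.inE; apply/or3P; apply: Or32; rewrite !eqxx.
  by rewrite finset.inE.
have [||||||T [plT sT iT sub cT]] := IH (#|{: V * V}| - arcs (add_edge e u v))%N _ (add_edge e u v).
- by have := arcs_max (add_edge e u v); rewrite -eN; move: lt; clear; lia.
- by [].
- by [].
- by apply: add_edge_sym.
- exact: add_edge_irr.
- by [].
exists T; split=> // x y exy; by apply: sub; rewrite /add_edge /= exy.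
Qed.

(** * Sparsity *)

Definition cone (V : finType) (e : rel V) : rel (option V) := ext e predT.

Fixpoint pl_cone (s : nat) (V : finType) (e : rel V) : Prop :=
  if s is s'.+1 then pl_cone s' (cone e) else pl e.

Lemma pl_cone_minor_star s (V W : finType) (e : rel V) (e' : rel W)
    (k : W -> V) (f : V -> option W) :
  pl_cone s e -> (forall w, f (k w) = Some w) ->
  (forall v w, f v = Some w -> v = k w \/ e (k w) v) ->
  (forall w w', e' w w' -> exists v v', [/\ f v = Some w, f v' = Some w' & e v v']) ->
  pl_cone s e'.
Proof.
elim: s V W e e' k f => [|s IH] V W e e' k f; first exact: pl_minor_star.
move=> /= ple fk star ee'.
apply: (IH _ _ _ _ (omap k) (fun o => if o is Some v then omap Some (f v) else Some None) ple).
- by move=> [w|] //=; rewrite fk.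
- move=> [v|] [w|] //=; last by left.
    by case fv: (f v) => [w'|] //= [ew]; move: fv; rewrite ew => /star [->|h]; [left|right].
  by case: (f v).
- move=> [w|] [w'|] //= h.
  + by have [v [v' [h1 h2 h3]]] := ee' _ _ h; exists (Some v), (Some v'); rewrite /= h1 h2.
  + by exists (Some (k w)), None; rewrite /= fk.
  + by exists None, (Some (k w')); rewrite /= fk.
Qed.

Lemma pl_cone_sub s (V W : finType) (e : rel V) (e' : rel W) (k : W -> V) :
  injective k -> (forall w w', e' w w' -> e (k w) (k w')) -> pl_cone s e -> pl_cone s e'.
Proof.
move=> ik ee' ple.
pose f v := [pick w | k w == v].
have fk w : f (k w) = Some w.
  rewrite /f; case: pickP => [w' /eqP /ik ->//|/(_ w)]; by rewrite eqxx.
apply: (pl_cone_minor_star (k := k) (f := f) ple fk) => [v w|w w' h].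
  by rewrite /f; case: pickP => // w' /eqP <- [<-]; left.
by exists (k w), (k w'); split=> //; apply: ee'.
Qed.

Definition nbr (V : finType) (e : rel V) (x : V) : {set V} := [set y | e x y]%SET.

Lemma arcsE (V : finType) (e : rel V) : arcs e = (\sum_x #|nbr e x|)%N.
Proof.
rewrite /arcs -sum1_card.
rewrite (eq_bigl (fun d : V * V => e d.1 d.2)); last by move=> d; rewrite finset.inE.
rewrite -(pair_big_dep xpredT (fun x y => e x y) (fun _ _ => 1%N)) /=.
by apply: eq_bigr => x _; rewrite sum1_card; apply: eq_card => y; rewrite !inE.
Qed.

Lemma card_setsub (V : finType) (P : pred V) (A : {set V}) :
  #|[set x : {x | P x} | val x \in A]%SET| = #|[set x in A | P x]%SET|.
Proof.
rewrite -(card_imset _ val_inj); apply: eq_card => x; rewrite !finset.inE.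
apply/imsetP/andP => [[y]|[xA Px]]; first by rewrite finset.inE => yA ->; split=> //; apply: valP.
by exists (exist _ x Px); rewrite ?finset.inE.
Qed.

Definition sub_rel (V : finType) (P : pred V) (e : rel V) : rel {x | P x} :=
  fun x y => e (val x) (val y).

Lemma arcs_contract s (V : finType) (e : rel V) v y :
  pl_cone s e -> symmetric e -> irreflexive e -> e v y ->
  exists e' : rel {x | x != v}, [/\ pl_cone s e', symmetric e', irreflexive e' &
    (arcs e <= arcs e' + 2 + 2 * #|nbr e v :&: nbr e y|)%N].
Proof.
move=> ple se ie evy.
have yv : y != v by apply: contraTneq evy => ->; rewrite ie.
pose y' : {x | x != v} := exist _ y yv.
pose e' : rel {x | x != v} := fun a b => (a != b) && [|| e (val a) (val b),
   (a == y') && e v (val b) | (b == y') && e v (val a)].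
have se' : symmetric e'.
  move=> a b; rewrite /e' eq_sym se.
  by congr (_ && (_ || _)); rewrite orbC.
exists e'; split=> //; last 2 first.
- by move=> x; rewrite /e' eqxx.
- pose r z := if z == v then y else z.
  pose g (d : V * V) := (r d.1, r d.2).
  pose S := [set d : V * V | e d.1 d.2]%SET.
  pose C := (nbr e v :&: nbr e y)%SET.
  pose T := ([set (v, y); (y, v)] :|: [set (v, x) | x in C] :|: [set (x, v) | x in C])%SET.
  have inS d : (d \in S) = e d.1 d.2 by rewrite finset.inE.
  have inT a b : ((a, b) \in T) = [|| (a == v) && (b == y), (a == y) && (b == v),
      (a == v) && (b \in C) | (b == v) && (a \in C)].
    rewrite !finset.in_setU !finset.in_set1 !xpair_eqE -!orbA; congr [|| _, _ | _]; congr orb.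
      by apply/imsetP/andP => [[x xC [-> ->]]|[/eqP -> bC]]; [rewrite eqxx|exists b].
    by apply/imsetP/andP => [[x xC [-> ->]]|[/eqP -> bC]]; [rewrite eqxx|exists a].
  have cT : (#|T| <= 2 + 2 * #|C|)%N.
    apply: leq_trans (leq_card_setU _ _) _.
    have := leq_card_setU [set (v, y); (y, v)]%SET [set (v, x) | x in C]%SET.
    have := leq_imset_card (fun x => (v, x)) C.
    have := leq_imset_card (fun x => (x, v)) C.
    have := leq_card_setU [set (v, y)]%SET [set (y, v)]%SET.
    rewrite !cards1 => h1 h2 h3 h4.
    apply: leq_trans (leq_add (leq_trans h4 (leq_add h1 h3)) h2) _.
    by rewrite addSn mul2n -addnn addnA.
  have inC z : (z \in C) = e v z && e y z by rewrite !finset.inE.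
  have shape a b : (a, b) \in (S :\: T)%SET -> [\/ [/\ a = v, b != v & ~~ e y b],
      [/\ b = v, a != v & ~~ e y a] | a != v /\ b != v].
    rewrite finset.in_setD inS inT !inC /= => /andP [nT eab].
    have [ea|av] := eqVneq a v.
      have bv : b != v by apply: contraTneq eab => ->; rewrite ea ie.
      apply: Or31; split=> //; apply: contra nT => eyb.
      by subst a; rewrite eqxx eab eyb /= !orbT.
    have [eb|bv] := eqVneq b v; last by apply: Or33.
    apply: Or32; split=> //; apply: contra nT => eya.
    by subst b; rewrite eqxx [e v a]se eab eya /= !orbT.
  have gi : {in (S :\: T)%SET &, injective g}.
    move=> [a b] [a' b'] h h'; rewrite /g /r /=.
    have eab : e a b by move: h; rewrite finset.in_setD inS => /andP [].
    have eab' : e a' b' by move: h'; rewrite finset.in_setD inS => /andP [].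
    have yvT : (y, v) \in T by rewrite inT !eqxx /= !orbT.
    have nT p q : (p, q) \in (S :\: T)%SET -> (p, q) != (y, v).
      by apply: contraTneq => ->; rewrite finset.in_setD yvT.
    have n1 := nT _ _ h; have n2 := nT _ _ h'.
    case: (shape _ _ h) => [[ea bv ny]|[eb av ny]|[av bv]];
    case: (shape _ _ h') => [[ea' bv' ny']|[eb' av' ny']|[av' bv']];
    move: n1 n2 eab eab'; rewrite ?ea ?eb ?ea' ?eb' ?eqxx ?(negbTE av) ?(negbTE bv) ?(negbTE av') ?(negbTE bv') //.
    + by move=> _ _ _ _ [->].
    + by move=> _ n2 _ _ [ey _]; rewrite -ey eqxx in n2.
    + by move=> _ _ _ h1 [h2 h3]; rewrite -h2 -h3 (negbTE ny) in h1.
    + by move=> n1 _ _ _ [ey _]; rewrite ey eqxx in n1.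
    + by move=> _ _ _ _ [->].
    + by move=> _ _ _ h1 [h2 h3]; rewrite -h2 -h3 se (negbTE ny) in h1.
    + by move=> _ _ h1 _ [h2 h3]; rewrite h2 h3 (negbTE ny') in h1.
    + by move=> _ _ h1 _ [h2 h3]; rewrite h2 h3 se (negbTE ny') in h1.
  have sub : (g @: (S :\: T) \subset
      [set (val d.1, val d.2) | d in [set d : {x | x != v} * {x | x != v} | e' d.1 d.2]])%SET.
    apply/fintype.subsetP => d /imsetP [[a b] h ->]; rewrite /g /r /=.
    have eab : e a b by move: h; rewrite finset.in_setD inS => /andP [].
    have nT : (a, b) \notin T by move: h; rewrite finset.in_setD => /andP [].
    case: (shape _ _ h) => [[ea bv ny]|[eb av ny]|[av bv]].
    + rewrite ea eqxx (negbTE bv); apply/imsetP; exists (y', exist _ b bv) => //.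
      have evb : e v b by rewrite -ea.
      rewrite finset.inE /= /e' /= eqxx evb orbT andbT.
      apply: contra nT => /eqP /(congr1 val) /= h1.
      by rewrite inT ea -h1 !eqxx.
    + rewrite eb eqxx (negbTE av); apply/imsetP; exists (exist _ a av, y') => //.
      have eva : e v a by rewrite se -eb.
      rewrite finset.inE /= /e' /= eqxx eva !orbT andbT.
      apply: contra nT => /eqP /(congr1 val) /= h1.
      by rewrite inT eb h1 !eqxx /= orbT.
    + rewrite (negbTE av) (negbTE bv); apply/imsetP.
      exists (exist _ a av, exist _ b bv) => //; rewrite finset.inE /= /e' /= eab andbT.
      by apply: contraTneq eab => /(congr1 val) /= ->; rewrite ie.
  have := leq_trans (subset_leq_card sub) (leq_imset_card _ _).
  rewrite (card_in_imset gi) => cS.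
  have := cardsID T S; rewrite -[#|S|]/(arcs e) => <-.
  rewrite [in leqRHS]addnC addnA addnC; apply: leq_trans (leq_add cS _) _.
    exact: leq_trans (subset_leq_card (subsetIr _ _)) cT.
  by rewrite -/(arcs e') /C; move: (arcs e') #|_| => p q; clear; lia.
- pose f x : option {x | x != v} := if x == v then Some y' else insub x.
  have fval w : f (val w) = Some w by rewrite /f (negbTE (valP w)) valK.
  apply: (pl_cone_minor_star (k := val) (f := f) ple fval).
  + move=> x w; rewrite /f; case: eqVneq => [-> [<-]|xv]; first by right; rewrite /= se.
    by rewrite insubT => -[<-]; left.
  + move=> a b /andP [ab /or3P [eab|/andP [/eqP -> evb]|/andP [/eqP -> eva]]].
    * by exists (val a), (val b).
    * by exists v, (val b); split=> //; rewrite /f eqxx.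
    * by exists (val a), v; split; [exact: fval|rewrite /f eqxx|rewrite se].
Qed.

Definition arcs_le (s K : nat) : Prop := forall (V : finType) (e : rel V),
  pl_cone s e -> symmetric e -> irreflexive e -> (arcs e <= K * #|V|)%N.

(* Contracting an edge in a minimal counterexample shows that every edge lies
   in many triangles, so that the neighbourhood of a vertex, whose cone is
   also planar, is too dense. *)
Lemma arcs_le_step s K : arcs_le s.+1 K -> arcs_le s (2 * K + 2).
Proof.
move=> HK V; move cV : #|V| => n; elim/ltn_ind: n V cV => n IH V cV e ple se ie.
rewrite leqNgt; apply/negP => big.
have codeg v y : e v y -> (K < #|nbr e v :&: nbr e y|)%N.
  move=> evy; have [e' [ple' se' ie' le']] := arcs_contract ple se ie evy.
  have c' : #|{: {x | x != v}}| = n.-1.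
    by rewrite card_sig (cardC1 v) cV.
  have n0 : (0 < n)%N by rewrite -cV; apply/card_gt0P; exists v.
  have := IH n.-1 _ _ c' e' ple' se' ie'; rewrite ltn_predL => /(_ n0).
  move: big le'; move: (arcs e) (arcs e') #|_| n0 => p q r; clear.
  case: n => // n _ /=; nia.
have [v [y evy]] : exists v y, e v y.
  have : (0 < arcs e)%N by apply: leq_trans big.
  by case/card_gt0P => d; rewrite finset.inE; exists d.1, d.2.
pose N := {x | e v x}.
have plN : pl_cone s.+1 (sub_rel (P := e v) e).
  pose k (o : option N) := if o is Some x then val x else v.
  apply: (pl_cone_sub (k := k) _ _ ple).
    move=> [a|] [b|] //= h.
    - by congr Some; apply: val_inj.
    - by have := valP a; rewrite /= h ie.
    - by have := valP b; rewrite /= -h ie.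
  move=> [a|] [b|] //= _; last exact: (valP b).
  by rewrite se; apply: (valP a).
have := HK _ _ plN (fun x y => se _ _) (fun x => ie _).
apply/negP; rewrite -ltnNge arcsE.
have N0 : (0 < #|{: N}|)%N by apply/card_gt0P; exists (exist _ y evy).
apply: (@leq_trans (K.+1 * #|{: N}|)); first by rewrite ltn_mul2r N0 leqnn.
rewrite mulnC -sum_nat_const; apply: leq_sum => x _.
apply: leq_trans (codeg v (val x) (valP x)) _.
have -> : nbr (sub_rel (P := e v) e) x = [set z | val z \in nbr e (val x)]%SET.
  by apply/finset.setP => z; rewrite !finset.inE.
rewrite card_setsub; apply: subset_leq_card; apply/fintype.subsetP => z.
by rewrite !finset.inE andbC.
Qed.

Lemma arcs_le3 : arcs_le 3 0.
Proof.
move=> V e ple se ie; rewrite mul0n leqn0 cards_eq0; apply/eqP/finset.setP => -[a b].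
rewrite !finset.inE /=; apply/negP => eab.
have ab : a != b by apply: contraTneq eab => ->; rewrite ie.
apply: (K5_not_pl (a := Some (Some (Some a))) (b := Some (Some (Some b)))
  (c := Some (Some None)) (d := Some None) (f := None) ple) => //.
  by rewrite /= !inE /= !(inj_eq Some_inj) (negbTE ab).
by rewrite /= eab.
Qed.

Lemma pl_arcs (V : finType) (e : rel V) : pl e -> symmetric e -> irreflexive e ->
  (arcs e <= 14 * #|V|)%N.
Proof. exact: (arcs_le_step (arcs_le_step (arcs_le_step arcs_le3))). Qed.

Definition tri (V : finType) (e : rel V) : {set V * V * V} :=
  [set t | [&& e t.1.1 t.1.2, e t.1.2 t.2 & e t.1.1 t.2]]%SET.

Lemma pl_tri (V : finType) (e : rel V) : pl e -> symmetric e -> irreflexive e ->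
  (#|tri e| <= 588 * #|V|)%N.
Proof.
move cV : #|V| => n; elim/ltn_ind: n V cV e => n IH V cV e ple se ie.
have [n0|n0] := posnP n.
  rewrite n0 muln0 leqn0 cards_eq0; apply/eqP/finset.setP => t.
  by have /card0_eq/(_ t.2) : #|V| = 0%N by rewrite cV.
have [v dv] : exists v, (#|nbr e v| <= 14)%N.
  apply: contrapT => H; have := pl_arcs ple se ie; apply/negP; rewrite -ltnNge arcsE.
  apply: (@leq_trans (15 * #|V|)); first by rewrite ltn_mul2r cV n0.
  rewrite mulnC -sum_nat_const; apply: leq_sum => x _; rewrite ltnNge; apply/negP => h.
  by apply: H; exists x.
pose W := {x | x != v}.
have cW : #|{: W}| = n.-1 by rewrite card_sig (cardC1 v) cV.
have plW : pl (sub_rel (P := fun x => x != v) e).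
  by apply: (pl_sub (k := val) val_inj _ ple).
have := IH n.-1 _ _ cW _ plW (fun x y => se _ _) (fun x => ie _).
rewrite ltn_predL => /(_ n0) cT.
pose N := nbr e v.
have mN x : e v x -> x \in N by rewrite finset.inE.
have mN' x : e x v -> x \in N by rewrite finset.inE se.
pose A := [set (val t.1.1, val t.1.2, val t.2) | t in tri (sub_rel (P := fun x => x != v) e)]%SET.
pose B1 := [set (v, p.1, p.2) | p in finset.setX N N]%SET.
pose B2 := [set (p.1, v, p.2) | p in finset.setX N N]%SET.
pose B3 := [set (p.1, p.2, v) | p in finset.setX N N]%SET.
have sub : tri e \subset (A :|: (B1 :|: (B2 :|: B3)))%SET.
  apply/fintype.subsetP => -[[a b] c]; rewrite finset.inE /= => /and3P [ab bc ac].
  rewrite !finset.in_setU.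
  have [av|av] := eqVneq a v.
    apply/or4P/Or42/imsetP; exists (b, c); rewrite /= ?av //.
    by rewrite finset.in_setX /= !mN // -av.
  have [bv|bv] := eqVneq b v.
    apply/or4P/Or43/imsetP; exists (a, c); rewrite /= ?bv //.
    by rewrite finset.in_setX /= mN' ?mN // -bv.
  have [cv|cv] := eqVneq c v.
    apply/or4P/Or44/imsetP; exists (a, b); rewrite /= ?cv //.
    by rewrite finset.in_setX /= !mN' // -cv.
  apply/or4P/Or41/imsetP; exists (exist _ a av, exist _ b bv, exist _ c cv) => //.
  by rewrite finset.inE /sub_rel /= ab bc ac.
have cN : (#|finset.setX N N| <= 196)%N by rewrite cardsX (leq_mul dv dv).
have h1 := leq_trans (leq_imset_card (fun p => (v, p.1, p.2)) (finset.setX N N)) cN.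
have h2 := leq_trans (leq_imset_card (fun p => (p.1, v, p.2)) (finset.setX N N)) cN.
have h3 := leq_trans (leq_imset_card (fun p => (p.1, p.2, v)) (finset.setX N N)) cN.
have h0 := leq_trans (leq_imset_card (fun t : W * W * W => (val t.1.1, val t.1.2, val t.2)) _) cT.
apply: leq_trans (subset_leq_card sub) _.
apply: leq_trans (leq_card_setU _ _) _; apply: leq_trans (leq_add h0 (leq_card_setU _ _)) _.
apply: leq_trans (leq_add (leqnn _) (leq_add h1 (leq_card_setU _ _))) _.
apply: leq_trans (leq_add (leqnn _) (leq_add (leqnn _) (leq_add h2 h3))) _.
by move: n0; clear; lia.
Qed.

Lemma card_fibers (A B : finType) (S : {set A}) (T : {set B}) (f : A -> B) (K : nat) :
  (forall a, a \in S -> f a \in T) ->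
  (forall b, (#|[set a in S | f a == b]%SET| <= K)%N) -> (#|S| <= K * #|T|)%N.
Proof.
move=> fT fK; rewrite -sum1_card (partition_big f (mem T)) //=.
rewrite mulnC -sum_nat_const; apply: leq_sum => b _.
apply: leq_trans (fK b); rewrite sum1_card; apply: subset_leq_card.
by apply/fintype.subsetP => a; rewrite !finset.inE.
Qed.

Lemma supp_arcs (V : finType) (S : {set V}) (e : rel V) :
  (forall x y, e x y -> x \in S /\ y \in S) -> symmetric e -> irreflexive e ->
  pl (sub_rel (P := mem S) e) -> (arcs e <= 14 * #|S|)%N /\ (#|tri e| <= 588 * #|S|)%N.
Proof.
move=> eS se ie ple.
have cS : #|{: {x | mem S x}}| = #|S| by rewrite card_sig.
split.
  rewrite -cS; apply: leq_trans (pl_arcs ple (fun x y => se _ _) (fun x => ie _)).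
  apply: leq_trans (leq_imset_card (fun d => (val d.1, val d.2)) _).
  apply: subset_leq_card; apply/fintype.subsetP => -[a b]; rewrite finset.inE /= => ab.
  have [aS bS] := eS _ _ ab; apply/imsetP.
  by exists (exist _ a aS, exist _ b bS); rewrite ?finset.inE.
rewrite -cS; apply: leq_trans (pl_tri ple (fun x y => se _ _) (fun x => ie _)).
apply: leq_trans (leq_imset_card (fun t => (val t.1.1, val t.1.2, val t.2)) _).
apply: subset_leq_card; apply/fintype.subsetP => -[[a b] c]; rewrite finset.inE /= => /and3P [ab bc ac].
have [aS bS] := eS _ _ ab; have [_ cS'] := eS _ _ ac; apply/imsetP.
exists (exist _ a aS, exist _ b bS, exist _ c cS') => //.
by rewrite finset.inE /sub_rel /= ab bc ac.
Qed.

Lemma card_ge3 (T : finType) (A : {set T}) : (2 < #|A|)%N ->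
  exists a b c, [/\ a \in A, b \in A, c \in A & uniq [:: a; b; c]].
Proof.
move=> h; have : (2 < size (enum A))%N by rewrite -cardE.
have := enum_uniq A; have := mem_enum A.
case: (enum A) => [|a [|b [|c l]]] //= mA u _; exists a, b, c.
by rewrite -!mA !inE !eqxx !orbT; split=> //; move: u;
  rewrite !inE !negb_or => /and4P [/and3P [-> -> _] /andP [-> _] _ _].
Qed.

(* The vertices of Q are contracted into neighbours in Hi as long as this
   creates a new edge inside Hi. The others then see a triangle of the
   contracted graph, and at most two of them the same one, as K33 is not
   planar. *)
Lemma pl_high (V : finType) (e : rel V) (Hi Q : {set V}) :
  pl e -> symmetric e -> irreflexive e -> [disjoint Hi & Q] ->
  (forall q, q \in Q -> (2 < #|nbr e q :&: Hi|)%N) -> (#|Q| <= 1183 * #|Hi|)%N.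
Proof.
move=> ple se ie dis deg.
pose J (f : {ffun V -> option V}) : rel V := fun x y =>
  [&& x \in Hi, y \in Hi, x != y & [|| e x y, [exists v, (f v == Some x) && e v y] |
     [exists v, (f v == Some y) && e v x]]].
pose dom (f : {ffun V -> option V}) := [set v | f v != None]%SET.
pose ok (f : {ffun V -> option V}) := [&& dom f \subset Q,
   [forall v, forall x, (f v == Some x) ==> (x \in Hi) && e v x] & (2 * #|dom f| <= arcs (J f))%N].
have ok0 : ok [ffun=> None].
  have d0 : dom [ffun=> None] = finset.set0.
    by apply/finset.setP => v; rewrite !finset.inE ffunE.
  rewrite /ok d0 finset.sub0set cards0 muln0 andbT /=.
  by apply/forallP => v; apply/forallP => x; rewrite ffunE.
have [f /and3P [fQ /forallP fH fJ] fmax] := @arg_maxnP _ _ ok (fun f => #|dom f|) ok0.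
have {}fH v x : f v = Some x -> x \in Hi /\ e v x.
  by move=> fv; have /forallP/(_ x) := fH v; rewrite fv eqxx => /andP [].
have disx x : x \in Hi -> x \in Q -> False.
  by move=> xH xQ; have := disjointFr dis xH; rewrite xQ.
have seJ : symmetric (J f).
  move=> x y; rewrite /J se eq_sym; case: (x \in Hi); case: (y \in Hi) => //=.
  by congr (_ && (_ || _)); rewrite orbC.
have ieJ : irreflexive (J f) by move=> x; rewrite /J eqxx !andbF.
pose rest := (Q :\: dom f)%SET.
pose W := {x | (x \in Hi) || (x \in rest)}.
pose eW : rel W := fun x y => J f (val x) (val y) ||
   (e (val x) (val y) && ((val x \in rest) (+) (val y \in rest))).
have plW : pl eW.
  pose F v : option W := if insub v is Some w then Some w else
    if f v is Some x then insub x else None.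
  have Fval w : F (val w) = Some w by rewrite /F valK.
  have FHi v x (h : (x \in Hi) || (x \in rest)) : f v = Some x -> F v = Some (exist _ x h).
    move=> fv; have [xH _] := fH _ _ fv; rewrite /F insubF.
      by rewrite fv insubT.
    have vd : v \in dom f by rewrite finset.inE fv.
    have vQ : v \in Q := fintype.subsetP fQ _ vd.
    rewrite finset.in_setD vd /= orbF; apply/negP => vH; exact: disx vH vQ.
  apply: (pl_minor_star (k := val) (f := F) ple Fval).
  - move=> v w; rewrite /F; case: insubP => [u _ <- [->]|nv]; first by left.
    case fv: (f v) => [x|] //; case: insubP => // u _ ux [<-].
    by right; rewrite ux se; have [] := fH _ _ fv.
  - move=> x y /orP [/and4P [xH yH xy /or3P [exy|/existsP [v /andP [/eqP fv evy]]|/existsP [v /andP [/eqP fv evx]]]]|/andP [exy _]].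
    + by exists (val x), (val y).
    + exists v, (val y); split=> //.
      by rewrite (FHi v _ (valP x) fv); congr Some; apply: val_inj.
    + exists (val x), v; split; rewrite // 1?se //.
      by rewrite (FHi v _ (valP y) fv); congr Some; apply: val_inj.
    + by exists (val x), (val y).
have JHi x y : J f x y -> x \in Hi /\ y \in Hi by case/and4P.
have plJ : pl (sub_rel (P := mem Hi) (J f)).
  have inW (x : {x | mem Hi x}) : (val x \in Hi) || (val x \in rest).
    by apply/orP; left; apply: valP x.
  apply: (pl_sub (k := fun x => exist _ (val x) (inW x) : W) _ _ plW).
    by move=> x y [] /val_inj.
  by move=> x y h; rewrite /eW; apply/orP; left.
have [cA cT] := supp_arcs JHi seJ ieJ plJ.
have cD : (#|dom f| <= 7 * #|Hi|)%N by move: (leq_trans fJ cA); clear; lia.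
have clique q x y : q \in rest -> x \in Hi -> y \in Hi -> x != y -> e q x -> e q y -> J f x y.
  move=> qr xH yH xy qx qy; apply/negPn/negP => nJ.
  move: (qr); rewrite finset.in_setD finset.inE negbK => /andP [/eqP fq qQ].
  pose f' : {ffun V -> option V} := [ffun v => if v == q then Some x else f v].
  have dd : dom f' = (q |: dom f)%SET.
    by apply/finset.setP => v; rewrite !finset.inE ffunE; case: ifP => //= ->.
  have cdd : #|dom f'| = #|dom f|.+1 by rewrite dd cardsU1 finset.inE fq eqxx.
  suff h : ok f' by have := fmax _ h; rewrite /geq cdd /= ltnn.
  apply/and3P; split.
  - by rewrite dd finset.subUset finset.sub1set qQ.
  - apply/forallP => v; apply/forallP => z; apply/implyP; rewrite ffunE.
    case: (eqVneq v q) => [->|_] /eqP; first by case=> <-; rewrite xH qx.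
    by move=> /fH [-> ->].
  - have sJ : [set (x, y); (y, x)]%SET :|: [set d : V * V | J f d.1 d.2]%SET \subset
        [set d : V * V | J f' d.1 d.2]%SET.
      have J1 : J f' x y.
        rewrite /J xH yH xy /=; apply/or3P/Or32/existsP; exists q.
        by rewrite ffunE eqxx eqxx qy.
      have J2 : J f' y x.
        rewrite /J xH yH eq_sym xy /=; apply/or3P/Or33/existsP; exists q.
        by rewrite ffunE eqxx eqxx qy.
      apply/fintype.subsetP => -[a b]; rewrite !finset.inE !xpair_eqE /=.
      case/orP => [/orP [/andP [/eqP -> /eqP ->]|/andP [/eqP -> /eqP ->]]|] //.
      have h0 v z w : (f v == Some z) && e v w -> (f' v == Some z) && e v w.
        by rewrite ffunE; case: (eqVneq v q) => [->|//]; rewrite fq.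
      case/and4P => aH bH ab; rewrite /J aH bH ab /=.
      case/or3P => [->//|/existsP [v /h0 hv]|/existsP [v /h0 hv]].
        by apply/or3P/Or32/existsP; exists v.
      by apply/or3P/Or33/existsP; exists v.
    have := subset_leq_card sJ; rewrite -/(arcs (J f')); apply: leq_trans.
    have -> : #|[set (x, y); (y, x)]%SET :|: [set d : V * V | J f d.1 d.2]%SET| =
      (2 + arcs (J f))%N.
      rewrite finset.setUC cardsU /arcs cards2 xpair_eqE (negbTE xy) /=.
      rewrite (_ : _ :&: _ = finset.set0)%SET ?cards0 ?subn0 1?addnC //.
      apply/finset.setP => -[a b]; rewrite !finset.inE !xpair_eqE /=; apply/negP.
      case/andP=> h /orP [/andP [/eqP ea /eqP eb]|/andP [/eqP ea /eqP eb]]; subst a b.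
        by rewrite h in nJ.
      by rewrite seJ h in nJ.
    by rewrite cdd; move: fJ; clear; lia.
have pick3 q : exists t : V * V * V, q \in rest ->
    [/\ t \in tri (J f), e q t.1.1, e q t.1.2 & e q t.2].
  have [qr|] := boolP (q \in rest); last by exists (q, q, q).
  have qQ : q \in Q by move: qr; rewrite finset.in_setD => /andP [].
  have [a [b [c [aA bA cA' u]]]] := card_ge3 (deg q qQ).
  move: aA bA cA' u; rewrite !finset.inE /= !inE negb_or.
  move=> /andP [qa aH] /andP [qb bH] /andP [qc cH] /and3P [/andP [ab ac] bc _].
  exists (a, b, c) => _; split=> //; rewrite finset.inE /=.
  by apply/and3P; split; apply: (clique q).
have [t Ht] := boolp.choice pick3.
have cR : (#|rest| <= 2 * #|tri (J f)|)%N.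
  apply: (card_fibers (f := t)) => [q /Ht [] //|u]; rewrite leqNgt; apply/negP => /card_ge3.
  move=> [q1 [q2 [q3 []]]]; rewrite !finset.inE /=.
  move=> /andP [h1 /eqP t1] /andP [h2 /eqP t2] /andP [h3 /eqP t3] U.
  have r1 : q1 \in rest by rewrite !finset.inE h1.
  have r2 : q2 \in rest by rewrite !finset.inE h2.
  have r3 : q3 \in rest by rewrite !finset.inE h3.
  have [tu a1 b1 c1] := Ht _ r1; have [_ a2 b2 c2] := Ht _ r2; have [_ a3 b3 c3] := Ht _ r3.
  rewrite t1 in tu a1 b1 c1; rewrite t2 in a2 b2 c2; rewrite t3 in a3 b3 c3.
  move: tu; rewrite finset.inE => /and3P [J1 J2 J3].
  have [xH yH] := JHi _ _ J1; have [_ zH] := JHi _ _ J2.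
  have xy : u.1.1 != u.1.2 by apply: contraTneq J1 => ->; rewrite ieJ.
  have yz : u.1.2 != u.2 by apply: contraTneq J2 => ->; rewrite ieJ.
  have xz : u.1.1 != u.2 by apply: contraTneq J3 => ->; rewrite ieJ.
  have rW q : q \in rest -> (q \in Hi) || (q \in rest) by move=> ->; rewrite orbT.
  have hW x : x \in Hi -> (x \in Hi) || (x \in rest) by move=> ->.
  have hr x : x \in Hi -> (x \in rest) = false.
    by move=> xH'; apply/negP => /finset.setDP [xQ _]; exact: disx xH' xQ.
  have rh q x : q \in rest -> x \in Hi -> (q == x) = false.
    by move=> qr xH'; apply/negP => /eqP eqx; have := hr _ xH'; rewrite -eqx qr.
  have E q x (qr : q \in rest) (xH' : x \in Hi) : e q x ->
      eW (exist _ q (rW q qr)) (exist _ x (hW x xH')).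
    by move=> qx; rewrite /eW /= qx qr hr // orbT.
  pose w q (qr : q \in rest) : W := exist _ q (rW q qr).
  pose w' x (xH' : x \in Hi) : W := exist _ x (hW x xH').
  apply: (@K33_not_pl _ _ (w _ r1) (w _ r2) (w _ r3) (w' _ xH) (w' _ yH) (w' _ zH) plW).
  - rewrite -(map_inj_uniq val_inj) /= !inE (rh _ _ r1 xH) (rh _ _ r1 yH) (rh _ _ r1 zH).
    rewrite (rh _ _ r2 xH) (rh _ _ r2 yH) (rh _ _ r2 zH).
    rewrite (rh _ _ r3 xH) (rh _ _ r3 yH) (rh _ _ r3 zH) /= !orbF.
    by move: U; rewrite /= !inE !negb_or xy xz yz /= !andbT.
  - by rewrite !E.
  - by rewrite !E.
  - by rewrite !E.
have := cardsID (dom f) Q; rewrite -/rest => <-.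
have := subset_leq_card (subsetIr Q (dom f)).
by move: cR cT cD; move: #|_| #|_| #|_| #|_| #|_|; clear; lia.
Qed.

(** * From lattice minors to plane drawings *)

Definition clamp (R : realType) (a : R) : R := (`|a| - `|a - 1| + 1) / 2.

(* [squeeze a s] is the increasing piecewise affine function of [a] which is the
   identity outside [0, 2] and maps [0, 1] onto [0, s]. *)
Definition squeeze (R : realType) (a s : R) : R :=
  (a - `|a|) / 2 + s * clamp a + (2 - s) * clamp (a - 1) + (a - 2 + `|a - 2|) / 2.

Lemma clamp_le0 (R : realType) (a : R) : a <= 0 -> clamp a = 0.
Proof. by move=> h; rewrite /clamp ler0_norm // ler0_norm; lra. Qed.

Lemma clamp_id (R : realType) (a : R) : 0 <= a -> a <= 1 -> clamp a = a.
Proof. by move=> h h'; rewrite /clamp ger0_norm // ler0_norm; lra. Qed.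

Lemma clamp_ge1 (R : realType) (a : R) : 1 <= a -> clamp a = 1.
Proof. by move=> h; rewrite /clamp !ger0_norm; lra. Qed.

Lemma clamp_bound (R : realType) (a : R) : 0 <= clamp a /\ clamp a <= 1.
Proof.
have [h|h] := leP a 0; first by rewrite clamp_le0 //; lra.
have [h'|h'] := leP a 1; first by rewrite clamp_id //; lra.
by rewrite clamp_ge1; lra.
Qed.

Lemma clamp_continuous (R : realType) : continuous (@clamp R).
Proof.
move=> x; rewrite /clamp; apply: cvgM; last exact: cvg_cst.
apply: cvgD; last exact: cvg_cst.
apply: cvgB; first exact: norm_continuous.
apply: cvg_norm; apply: cvgB; [exact: cvg_id|exact: cvg_cst].
Qed.

Lemma squeezeE (R : realType) (a s : R) :
  [\/ a <= 0 /\ squeeze a s = a, 0 <= a <= 1 /\ squeeze a s = s * a,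
      1 <= a <= 2 /\ squeeze a s = s + (a - 1) * (2 - s) | 2 <= a /\ squeeze a s = a].
Proof.
have [h|h] := leP a 0.
  apply: Or41; split=> //; rewrite /squeeze ler0_norm // clamp_le0 // clamp_le0; last lra.
  by rewrite ler0_norm; lra.
have [h1|h1] := leP a 1.
  apply: Or42; split; first lra.
  rewrite /squeeze ger0_norm; last lra.
  rewrite clamp_id ?clamp_le0; try lra.
  by rewrite ler0_norm; lra.
have [h2|h2] := leP a 2.
  apply: Or43; split; first lra.
  rewrite /squeeze ger0_norm; last lra.
  rewrite clamp_ge1 ?clamp_id; try lra.
  by rewrite ler0_norm; lra.
apply: Or44; split; first lra.
rewrite /squeeze ger0_norm; last lra.
rewrite clamp_ge1 ?clamp_ge1; try lra.
by rewrite ger0_norm; lra.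
Qed.

Lemma squeeze_inj (R : realType) (a a' s : R) : 0 <= s <= 1 ->
  squeeze a s = squeeze a' s -> a = a' \/ [/\ s = 0, 0 <= a <= 1 & 0 <= a' <= 1].
Proof.
move=> /andP [s0 s1]; wlog le : a a' / a <= a'.
  move=> H E; have [h|h] := leP a a'; first exact: H.
  by case: (H a' a (ltW h) (esym E)) => [->|[h1 h2 h3]]; [left|right].
have [->|sn0] := eqVneq s 0.
  case: (squeezeE a 0) => -[h ->]; case: (squeezeE a' 0) => -[h' ->] E; 
    (left; lra) || (right; split; lra).
have sp : 0 < s by rewrite lt_neqAle eq_sym sn0.
by case: (squeezeE a s) => -[h ->]; case: (squeezeE a' s) => -[h' ->] E; left; nra.
Qed.

Lemma squeeze_out (R : realType) (a s : R) : a <= 0 \/ 2 <= a -> squeeze a s = a.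
Proof.
case: (squeezeE a s) => -[h ->] // H.
  by have -> : a = 0 by [lra]; rewrite mulr0.
by have -> : a = 2 by [lra]; ring.
Qed.

Lemma squeeze1 (R : realType) (a : R) : squeeze a 1 = a.
Proof. by case: (squeezeE a 1) => -[h ->]; lra. Qed.

Definition iota2 (R : realType) (p : pt) : R * R := (p.1%:~R, p.2%:~R).

Lemma iota2_inj (R : realType) : injective (@iota2 R).
Proof. by move=> [a b] [c d] [] /intr_inj -> /intr_inj ->. Qed.

Definition loc (R : realType) (y g : pt) (z : R * R) : R * R :=
  ((z.1 - y.1%:~R) * g.1%:~R + (z.2 - y.2%:~R) * g.2%:~R,
   (z.2 - y.2%:~R) * g.1%:~R - (z.1 - y.1%:~R) * g.2%:~R).

Definition unloc (R : realType) (y g : pt) (w : R * R) : R * R :=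
  (y.1%:~R + w.1 * g.1%:~R - w.2 * g.2%:~R, y.2%:~R + w.1 * g.2%:~R + w.2 * g.1%:~R).

Lemma locK (R : realType) (y g : pt) (z : R * R) : dir g -> unloc y g (loc y g z) = z.
Proof. by case: z => [a b] /dirP [] ->; rewrite /unloc /loc /=; congr pair; lra. Qed.

Lemma unlocK (R : realType) (y g : pt) (z : R * R) : dir g -> loc y g (unloc y g z) = z.
Proof. by case: z => [a b] /dirP [] ->; rewrite /unloc /loc /=; congr pair; lra. Qed.

(* A continuous map of the plane that collapses the unit segment from y in the
   direction g onto y, is injective elsewhere, and is the identity outside a
   small neighbourhood of the continuation of this segment. *)
Definition collapse (R : realType) (y g : pt) (z : R * R) : R * R :=
  unloc y g (squeeze (loc y g z).1 (clamp (2 * `|(loc y g z).2|)), (loc y g z).2).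

Lemma continuous_pair (R : realType) (T : topologicalType) (f g : T -> R) :
  continuous f -> continuous g -> continuous (fun z => (f z, g z)).
Proof. by move=> cf cg z; exact: (cvg_pair (cf z) (cg z)). Qed.

Lemma continuous_fst (R : realType) : continuous (fun z : R * R => z.1).
Proof. by move=> [a b] A hA; exact: (@cvg_fst R R (nbhs a) (nbhs b) _ A hA). Qed.

Lemma continuous_snd (R : realType) : continuous (fun z : R * R => z.2).
Proof. by move=> [a b] A hA; exact: (@cvg_snd R R (nbhs a) (nbhs b) _ A hA). Qed.

Lemma continuous_affine2 (R : realType) (T : topologicalType) (f g : T -> R) (a b c : R) :
  continuous f -> continuous g -> continuous (fun z => a * f z + b * g z + c).
Proof.
move=> cf cg z; apply: cvgD; last exact: cvg_cst.
by apply: cvgD; (apply: cvgM; first exact: cvg_cst); [exact: cf|exact: cg].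
Qed.

Lemma loc_continuous (R : realType) (y g : pt) : continuous (@loc R y g).
Proof.
have c1 := @continuous_fst R; have c2 := @continuous_snd R.
have -> : @loc R y g = (fun z => (
    g.1%:~R * z.1 + g.2%:~R * z.2 + (- y.1%:~R * g.1%:~R - y.2%:~R * g.2%:~R),
    - g.2%:~R * z.1 + g.1%:~R * z.2 + (y.1%:~R * g.2%:~R - y.2%:~R * g.1%:~R))).
  by apply/funext => z; rewrite /loc; congr pair; ring.
by apply: continuous_pair; apply: continuous_affine2.
Qed.

Lemma unloc_continuous (R : realType) (y g : pt) : continuous (@unloc R y g).
Proof.
have c1 := @continuous_fst R; have c2 := @continuous_snd R.
have -> : @unloc R y g = (fun z => (
    g.1%:~R * z.1 + - g.2%:~R * z.2 + y.1%:~R,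
    g.2%:~R * z.1 + g.1%:~R * z.2 + y.2%:~R)).
  by apply/funext => z; rewrite /unloc; congr pair; ring.
by apply: continuous_pair; apply: continuous_affine2.
Qed.

Lemma continuous_compose (S T U : topologicalType) (f : S -> T) (h : T -> U) :
  continuous f -> continuous h -> continuous (fun z => h (f z)).
Proof. by move=> cf ch z; exact: (continuous_comp (cf z) (ch (f z))). Qed.

Lemma collapse_continuous (R : realType) (y g : pt) : continuous (@collapse R y g).
Proof.
have c1 := @continuous_fst R; have c2 := @continuous_snd R.
pose C (h : R * R -> R) := continuous h.
have cc (c : R) : C (fun _ => c) by move=> z; exact: cvg_cst.
have cD h k : C h -> C k -> C (fun z => h z + k z) by move=> ch ck z; exact: (cvgD (ch z) (ck z)).
have cB h k : C h -> C k -> C (fun z => h z - k z) by move=> ch ck z; exact: (cvgB (ch z) (ck z)).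
have cM h k : C h -> C k -> C (fun z => h z * k z) by move=> ch ck z; exact: (cvgM (ch z) (ck z)).
have cA h : C h -> C (fun z => `|h z|) by move=> ch z; exact: (cvg_norm (ch z)).
have ck h : C h -> C (fun z => clamp (h z)).
  by move=> ch; exact: (continuous_compose ch (@clamp_continuous R)).
have cs : C (fun z => squeeze z.1 (clamp (2 * `|z.2|))).
  have cs : C (fun z => clamp (2 * `|z.2|)) by apply: (ck _); apply: (cM _ _) => //; apply: (cA _).
  rewrite /squeeze; apply: (cD _ _); first apply: (cD _ _); first apply: (cD _ _).
  - by apply: (cM _ _) => //; apply: (cB _ _) => //; apply: (cA _).
  - by apply: (cM _ _) => //; apply: (ck _).
  - by apply: (cM _ _); [apply: (cB _ _)|apply: (ck _); apply: (cB _ _)].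
  - by apply: (cM _ _) => //; apply: (cD _ _); [apply: (cB _ _)|apply: (cA _); apply: (cB _ _)].
have cG := continuous_pair cs c2.
exact: (continuous_compose (continuous_compose (@loc_continuous R y g) cG) (@unloc_continuous R y g)).
Qed.

Definition inseg (R : realType) (p q : pt) (z : R * R) : Prop :=
  exists t : R, [/\ 0 <= t <= 1, z.1 = p.1%:~R + t * (q.1 - p.1)%:~R &
    z.2 = p.2%:~R + t * (q.2 - p.2)%:~R].

Definition trace (R : realType) (s : seq pt) (z : R * R) : Prop :=
  exists p q, [/\ p \in s, q \in s, (p == q) || adjz p q & inseg p q z].

Lemma collapse_inj (R : realType) (y x : pt) (z z' : R * R) : adjz y x ->
  collapse y (ptB x y) z = collapse y (ptB x y) z' ->
  z = z' \/ inseg y x z /\ inseg y x z'.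
Proof.
move=> yx; have dg := adj_dir yx; rewrite /collapse.
move: (@locK R y _ z dg) (@locK R y _ z' dg).
move: (loc y _ z) (loc y _ z') => [a b] [a' b'] e1 e2 /(congr1 (@loc R y (ptB x y))).
rewrite !unlocK //= => -[+ eb]; rewrite -{}eb in e2 *.
move=> /squeeze_inj; case; first exact/andP/clamp_bound.
  by move=> ea; left; rewrite -e1 -e2 ea.
move=> [c0 h h']; right.
have b0 : b = 0.
  apply/eqP; rewrite -normr_eq0; apply/eqP.
  have [h1|h1] := leP (2 * `|b|) 1.
    by move: c0; rewrite clamp_id //; have := normr_ge0 b; lra.
  by move: c0; rewrite clamp_ge1; lra.
rewrite b0 in e1 e2; split; [exists a|exists a']; split=> //.
- by rewrite -e1 /= mul0r subr0.
- by rewrite -e1 /= mul0r addr0.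
- by rewrite -e2 /= mul0r subr0.
- by rewrite -e2 /= mul0r addr0.
Qed.

Lemma collapse_seg (R : realType) (y x : pt) (z : R * R) : adjz y x ->
  inseg y x z -> collapse y (ptB x y) z = iota2 R y.
Proof.
move=> yx [t [/andP [t0 t1] e1 e2]]; have dg := adj_dir yx.
have : loc y (ptB x y) z = (t, 0).
  rewrite /loc e1 e2 /=.
  case/dirP: dg => -[-> ->]; congr pair; lra.
rewrite /collapse => -> /=; rewrite normr0 mulr0 clamp_le0 //.
have -> : squeeze t 0 = 0.
  by case: (squeezeE t 0) => -[h ->]; lra.
by rewrite /unloc /= !mul0r subr0 !addr0.
Qed.

Lemma conv_le (R : realType) (a b c t : R) : 0 <= t -> t <= 1 -> a <= c -> b <= c ->
  (1 - t) * a + t * b <= c.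
Proof.
move=> t0 t1 ac bc; have h1 : 0 <= (1 - t) * (c - a) by apply: mulr_ge0; lra.
have h2 : 0 <= t * (c - b) by apply: mulr_ge0; lra.
by lra.
Qed.

Lemma conv_ge (R : realType) (a b c t : R) : 0 <= t -> t <= 1 -> c <= a -> c <= b ->
  c <= (1 - t) * a + t * b.
Proof.
move=> t0 t1 ac bc; have := conv_le (a := - a) (b := - b) (c := - c) t0 t1.
by rewrite !lerN2 !mulrN -opprD lerN2; apply.
Qed.

Definition loci (y g p : pt) : int := (p.1 - y.1) * g.1 + (p.2 - y.2) * g.2.
Definition locj (y g p : pt) : int := (p.2 - y.2) * g.1 - (p.1 - y.1) * g.2.

Lemma loc_key (y g p q : pt) : dir g -> p != trans g y -> q != trans g y ->
  (p == q) || adjz p q ->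
  (loci y g p <= 0 /\ loci y g q <= 0) \/ (2 <= loci y g p /\ 2 <= loci y g q) \/
  (1 <= locj y g p /\ 1 <= locj y g q) \/ (locj y g p <= -1 /\ locj y g q <= -1).
Proof.
case: y p q => [y1 y2] [p1 p2] [q1 q2].
by case/dirP => ->; rewrite /adjz /loci /locj /trans !xpair_eqE /=; lia.
Qed.

Lemma collapse_trace (R : realType) (y x : pt) (s : seq pt) (z : R * R) : adjz y x ->
  x \notin s -> trace s z -> collapse y (ptB x y) z = z.
Proof.
move=> yx xs [p [q [ps qs pq [t [/andP [t0 t1] e1 e2]]]]].
have dg := adj_dir yx; set g := ptB x y in dg *.
have px : p <> x by move=> e; rewrite e (negbTE xs) in ps.
have qx : q <> x by move=> e; rewrite e (negbTE xs) in qs.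
suff H : [\/ (loc y g z).1 <= 0, 2 <= (loc y g z).1 | 1 <= `|(loc y g z).2| ].
  rewrite /collapse; suff -> : squeeze (loc y g z).1 (clamp (2 * `|(loc y g z).2|)) = (loc y g z).1.
    by rewrite -surjective_pairing locK.
  case: H => h; last by rewrite clamp_ge1 ?squeeze1 //; lra.
    by apply: squeeze_out; left.
  by apply: squeeze_out; right.
have ez1 : (loc y g z).1 = (loci y g p)%:~R + t * ((loci y g q)%:~R - (loci y g p)%:~R).
  by rewrite /loc /loci /= e1 e2 !(rmorphB, rmorphD, rmorphM) /=; ring.
have ez2 : (loc y g z).2 = (locj y g p)%:~R + t * ((locj y g q)%:~R - (locj y g p)%:~R).
  by rewrite /loc /locj /= e1 e2 !(rmorphB, rmorphD, rmorphM) /=; ring.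
have px' : p != trans g y by rewrite trans_ptB; apply/eqP.
have qx' : q != trans g y by rewrite trans_ptB; apply/eqP.
have cast0 (k : int) : k <= 0 -> k%:~R <= 0 :> R by rewrite -(ler_int R).
have cast2 (k : int) : 2 <= k -> 2 <= k%:~R :> R by rewrite -(ler_int R).
have cast1 (k : int) : 1 <= k -> 1 <= k%:~R :> R by rewrite -(ler_int R).
have castN (k : int) : k <= -1 -> k%:~R <= -1 :> R by rewrite -(ler_int R).
have conv (a b : R) : a + t * (b - a) = (1 - t) * a + t * b by ring.
rewrite ez1 ez2 !conv.
case: (loc_key dg px' qx' pq) => [[h h']|[[h h']|[[h h']|[h h']]]].
- by apply: Or31; apply: conv_le => //; apply: cast0.
- by apply: Or32; apply: conv_ge => //; apply: cast2.
- apply: Or33; apply: le_trans (ler_norm _).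
  by apply: conv_ge => //; apply: cast1.
- apply: Or33; rewrite -normrN; apply: le_trans (ler_norm _); rewrite lerNr.
  by apply: conv_le => //; apply: castN.
Qed.

Lemma unit_step (p q : pt) : (p == q) || adjz p q ->
  exists d : pt, (d = (0, 0) \/ dir d) /\ q = trans d p.
Proof.
case/orP=> [/eqP ->|pq].
  by exists (0, 0); rewrite /trans /= !addr0 -surjective_pairing; split=> //; left.
by exists (ptB q p); rewrite trans_ptB; split=> //; right; apply: adj_dir.
Qed.

Lemma int_between (R : realType) (k : int) (a b : int) :
  (a%:~R : R) < k%:~R -> k%:~R < (b%:~R : R) -> a < k /\ k < b.
Proof. by rewrite !ltr_int. Qed.

Lemma int_near (R : realType) (k d : int) (t : R) : 0 <= t -> t <= 1 ->
  `|t * d%:~R - k%:~R| < 1 -> [\/ d = 0, d = 1 | d = -1] ->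
  (k = 0 /\ (d <> 0 -> t < 1)) \/ (k = d /\ (d <> 0 -> 0 < t)).
Proof.
rewrite ltr_norml => t0 t1 /andP [h1 h2] hd.
have [] := @int_between R k (-2) 2; rewrite ?rmorphN /=.
- by case: hd h1 h2 => -> h1 h2; lra.
- by case: hd h1 h2 => -> h1 h2; lra.
move=> k1 k2; have : [\/ k = 0, k = 1 | k = -1].
  have [->|[->|->]] : k = 0 \/ k = 1 \/ k = -1 by lia.
  - exact: Or31. - exact: Or32. - exact: Or33.
case: hd h1 h2 => -> h1 h2; case=> hk; rewrite hk /= in h1 h2 *; try lra.
- by left.
- by left; split=> // _; lra.
- by right; split=> // _; lra.
- by left; split=> // _; lra.
- by right; split=> // _; lra.
Qed.

Lemma near_end (R : realType) (p q r : pt) (t : R) (z : R * R) :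
  (p == q) || adjz p q -> 0 <= t <= 1 ->
  z.1 = p.1%:~R + t * (q.1 - p.1)%:~R -> z.2 = p.2%:~R + t * (q.2 - p.2)%:~R ->
  `|z.1 - r.1%:~R| < 1 -> `|z.2 - r.2%:~R| < 1 ->
  (r = p /\ (p <> q -> t < 1)) \/ (r = q /\ (p <> q -> 0 < t)).
Proof.
move=> /unit_step [d [hd ->]] /andP [t0 t1] -> ->.
case: p r d hd => [p1 p2] [r1 r2] [d1 d2] hd; rewrite /trans /=.
have -> : p1 + d1 - p1 = d1 by ring.
have -> : p2 + d2 - p2 = d2 by ring.
have E (x y k : int) : x%:~R + t * k%:~R - y%:~R = t * k%:~R - (y - x)%:~R :> R.
  by rewrite rmorphB /=; ring.
rewrite !{}E.
have -> : (r1, r2) = (p1 + (r1 - p1), p2 + (r2 - p2)) by congr pair; ring.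
move: (r1 - p1) (r2 - p2) => k1 k2 h1 h2.
have := int_near t0 t1 h1; have := int_near t0 t1 h2.
have [hd1 hd2] : [\/ d1 = 0, d1 = 1 | d1 = -1] /\ [\/ d2 = 0, d2 = 1 | d2 = -1].
  case: hd => [[-> ->]|/dirP [] [-> ->]]; split;
  (apply: Or31; by []) || (apply: Or32; by []) || (apply: Or33; by []).
move=> /(_ hd2) H2 /(_ hd1) H1.
case: hd => [[e1 e2]|hd].
  rewrite e1 e2 in H1 H2 *.
  left; split; last by rewrite !addr0.
  by case: H1 => [[-> _]|[-> _]]; case: H2 => [[-> _]|[-> _]]; rewrite !addr0.
have dz : d1 = 0 /\ d2 <> 0 \/ d2 = 0 /\ d1 <> 0.
  by case/dirP: hd => -[-> ->]; [left|right|left|right].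
case: dz => -[e0 en]; rewrite e0 in H1 H2 *.
- have -> : k1 = 0 by case: H1 => [[]|[]].
  case: H2 => -[-> h]; [left|right]; split=> //.
  + by rewrite !addr0.
  + by move=> _; apply: h.
  + by move=> _; apply: h.
- have -> : k2 = 0 by case: H2 => [[]|[]].
  case: H1 => -[-> h]; [left|right]; split=> //.
  + by rewrite !addr0.
  + by move=> _; apply: h.
  + by move=> _; apply: h.
Qed.

Lemma seg_cross (R : realType) (a b p q : pt) (t : R) (z : R * R) :
  adjz a b -> (p == q) || adjz p q -> 0 <= t <= 1 ->
  z.1 = a.1%:~R + t * (b.1 - a.1)%:~R -> z.2 = a.2%:~R + t * (b.2 - a.2)%:~R ->
  inseg p q z ->
  [\/ t = 0 /\ (a = p \/ a = q), t = 1 /\ (b = p \/ b = q), p = a /\ q = b | p = b /\ q = a].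
Proof.
move=> ab pq t01 z1 z2 [s [s01 y1 y2]].
have ab' : (a == b) || adjz a b by rewrite ab orbT.
have anb : a <> b.
  by move=> e; move: ab; rewrite e; case: (b) => [b1 b2]; rewrite /adjz /=; lia.
have [t0|tn0] := eqVneq t 0.
  apply: Or41; split=> //.
  have [||[? _]|[? _]] := near_end (r := a) pq s01 y1 y2; try by [left|right].
  - by rewrite z1 t0 mul0r addr0 subrr normr0.
  - by rewrite z2 t0 mul0r addr0 subrr normr0.
have [t1|tn1] := eqVneq t 1.
  apply: Or42; split=> //.
  have [||[? _]|[? _]] := near_end (r := b) pq s01 y1 y2; try by [left|right].
  - rewrite z1 t1 rmorphB /=.
    have -> : a.1%:~R + 1 * (b.1%:~R - a.1%:~R) - b.1%:~R = 0 :> R by ring.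
    by rewrite normr0.
  - rewrite z2 t1 rmorphB /=.
    have -> : a.2%:~R + 1 * (b.2%:~R - a.2%:~R) - b.2%:~R = 0 :> R by ring.
    by rewrite normr0.
have /andP [t0 t1] := t01.
have noint (r : pt) : z.1 = r.1%:~R -> z.2 = r.2%:~R -> False.
  move=> e1 e2; have [||[er _]|[er _]] := near_end (r := r) ab' t01 z1 z2.
  - by rewrite e1 subrr normr0.
  - by rewrite e2 subrr normr0.
  - have [d [hd eb]] := unit_step ab'; move: z1 z2; rewrite e1 e2 er eb /trans /=.
    rewrite ![_ + _ - _]addrAC !subrr !add0r => h1 h2.
    have {}h1 : t * d.1%:~R = 0 by lra.
    have {}h2 : t * d.2%:~R = 0 by lra.
    move: h1 h2 => /eqP + /eqP; rewrite !mulf_eq0 (negbTE tn0) !intr_eq0 /= => /eqP g1 /eqP g2.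
    by apply: anb; rewrite eb /trans g1 g2 !addr0 -surjective_pairing.
  - have [d [hd eb]] := unit_step ab'; move: z1 z2; rewrite e1 e2 er eb /trans /=.
    rewrite ![_ + _ - _]addrAC !subrr !add0r !rmorphD /= => h1 h2.
    have {}h1 : (1 - t) * d.1%:~R = 0 by lra.
    have {}h2 : (1 - t) * d.2%:~R = 0 by lra.
    move: h1 h2 => /eqP + /eqP; rewrite !mulf_eq0 subr_eq0 eq_sym (negbTE tn1) !intr_eq0 /= => /eqP g1 /eqP g2.
    by apply: anb; rewrite eb /trans g1 g2 !addr0 -surjective_pairing.
have [d [hd eq]] := unit_step pq.
have dn : d <> (0, 0).
  by move=> e; apply: (noint p); rewrite ?y1 ?y2 eq e /trans /= addr0 subrr mulr0 addr0.
have {}hd : dir d by case: hd.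
have dd : `|d.1%:~R : R| <= 1 /\ `|d.2%:~R : R| <= 1.
  by case/dirP: hd => -> /=; rewrite ?normr0 ?normr1 ?rmorphN ?normrN ?normr1 ?lexx ?ler01.
have [s0 s1] : 0 < s /\ s < 1.
  have /andP [h0 h1] := s01; split.
    rewrite lt_neqAle h0 andbT; apply/eqP => e; apply: (noint p).
      by rewrite y1 -e mul0r addr0.
    by rewrite y2 -e mul0r addr0.
  rewrite lt_neqAle h1 andbT; apply/eqP => e; apply: (noint q).
    by rewrite y1 e mul1r rmorphB /= addrC subrK.
  by rewrite y2 e mul1r rmorphB /= addrC subrK.
have np (x : R) : `|x| <= 1 -> `|s * x| < 1.
  move=> hx; rewrite normrM ger0_norm ?ltW //.
  by have := normr_ge0 x; nra.
have nq (x : R) : `|x| <= 1 -> `|(s - 1) * x| < 1.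
  move=> hx; rewrite normrM ler0_norm; last lra.
  by have := normr_ge0 x; nra.
have [dd1 dd2] := dd.
have [eq1 eq2] : q.1 - p.1 = d.1 /\ q.2 - p.2 = d.2 by rewrite eq /trans /=; split; ring.
have ep : p = a \/ p = b.
  have [||[? _]|[? _]] := near_end (r := p) ab' t01 z1 z2; try by [left|right].
  - rewrite y1 eq1.
    have -> : p.1%:~R + s * d.1%:~R - p.1%:~R = s * d.1%:~R :> R by ring.
    exact: np.
  - rewrite y2 eq2.
    have -> : p.2%:~R + s * d.2%:~R - p.2%:~R = s * d.2%:~R :> R by ring.
    exact: np.
have eq' : q = a \/ q = b.
  have [||[? _]|[? _]] := near_end (r := q) ab' t01 z1 z2; try by [left|right].
  - rewrite y1 eq1 eq /trans rmorphD /=.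
    have -> : p.1%:~R + s * d.1%:~R - (p.1%:~R + d.1%:~R) = (s - 1) * d.1%:~R :> R by ring.
    exact: nq.
  - rewrite y2 eq2 eq /trans rmorphD /=.
    have -> : p.2%:~R + s * d.2%:~R - (p.2%:~R + d.2%:~R) = (s - 1) * d.2%:~R :> R by ring.
    exact: nq.
have pnq : p <> q.
  move=> e; apply: dn; have := eq; rewrite -e; case: (p) (d) => [p1 p2] [d1 d2].
  by rewrite /trans /= => -[h1 h2]; congr pair; [clear -h1|clear -h2]; lia.
case: ep => ep; case: eq' => eq'; first by case: pnq; rewrite ep eq'.
- exact: Or43.
- exact: Or44.
- by case: pnq; rewrite ep eq'.
Qed.

Local Open Scope classical_set_scope.
Local Open Scope ring_scope.

(* A drawing in which the vertex v is blown up to the lattice tree B v. *)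
Definition drawn (R : realType) n (E : edge_set n) (B : 'I_n -> seq pt)
    (g : {set 'I_n} -> R -> R * R) : Prop :=
  [/\ forall v, grown (B v),
      forall u v x, x \in B u -> x \in B v -> u = v,
      forall e, e \in E -> exists u w a b,
        [/\ [/\ e = [set u; w]%SET, u != w, a \in B u & b \in B w],
            {within `[0, 1]%classic, continuous (g e)},
            forall t t', 0 <= t <= 1 -> 0 <= t' <= 1 -> g e t = g e t' -> t = t',
            g e 0 = iota2 R a /\ g e 1 = iota2 R b &
            forall t v, 0 <= t <= 1 -> trace (B v) (g e t) -> (t = 0 /\ v = u) \/ (t = 1 /\ v = w)] &
      forall e e' t t', e \in E -> e' \in E -> e != e' -> 0 <= t <= 1 -> 0 <= t' <= 1 ->
        g e t = g e' t' -> t = 0 \/ t = 1].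

Lemma trace_point (R : realType) s p : p \in s -> trace s (iota2 R p).
Proof.
move=> ps; exists p, p; split; rewrite ?eqxx //; exists 0.
by rewrite lexx ler01 !mul0r !addr0.
Qed.

Lemma trace_sub (R : realType) s s' (z : R * R) : {subset s <= s'} -> trace s z -> trace s' z.
Proof. by move=> ss [p [q [ps qs pq h]]]; exists p, q; split; rewrite ?ss. Qed.

Lemma trace_inseg (R : realType) s x y (z : R * R) : y \in s -> adjz y x -> inseg y x z ->
  trace (x :: s) z.
Proof.
by move=> ys yx h; exists y, x; split; rewrite ?mem_head ?inE ?ys ?yx ?orbT.
Qed.

Lemma trace_lattice (R : realType) s y : trace s (iota2 R y) -> y \in s.
Proof.
move=> [p [q [ps qs pq [t [t01 e1 e2]]]]].
have [||[-> _]|[-> _]] // := near_end (r := y) pq t01 e1 e2; by rewrite subrr normr0.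
Qed.

Lemma drawn_leaf (R : realType) n (E : edge_set n) (B : 'I_n -> seq pt)
    (g : {set 'I_n} -> R -> R * R) v x s :
  drawn E B g -> B v = x :: s -> ~~ nilp s ->
  exists g', @drawn R n E (fun u => if u == v then s else B u) g'.
Proof.
move=> [gB dB eB xB] Bv ns.
have := gB v; rewrite Bv /= (negbTE ns) => /and3P [xs /hasP [y ys xy] gs].
have yx : adjz y x by rewrite adjzC.
have ss : {subset s <= x :: s} by move=> z zs; rewrite inE zs orbT.
pose B' u := if u == v then s else B u.
have sB u : {subset B' u <= B u}.
  by move=> z; rewrite /B'; case: eqP => // ->; rewrite Bv; apply: ss.
have xB' u : x \notin B' u.
  rewrite /B'; case: (eqVneq u v) => // uv; apply/negP => xu.
  by move/eqP: uv; apply; apply: (dB u v x) => //; rewrite Bv mem_head.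
pose h : R * R -> R * R := collapse y (ptB x y).
exists (fun e t => h (g e t)); split.
- by move=> u; case: eqP.
- by move=> u w z /sB zu /sB zw; apply: dB zu zw.
- move=> e eE; have [u [w [a [b [[ee uw aB bB] ce ie [g0 g1] te]]]]] := eB e eE.
  pose r z := if z == x then y else z.
  have hr z : h (iota2 R z) = iota2 R (r z).
    rewrite /h /r; case: eqP => [->|/eqP zx].
      apply: collapse_seg => //; exists 1; rewrite lexx ler01 !mul1r !rmorphB /=; split=> //; ring.
    apply: (collapse_trace (s := [:: z]) yx); first by rewrite inE eq_sym.
    by apply: trace_point; rewrite mem_head.
  have rB z k : z \in B k -> r z \in B' k.
    rewrite /r /B'; case: (eqVneq z x) => [->|zx] zk.
      have -> : k = v by apply: (dB k v x) => //; rewrite Bv mem_head.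
      by rewrite eqxx.
    by case: (eqVneq k v) => // kv; move: zk; rewrite kv Bv inE (negbTE zx).
  have tse t : 0 <= t <= 1 -> inseg y x (g e t) -> (t = 0 /\ v = u) \/ (t = 1 /\ v = w).
    by move=> t01 sg; apply: te => //; rewrite Bv; apply: trace_inseg sg.
  exists u, w, (r a), (r b); split.
  + by split=> //; apply: rB.
  + move=> t; apply: (continuous_comp (ce t)); exact: collapse_continuous.
  + move=> t t' t01 t01' /(collapse_inj yx) [|[/(tse _ t01) h1 /(tse _ t01') h2]].
      exact: ie.
    move/eqP: uw => uw; case: h1 => -[-> vu]; case: h2 => -[-> vw] //; case: uw; by rewrite -vu.
  + by rewrite g0 g1 !hr.
  + move=> t k t01 tr.
    have hz : h (h (g e t)) = h (g e t) by apply: collapse_trace (xB' k) tr.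
    have [hg|[_ sg]] := collapse_inj yx hz.
      by apply: te => //; apply: trace_sub (sB k) _; rewrite -hg.
    have hy : h (g e t) = iota2 R y by apply: collapse_seg sg.
    have -> : k = v.
      move: tr; rewrite -/(B' k) hy => tr; apply: (dB k v y); last by rewrite Bv ss.
      by apply: sB; apply: trace_lattice tr.
    exact: tse.
- move=> e e' t t' eE e'E ne t01 t01' /(collapse_inj yx) [|[sg _]]; first exact: xB.
  have [u [w [a [b [_ _ _ _ te]]]]] := eB e eE.
  have [|[-> _]|[-> _]] := te t v t01; [|by left|by right].
  by rewrite Bv; apply: trace_inseg sg.
Qed.

Lemma drawn_points (R : realType) n (E : edge_set n) (B : 'I_n -> seq pt)
    (g : {set 'I_n} -> R -> R * R) :
  drawn E B g -> exists B' g', @drawn R n E B' g' /\ forall v, (size (B' v) <= 1)%N.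
Proof.
move eN : (\sum_v size (B v))%N => N.
elim/ltn_ind: N B g eN => N IH B g eN D.
have [/forallP h|] := boolP [forall v, (size (B v) <= 1)%N]; first by exists B, g.
rewrite negb_forall => /existsP [v]; rewrite -ltnNge => sv.
case Bv : (B v) sv => [|x s] //=; rewrite ltnS => s0.
have [|g' D'] := drawn_leaf D Bv; first by rewrite /nilp -lt0n.
apply: IH D'; last by reflexivity.
rewrite -eN (bigD1 v) //= eqxx [X in (_ < X)%N](bigD1 v) //= Bv /= addSn ltnS leq_add2l.
by apply: leq_sum => u /negbTE ->.
Qed.

Lemma drawn_planar (R : realType) n (E : edge_set n) (B : 'I_n -> seq pt)
    (g : {set 'I_n} -> R -> R * R) :
  drawn E B g -> (forall v, (size (B v) <= 1)%N) -> planar R E.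
Proof.
move=> [gB dB eB xB] sB.
have H v : exists x, B v = [:: x].
  by have := gB v; have := sB v; case: (B v) => [|x []] // _ _; exists x.
have [p Hp] := boolp.choice H.
have unit01 (t : R) : t \in `]0, 1[ -> 0 <= t <= 1.
  by rewrite in_itv /= => /andP [h h']; rewrite !ltW.
have n01 (t : R) : t \in `]0, 1[ -> ~ (t = 0 \/ t = 1).
  by move=> + [] e; rewrite e in_itv /= ltxx ?andbF.
exists (fun v => iota2 R (p v)), g; split.
- move=> u v /iota2_inj e; apply: (dB u v (p u)); first by rewrite Hp mem_head.
  by rewrite Hp e mem_head.
- move=> e eE; have [u [w [a [b [[ee uw aB bB] ce ie [g0 g1] te]]]]] := eB e eE.
  split=> //.
  move: aB bB; rewrite !Hp !inE => /eqP ea /eqP eb; subst a b.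
  rewrite g0 g1 ee; apply/seteqP; split=> z /=.
    by case=> ->; [exists u|exists w]; rewrite //= !finset.inE eqxx ?orbT.
  by move=> [v]; rewrite !finset.inE => /orP [/eqP ->|/eqP ->] <-; [left|right].
- move=> e x t eE t01 gx; have [u [w [a [b [_ _ _ _ te]]]]] := eB e eE.
  apply: (n01 t t01); have [|[-> _]|[-> _]] := te t x (unit01 t t01); [|by left|by right].
  by rewrite gx; apply: trace_point; rewrite Hp mem_head.
- move=> e e' t t' eE e'E ne t01 t01' gx.
  exact: (n01 t t01) (xB _ _ _ _ eE e'E ne (unit01 t t01) (unit01 t' t01') gx).
Qed.

Lemma pl_planar (R : realType) n (E : edge_set n) :
  simple_graph E -> pl (adj E) -> planar R E.
Proof.
move=> sE [B [gB dB tB]].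
pose sg (a b : pt) (t : R) : R * R :=
  (a.1%:~R + t * (b.1 - a.1)%:~R, a.2%:~R + t * (b.2 - a.2)%:~R).
have H (e : {set 'I_n}) : exists ge : R -> R * R, e \in E -> exists u w a b,
    [/\ e = [set u; w]%SET, u != w, a \in B u, b \in B w & adjz a b /\ ge = sg a b].
  case eE : (e \in E); last by exists (fun _ => (0, 0)).
  have /cards2P [u [w [uw ee]]] : #|e| == 2%N by move/forall_inP : sE; apply.
  have /touchP [a [b [aB bB ab]]] : touch (B u) (B w).
    by apply: tB => //; rewrite /adj -ee.
  by exists (sg a b) => _; exists u, w, a, b.
have [g Hg] := boolp.choice H.
have inj_sg a b t t' : adjz a b -> sg a b t = sg a b t' -> t = t'.
  move=> ab; rewrite /sg => -[/addrI h1 /addrI h2].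
  have [d1|d1] := eqVneq (b.1 - a.1) 0; last by apply: (mulIf _ h1); rewrite intr_eq0.
  have [d2|d2] := eqVneq (b.2 - a.2) 0; last by apply: (mulIf _ h2); rewrite intr_eq0.
  by exfalso; move: ab d1 d2; clear; rewrite /adjz; lia.
have D : drawn E B g.
  split.
  - by move=> v; apply: gB.
  - by move=> u v x; apply: dB.
  - move=> e eE; have [u [w [a [b [ee uw aB bB [ab ge]]]]]] := Hg e eE.
    exists u, w, a, b; rewrite ge; split=> //.
    + apply: continuous_subspaceT; apply: continuous_pair => t;
      (apply: cvgD; [exact: cvg_cst|apply: cvgM; [exact: cvg_id|exact: cvg_cst]]).
    + by move=> t t' _ _; apply: inj_sg.
    + by rewrite /sg !mul0r !addr0 !mul1r !rmorphB /= ![_ + (_ - _)]addrC !subrK.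
    + move=> t v t01 [p [q [pv qv pq seg]]].
      case: (seg_cross (z := sg a b t) ab pq t01 (erefl _) (erefl _) seg) => [[-> [ap|aq]]|[-> [bp|bq]]|[pa qb]|[pb qa]].
      * by left; split=> //; apply: (dB v u a) => //; rewrite ap.
      * by left; split=> //; apply: (dB v u a) => //; rewrite aq.
      * by right; split=> //; apply: (dB v w b) => //; rewrite bp.
      * by right; split=> //; apply: (dB v w b) => //; rewrite bq.
      * subst p q; case/eqP: uw; rewrite -(dB v u a) //; exact: (dB v w b).
      * subst p q; case/eqP: uw; rewrite -(dB v u a) //; exact: (dB v w b).
  - move=> e e' t t' eE e'E ne t01 t01' gx.
    have [u [w [a [b [ee uw aB bB [ab ge]]]]]] := Hg e eE.
    have [u' [w' [a' [b' [ee' uw' aB' bB' [ab' ge']]]]]] := Hg e' e'E.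
    rewrite ge ge' in gx.
    have seg : inseg a' b' (sg a b t) by rewrite gx; exists t'.
    have pq : (a' == b') || adjz a' b' by rewrite ab' orbT.
    case: (seg_cross (z := sg a b t) ab pq t01 (erefl _) (erefl _) seg) => [[-> _]|[-> _]|[pa qb]|[pb qa]]; [by left|by right| |].
    + rewrite pa in aB'; rewrite qb in bB'; case/eqP: ne.
      by rewrite ee ee' (dB u u' a isT isT aB aB') (dB w w' b isT isT bB bB').
    + rewrite pb in aB'; rewrite qa in bB'; case/eqP: ne.
      by rewrite ee ee' (dB u w' a isT isT aB bB') (dB w u' b isT isT bB aB') finset.setUC.
have [B' [g' [D' s1]]] := drawn_points D.
exact: drawn_planar D' s1.
Qed.

Local Close Scope classical_set_scope.

(** * From plane drawings to lattice minors *)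

Local Open Scope classical_set_scope.
Local Open Scope ring_scope.

Lemma fin_lower (R : realType) (I : finType) (f : I -> R) :
  (forall i, 0 < f i) -> exists2 d : R, 0 < d & forall i, d <= f i.
Proof.
move=> f0; pose S := \sum_i (f i)^-1 + 1.
have s0 : 0 <= \sum_i (f i)^-1 by apply: sumr_ge0 => i _; rewrite invr_ge0 ltW.
have S0 : 0 < S by rewrite /S; lra.
exists S^-1; first by rewrite invr_gt0.
move=> i; rewrite -[f i]invrK lef_pV2 ?posrE ?invr_gt0 //.
rewrite /S (bigD1 i) //=.
have : 0 <= \sum_(j | j != i) (f j)^-1 by apply: sumr_ge0 => j _; rewrite invr_ge0 ltW.
by lra.
Qed.

Lemma pos_lower (R : realType) (T : topologicalType) (A : set T) (f : T -> R) :
  compact A -> continuous f -> (forall t, A t -> 0 < f t) ->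
  exists2 d : R, 0 < d & forall t, A t -> d <= f t.
Proof.
move=> cA cf f0; have [A0|A0] := pselect (A !=set0); last first.
  by exists 1 => // t At; case: A0; exists t.
have [t tA h] := compact_EVT_min A0 cA (continuous_subspaceT cf).
exists (f t); first by apply: f0; exact: set_mem.
by move=> s As; apply: h; exact: mem_set.
Qed.

Lemma clamp_itv (R : realType) (f : R -> R * R) :
  {within `[0, 1], continuous f} -> continuous (fun t => f (clamp t)).
Proof.
move=> /subspace_continuousP cf x A hA.
have c01 y : `[0, 1]%classic (@clamp R y).
  by rewrite /= in_itv /=; have [-> ->] := clamp_bound y.
have := cf _ (c01 x) A hA; rewrite /= => h.
have h' : nbhs x [set y | (`[0, 1]%classic (@clamp R y)) -> A (f (clamp y))] :=
  @clamp_continuous R x _ h.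
by apply: (filterS _ h') => y /= hy; apply: hy; apply: c01.
Qed.

Definition dist1 (R : realType) (z z' : R * R) : R := `|z.1 - z'.1| + `|z.2 - z'.2|.
Definition near (R : realType) (d : R) (z z' : R * R) : Prop :=
  `|z.1 - z'.1| <= d /\ `|z.2 - z'.2| <= d.

Lemma near_dist (R : realType) (d : R) (z z' : R * R) : near d z z' -> dist1 z z' <= 2 * d.
Proof. by rewrite /near /dist1 => -[h h']; lra. Qed.

Lemma dist_near (R : realType) (d : R) (z z' : R * R) : dist1 z z' <= d -> near d z z'.
Proof.
rewrite /near /dist1 => h; have := normr_ge0 (z.1 - z'.1); have := normr_ge0 (z.2 - z'.2).
by split; lra.
Qed.

Lemma nearC (R : realType) (d : R) (z z' : R * R) : near d z z' -> near d z' z.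
Proof. by rewrite /near => -[h h']; rewrite distrC h distrC h'. Qed.

Lemma near_trans (R : realType) (d d' : R) (z z' z'' : R * R) :
  near d z z' -> near d' z' z'' -> near (d + d') z z''.
Proof.
move=> [h1 h2] [h3 h4]; split; apply: le_trans (ler_distD _ _ _) (lerD _ _); eassumption.
Qed.

Lemma near_le (R : realType) (d d' : R) (z z' : R * R) : d <= d' -> near d z z' -> near d' z z'.
Proof. by move=> dd [h1 h2]; split; apply: le_trans dd. Qed.

Lemma dist1_gt0 (R : realType) (z z' : R * R) : z <> z' -> 0 < dist1 z z'.
Proof.
move=> zz; rewrite lt_neqAle /dist1 addr_ge0 // andbT eq_sym.
apply/negP; rewrite paddr_eq0 // !normr_eq0 !subr_eq0 => /andP [/eqP h1 /eqP h2].
by apply: zz; rewrite [z]surjective_pairing [z']surjective_pairing h1 h2.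
Qed.

Lemma dist1_continuous (R : realType) (T : topologicalType) (f f' : T -> R * R) :
  continuous f -> continuous f' -> continuous (fun t => dist1 (f t) (f' t)).
Proof.
move=> cf cf'.
have c1 (h : T -> R * R) : continuous h -> continuous (fun t => (h t).1).
  by move=> ch; exact: (continuous_compose ch (@continuous_fst R)).
have c2 (h : T -> R * R) : continuous h -> continuous (fun t => (h t).2).
  by move=> ch; exact: (continuous_compose ch (@continuous_snd R)).
move=> t; apply: cvgD; apply: cvg_norm; apply: cvgB.
- exact: (c1 _ cf t).
- exact: (c1 _ cf' t).
- exact: (c2 _ cf t).
- exact: (c2 _ cf' t).
Qed.

(* Real induction: the points of [0, 1] reachable from 0 by small steps form
   an interval that contains its supremum, which can only be 1. *)
Lemma small_steps (R : realType) (G : R -> R * R) (d : R) : 0 < d -> continuous G ->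
  exists s : seq R, [/\ path (fun x y => `[< near d (G x) (G y) >] && (0 <= y <= 1)) 0 s
    & last 0 s = 1].
Proof.
move=> d0 cG.
pose rel_ (x y : R) := `[< near d (G x) (G y) >] && (0 <= y <= 1).
pose S : set R := [set t | exists s, path rel_ 0 s /\ last 0 s = t].
have S0 : S 0 by exists [::].
have S1 t : S t -> 0 <= t <= 1.
  move=> [s [+ <-]]; case/lastP: s => [_|s x]; first by rewrite lexx ler01.
  by rewrite rcons_path last_rcons => /andP [_ /andP [_ ->]].
have step t t' : S t -> near d (G t) (G t') -> 0 <= t' <= 1 -> S t'.
  move=> [s [ps ls]] nt t01; exists (rcons s t'); split; last by rewrite last_rcons.
  by rewrite rcons_path ps ls /rel_ t01 andbT; apply/asboolP.
have hs : has_sup S.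
  by split; [exists 0|exists 1 => t /S1 /andP []].
pose m := sup S.
have m0 : 0 <= m by apply: ub_le_sup => //; case: hs.
have m1 : m <= 1 by apply: ge_sup => [|t /S1 /andP []] //; exists 0.
have cD : continuous (fun t => dist1 (G t) (G m)).
  by apply: dist1_continuous => // t; exact: cvg_cst.
have [e e0 He] : exists2 e : R, 0 < e & forall t, `|m - t| < e -> near (d / 2) (G t) (G m).
  have d20 : 0 < d / 2 by lra.
  have := cD m; move/cvgrPdist_lt => /(_ _ d20) /nbhs_ballP [e e0 h].
  exists e => // t mt; apply: dist_near; have := h t mt; rewrite /=.
  have -> : dist1 (G m) (G m) = 0 by rewrite /dist1 !subrr normr0 addr0.
  by rewrite sub0r normrN ger0_norm ?addr_ge0 // => /ltW.
have d2 : d / 2 + d / 2 = d by lra.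
have Sm : S m.
  have [t St mt] := sup_adherent e0 hs; rewrite -/m in mt.
  have tm : t <= m by apply: ub_le_sup => //; case: hs.
  apply: (step t) => //; last by rewrite m0 m1.
  apply: (near_le (d := d / 2)); first by lra.
  by apply: He; rewrite ger0_norm; lra.
have [m1'|mn1] := eqVneq m 1; first by have [s [ps ls]] := Sm; exists s; rewrite ls m1'.
exfalso; pose t := Num.min 1 (m + e / 2).
have tm : m < t by rewrite /t lt_min; apply/andP; split; [rewrite lt_neqAle mn1|lra].
have te : t <= m + e / 2 by rewrite /t ge_min lexx orbT.
have t1 : t <= 1 by rewrite /t ge_min lexx.
have St : S t.
  apply: (step m) => //; last by apply/andP; split; lra.
  apply: nearC; apply: (near_le (d := d / 2)); first by lra.
  by apply: He; rewrite distrC ger0_norm; lra.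
have : t <= m by apply: ub_le_sup => //; case: hs.
by lra.
Qed.

Lemma walk_excursion (A B : pt -> Prop) x l : path adjz x l -> A x -> B (last x l) ->
  (forall z, A z -> ~ B z) ->
  exists a m b, [/\ A a, B b, path adjz a (rcons m b),
    forall z, z \in m -> ~ A z /\ ~ B z & {subset a :: rcons m b <= x :: l}].
Proof.
move=> pl Ax Bl dis; move sz : (size l) => k.
elim/ltn_ind: k x l sz pl Ax Bl => k IH x l sz pl Ax Bl.
have [l1 [b [l2 [el nm hb]]]] : exists l1 b l2, [/\ l = l1 ++ b :: l2,
    forall z, z \in l1 -> ~ A z /\ ~ B z & A b \/ B b].
  case: l {sz pl} Bl => [/(dis _ Ax) //|y l] /= Bl.
  have : A (last y l) \/ B (last y l) by right.
  elim: l y {Bl} => [|z l IHl] y /= h.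
    by exists [::], y, [::].
  have [[Ay|By]|nAB] := pselect (A y \/ B y).
  - by exists [::], y, (z :: l); split=> //; left.
  - by exists [::], y, (z :: l); split=> //; right.
  have [l1 [b [l2 [-> nm hb]]]] := IHl z h.
  exists (y :: l1), b, l2; split=> // w; rewrite inE => /orP [/eqP ->|/nm //].
  by split=> hw; apply: nAB; [left|right].
rewrite el cat_path /= in pl; case/and3P: pl => p1 pb p2.
have [Ab|nAb] := pselect (A b).
  have [|||||a [m [b' [h1 h2 h3 h4 h5]]]] := IH (size l2) _ b l2 => //.
  - by rewrite -sz el size_cat /= addnS ltnS leq_addl.
  - by rewrite el last_cat in Bl.
  exists a, m, b'; split=> // z /h5 zl; rewrite el inE mem_cat zl !orbT //.
exists x, l1, b; split=> //; first by case: hb.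
  by rewrite rcons_path p1.
move=> z; rewrite inE mem_rcons el => /orP [/eqP ->|]; first by rewrite mem_head.
by rewrite !inE mem_cat inE => /orP [->|->]; rewrite ?orbT.
Qed.

Definition scale (R : realType) (mu : R) (q : pt) : R * R := (mu * q.1%:~R, mu * q.2%:~R).
Definition snap (R : realType) (mu : R) (z : R * R) : pt :=
  (Num.floor (z.1 / mu), Num.floor (z.2 / mu)).

Lemma snap_near (R : realType) (mu : R) (z : R * R) : 0 < mu -> near mu (scale mu (snap mu z)) z.
Proof.
move=> mu0; suff H (x : R) : `|mu * (Num.floor (x / mu))%:~R - x| <= mu by split; apply: H.
have h1 := floor_le (x / mu); have h2 := floorD1_gt (x / mu).
have ex : x = mu * (x / mu) by rewrite mulrC divfK // gt_eqF.
rewrite {2}ex -mulrBr normrM gtr0_norm // -[leRHS]mulr1 ler_pM2l //.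
by rewrite ler0_norm; move: h2; rewrite rmorphD /=; lra.
Qed.

Lemma floor_step (R : realType) (mu x x' : R) : 0 < mu -> `|x - x'| <= mu ->
  [\/ Num.floor (x' / mu) = Num.floor (x / mu),
      Num.floor (x' / mu) = Num.floor (x / mu) + 1 |
      Num.floor (x / mu) = Num.floor (x' / mu) + 1].
Proof.
move=> mu0 h.
have : `|x / mu - x' / mu| <= 1.
  by rewrite -mulrBl normrM normfV (gtr0_norm mu0) ler_pdivrMr // mul1r.
move: (x / mu) (x' / mu) => y y'; rewrite ler_norml => /andP [h1 h2].
have a1 := floor_le y; have a2 := floorD1_gt y.
have b1 := floor_le y'; have b2 := floorD1_gt y'.
have c1 : Num.floor y' < Num.floor y + 2.
  by rewrite -(ltr_int R) rmorphD /=; move: a2; rewrite rmorphD /=; lra.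
have c2 : Num.floor y < Num.floor y' + 2.
  by rewrite -(ltr_int R) rmorphD /=; move: b2; rewrite rmorphD /=; lra.
have : Num.floor y' = Num.floor y \/ Num.floor y' = Num.floor y + 1 \/ Num.floor y = Num.floor y' + 1.
  by move: c1 c2; clear; move: (Num.floor y) (Num.floor y') => i j; lia.
by case=> [?|[?|?]]; [apply: Or31|apply: Or32|apply: Or33].
Qed.

Lemma conn_sym (Q : pt -> bool) x y : conn Q x y -> conn Q y x.
Proof.
move=> [p [+ <- +]]; elim: p x => [|z p IH] x /=.
  by move=> _ /andP [Qx _]; apply: conn_refl.
move=> /andP [xz pz] /andP [Qx /andP [Qz Qp]].
have {}IH := IH z pz; rewrite /= Qz in IH; apply: conn_trans (IH Qp) _.
by apply: conn_adj => //; rewrite adjzC.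
Qed.

Lemma conn_row (Q : pt -> bool) (a b : int) (n : nat) :
  (forall i : int, a <= i -> i <= a + n%:Z -> Q (i, b)) -> conn Q (a, b) (a + n%:Z, b).
Proof.
elim: n => [|n IH] H; first by rewrite addr0; apply: conn_refl; apply: H; lia.
apply: (conn_trans (IH _)); first by move=> i h1 h2; apply: H => //; lia.
by apply: conn_adj; [apply: H; lia|apply: H; lia|rewrite /adjz /=; lia].
Qed.

Lemma conn_col (Q : pt -> bool) (a b : int) (n : nat) :
  (forall i : int, b <= i -> i <= b + n%:Z -> Q (a, i)) -> conn Q (a, b) (a, b + n%:Z).
Proof.
elim: n => [|n IH] H; first by rewrite addr0; apply: conn_refl; apply: H; lia.
apply: (conn_trans (IH _)); first by move=> i h1 h2; apply: H => //; lia.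
by apply: conn_adj; [apply: H; lia|apply: H; lia|rewrite /adjz /=; lia].
Qed.

Lemma int_le_ex (a b : int) : a <= b -> exists n : nat, b = a + n%:Z.
Proof. by move=> h; exists `|b - a|%N; lia. Qed.

Lemma conn_row2 (Q : pt -> bool) (a a' b : int) :
  (forall i : int, (a <= i <= a') || (a' <= i <= a) -> Q (i, b)) -> conn Q (a, b) (a', b).
Proof.
move=> H; have [h|h] := leP a a'.
  have [n e] := int_le_ex h; rewrite e; apply: conn_row => i h1 h2; apply: H.
  by rewrite e h1 h2.
have [n e] := int_le_ex (ltW h); rewrite e; apply: conn_sym; apply: conn_row => i h1 h2; apply: H.
by rewrite e h1 h2 orbT.
Qed.

Lemma conn_col2 (Q : pt -> bool) (a b b' : int) :
  (forall i : int, (b <= i <= b') || (b' <= i <= b) -> Q (a, i)) -> conn Q (a, b) (a, b').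
Proof.
move=> H; have [h|h] := leP b b'.
  have [n e] := int_le_ex h; rewrite e; apply: conn_col => i h1 h2; apply: H.
  by rewrite e h1 h2.
have [n e] := int_le_ex (ltW h); rewrite e; apply: conn_sym; apply: conn_col => i h1 h2; apply: H.
by rewrite e h1 h2 orbT.
Qed.

Lemma conn_box (R : realType) (mu r : R) (c : R * R) (x y : pt) : 0 < mu ->
  near r (scale mu x) c -> near r (scale mu y) c ->
  conn (fun q => `[< near r (scale mu q) c >]) x y.
Proof.
move=> mu0 [x1 x2] [y1 y2].
have btw (i j k : int) (d : R) : (i <= j <= k) || (k <= j <= i) ->
    `|mu * i%:~R - d| <= r -> `|mu * k%:~R - d| <= r -> `|mu * j%:~R - d| <= r.
  move=> h; rewrite !ler_norml => /andP [a1 a2] /andP [b1 b2].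
  case/orP: h => /andP []; rewrite -!(ler_int R) -(ler_pM2l mu0) => h1;
  rewrite -(ler_pM2l mu0) => h2; apply/andP; split; lra.
case: x y x1 x2 y1 y2 => [a b] [a' b'] /= x1 x2 y1 y2.
apply: (@conn_trans _ _ (a', b)).
  by apply: conn_row2 => i h; apply/asboolP; split=> //=; apply: btw h _ _.
by apply: conn_col2 => i h; apply/asboolP; split=> //=; apply: btw h _ _.
Qed.

Lemma snap_conn (R : realType) (mu : R) (Q : pt -> bool) (z z' : R * R) : 0 < mu ->
  (forall q, near (2 * mu) (scale mu q) z -> Q q) -> near mu z z' -> Q (snap mu z') ->
  conn Q (snap mu z) (snap mu z').
Proof.
move=> mu0 HQ nz Qz'; have [n1 n2] := nz.
have [s1 s2] := snap_near z mu0; have [t1 t2] := snap_near z' mu0.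
have Qm : Q ((snap mu z').1, (snap mu z).2).
  apply: HQ; split; last by apply: le_trans s2 _; lra.
  have n1' : `|z'.1 - z.1| <= mu by rewrite distrC.
  rewrite /=; apply: le_trans (ler_distD z'.1 _ _) _.
  by have -> : 2 * mu = mu + mu by [ring]; apply: lerD.
have Qz : Q (snap mu z) by apply: HQ; apply: near_le (snap_near z mu0); lra.
apply: (@conn_trans _ _ ((snap mu z').1, (snap mu z).2)).
  have := floor_step mu0 n1; rewrite -/(snap mu z).1 -/(snap mu z').1 => H.
  have [->|ne] := eqVneq (snap mu z').1 (snap mu z).1.
    by rewrite -surjective_pairing; apply: conn_refl.
  apply: conn_adj => //; rewrite /adjz /= eqxx.
  by case: H => /eqP h; rewrite ?(negbTE ne) // in h *; rewrite h ?orbT.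
have := floor_step mu0 n2; rewrite -/(snap mu z).2 -/(snap mu z').2 => H.
have [<-|ne] := eqVneq (snap mu z').2 (snap mu z).2.
  by rewrite -surjective_pairing; apply: conn_refl.
apply: conn_adj => //; rewrite /adjz /= eqxx.
by case: H => /eqP h; rewrite ?(negbTE ne) // in h *; rewrite h ?orbT.
Qed.

Lemma lattice_walk (R : realType) (G : R -> R * R) (mu : R) : 0 < mu -> continuous G ->
  conn (fun q => `[< exists2 t : R, 0 <= t <= 1 & near (2 * mu) (scale mu q) (G t) >])
    (snap mu (G 0)) (snap mu (G 1)).
Proof.
move=> mu0 cG; have [s [ps ls]] := small_steps mu0 cG.
set Q := (fun q : pt => _).
have QG t q : 0 <= t <= 1 -> near (2 * mu) (scale mu q) (G t) -> Q q.
  by move=> t01 h; apply/asboolP; exists t.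
have Qs t : 0 <= t <= 1 -> Q (snap mu (G t)).
  by move=> t01; apply: (QG t) => //; apply: near_le (snap_near _ mu0); lra.
suff H y : path (fun x y => `[< near mu (G x) (G y) >] && (0 <= y <= 1)) y s ->
    0 <= y <= 1 -> conn Q (snap mu (G y)) (snap mu (G (last y s))).
  by have := H 0 ps; rewrite ls lexx ler01; apply.
elim: s {ps ls} y => [|x s IH] y /= ps y01; first by apply: conn_refl; apply: Qs.
case/andP: ps => /andP [/asboolP nyx x01] ps.
apply: conn_trans (IH x ps x01); apply: snap_conn => //; last exact: Qs.
by move=> q; apply: QG.
Qed.

Lemma grown_paths s (D : seq (pt * seq pt)) : grown s ->
  (forall x, x \in D -> x.1 \in s /\ path adjz x.1 x.2) ->
  exists2 s', grown s' & forall z, z \in s' <-> z \in s \/ exists2 x, x \in D & z \in x.2.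
Proof.
move=> gs; elim: D => [|x D IH] H.
  by exists s => // z; split=> [zs|[zs //|[x]]] //; left.
have [|s1 gs1 es1] := IH; first by move=> y yD; apply: H; rewrite inE yD orbT.
have [xs px] := H x (mem_head _ _).
have xs1 : x.1 \in s1 by apply/es1; left.
have [s2 gs2 es2] := grown_path gs1 xs1 px.
exists s2 => // z; rewrite es2 mem_cat; split.
  case/orP=> [/es1 [zs|[y yD zy]]|zx]; [by left| |].
    by right; exists y; rewrite // inE yD orbT.
  by right; exists x; rewrite ?mem_head.
case=> [zs|[y]]; first by apply/orP; left; apply/es1; left.
rewrite inE => /orP [/eqP ->|yD] zy; first by rewrite zy orbT.
by apply/orP; left; apply/es1; right; exists y.
Qed.

Lemma planar_pl (R : realType) n (E : edge_set n) : planar R E -> pl (adj E).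
Proof.
move=> [p [g [ip dE dV dX]]].
have p01 (t : R) : 0 <= t <= 1 -> [\/ t = 0, t = 1 | t \in `]0, 1[].
  move=> /andP [h h'].
  have [->|n0] := eqVneq t 0; first exact: Or31.
  have [->|n1] := eqVneq t 1; first exact: Or32.
  by apply: Or33; rewrite in_itv /= !lt_neqAle h h' n1 [0 == t]eq_sym n0.
have H (e : {set 'I_n}) : exists x : option ('I_n * 'I_n), e \in E -> exists u w, [/\ x = Some (u, w),
    (forall v, (v \in e) = (v == u) || (v == w)), u != w, g e 0 = p u & g e 1 = p w].
  case eE : (e \in E); last by exists None.
  have [_ ie se] := dE e eE.
  have : [set p x | x in [set` e]] (g e 0) by rewrite -se; left.
  have : [set p x | x in [set` e]] (g e 1) by rewrite -se; right.
  move=> /= [w we gw] [u ue gu]; exists (Some (u, w)) => _; exists u, w; split=> //.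
    move=> v; apply/idP/orP => [ve|[/eqP ->|/eqP ->] //].
    have : [set g e 0; g e 1] (p v) by rewrite se; exists v.
    by rewrite -gu -gw => -[/ip ->|/ip ->]; [left|right].
  apply/eqP => uw; have := ie 0 1; rewrite !in_itv /= !lexx !ler01 => /(_ isT isT).
  by rewrite -gu -gw uw => /(_ erefl) /eqP; rewrite eq_sym oner_eq0.
have [ends Hends] := boolp.choice H.
pose G e t := g e (clamp t).
have cG e : e \in E -> continuous (G e).
  by move=> eE; have [ce _ _] := dE e eE; apply: clamp_itv.
have Gg e t : 0 <= t <= 1 -> G e t = g e t by move=> /andP [h h']; rewrite /G clamp_id.
have c01 := @segment_compact R 0 1.
have i01 (t : R) : `[0, 1]%classic t -> 0 <= t <= 1 by rewrite /= in_itv.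
have [d1 d10 Hd1] : exists2 d : R, 0 < d & forall uw : 'I_n * 'I_n, uw.1 != uw.2 ->
    d <= dist1 (p uw.1) (p uw.2).
  have [|d d0 Hd] := @fin_lower R _ (fun uw : 'I_n * 'I_n => if uw.1 != uw.2 then dist1 (p uw.1) (p uw.2) else 1).
    by move=> [u w] /=; case: ifPn => // uw; apply: dist1_gt0 => /ip /eqP; rewrite (negbTE uw).
  by exists d => // uw ne; have := Hd uw; rewrite ne.
have [d2 d20 Hd2] : exists2 d : R, 0 < d & forall ex : {set 'I_n} * 'I_n, ex.1 \in E -> ex.2 \notin ex.1 ->
    forall t, 0 <= t <= 1 -> d <= dist1 (G ex.1 t) (p ex.2).
  have K (ex : {set 'I_n} * 'I_n) : exists d : R, 0 < d /\ (ex.1 \in E -> ex.2 \notin ex.1 ->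
      forall t, 0 <= t <= 1 -> d <= dist1 (G ex.1 t) (p ex.2)).
    case: ex => e x /=; case eE : (e \in E); last by exists 1.
    case xe : (x \in e); first by exists 1.
    have [|d d0 Hd] := pos_lower c01 (dist1_continuous (cG e eE) (fun t => cvg_cst (p x))).
      move=> t /i01 t01; apply: dist1_gt0; rewrite Gg //.
      have [u [w [_ me _ gu gw]]] := Hends e eE.
      case: (p01 t t01) => [->|->|ti].
      - by rewrite gu => /ip ux; rewrite -ux me eqxx in xe.
      - by rewrite gw => /ip ux; rewrite -ux me eqxx orbT in xe.
      - exact: dV eE ti.
    by exists d; split=> // _ _ t t01; apply: Hd; rewrite /= in_itv.
  have [f Hf] := boolp.choice K.
  have [|d d0 Hd] := @fin_lower R _ f; first by move=> i; case: (Hf i).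
  exists d => // ex h1 h2 t t01; apply: le_trans (Hd ex) _.
  by have [_] := Hf ex; apply.
pose r := Num.min d1 d2 / 40.
have r0 : 0 < r by rewrite /r divr_gt0 // lt_min d10.
have rd1 : 40 * r <= d1 by rewrite /r mulrC divfK // ge_min lexx.
have rd2 : 40 * r <= d2 by rewrite /r mulrC divfK // ge_min lexx orbT.
have [d3 d30 Hd3] : exists2 d : R, 0 < d & forall ee : {set 'I_n} * {set 'I_n},
    ee.1 \in E -> ee.2 \in E -> ee.1 != ee.2 -> forall s t, 0 <= s <= 1 -> 0 <= t <= 1 ->
    (forall x, ~ near r (G ee.1 s) (p x)) -> d <= dist1 (G ee.1 s) (G ee.2 t).
  have K (ee : {set 'I_n} * {set 'I_n}) : exists d : R, 0 < d /\
    (ee.1 \in E -> ee.2 \in E -> ee.1 != ee.2 -> forall s t, 0 <= s <= 1 -> 0 <= t <= 1 ->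
    (forall x, ~ near r (G ee.1 s) (p x)) -> d <= dist1 (G ee.1 s) (G ee.2 t)).
    case: ee => e e' /=; case eE : (e \in E); last by exists 1.
    case eE' : (e' \in E); last by exists 1.
    case: (eqVneq e e') => ne; first by exists 1.
    have [u [w [_ me uw gu gw]]] := Hends e eE.
    have [u' [w' [_ me' uw' gu' gw']]] := Hends e' eE'.
    pose pos (x : R) := (x + `|x|) / 2.
    pose F (st : R * R) := dist1 (G e st.1) (G e' st.2) +
      pos (r - dist1 (G e st.1) (p u)) + pos (r - dist1 (G e st.1) (p w)).
    have cG1 : continuous (fun st : R * R => G e st.1).
      exact: (continuous_compose (@continuous_fst R) (cG e eE)).
    have cG2 : continuous (fun st : R * R => G e' st.2).
      exact: (continuous_compose (@continuous_snd R) (cG e' eE')).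
    have cpos (f : R * R -> R) : continuous f -> continuous (fun st => pos (r - f st)).
      move=> cf st; apply: cvgM; last exact: cvg_cst.
      have h : (r - f t @[t --> st] --> r - f st)%classic by apply: cvgB; [exact: cvg_cst|exact: cf].
      by apply: cvgD => //; apply: cvg_norm.
    have cF : continuous F.
      move=> st; apply: cvgD; first apply: cvgD.
      - exact: (dist1_continuous cG1 cG2).
      - exact: (cpos _ (dist1_continuous cG1 (fun t => cvg_cst (p u)))).
      - exact: (cpos _ (dist1_continuous cG1 (fun t => cvg_cst (p w)))).
    have pos0 x : 0 <= pos x by rewrite /pos; have := ler_norm (- x); rewrite normrN; lra.
    have d0 z z' : 0 <= @dist1 R z z' by apply: addr_ge0.
    have posr : 0 < pos (r - dist1 (p u) (p u)).
      by rewrite /pos /dist1 !subrr normr0 addr0 subr0 gtr0_norm //; lra.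
    have posr' : 0 < pos (r - dist1 (p w) (p w)).
      by rewrite /pos /dist1 !subrr normr0 addr0 subr0 gtr0_norm //; lra.
    have F0 st : (`[0, 1] `*` `[0, 1])%classic st -> 0 < F st.
      case: st => s t [] /= /i01 s01 /i01 t01; rewrite /F /=.
      have a1 := d0 (G e s) (G e' t); have a2 := pos0 (r - dist1 (G e s) (p u)).
      have a3 := pos0 (r - dist1 (G e s) (p w)).
      rewrite Gg // in a1 a2 a3 *; case: (p01 s s01) => [s0|s1|si].
      - by rewrite s0 gu in a1 a3 *; lra.
      - by rewrite s1 gw in a1 a2 *; lra.
      suff : 0 < dist1 (g e s) (G e' t) by lra.
      apply: dist1_gt0; rewrite Gg //; case: (p01 t t01) => [->|->|ti].
      - by rewrite gu'; apply: dV.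
      - by rewrite gw'; apply: dV.
      - exact: dX.
    have [d dd Hd] := pos_lower (compact_setX c01 c01) cF F0.
    exists d; split=> // _ _ _ s t s01 t01 nx.
    have := Hd (s, t); rewrite /F /= => /(_ _).
    have pz x : ~ near r (G e s) (p x) -> pos (r - dist1 (G e s) (p x)) = 0.
      move=> h; rewrite /pos ler0_norm; first lra.
      by have [h1|] := leP (dist1 (G e s) (p x)) r; [case: h; apply: dist_near|lra].
    rewrite !pz // !addr0; apply; by split; rewrite /= in_itv.
  have [f Hf] := boolp.choice K.
  have [|d d0 Hd] := @fin_lower R _ f; first by move=> i; case: (Hf i).
  exists d => // ee h1 h2 h3 s t s01 t01 h; apply: le_trans (Hd ee) _.
  by have [_] := Hf ee; apply.
have [[x0 _]|nI] := pselect (exists x0 : 'I_n, True); last first.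
  by exists (fun _ => [::]); split=> v; case: nI; exists v.
pose mu := Num.min r d3 / 20.
have mu0 : 0 < mu by rewrite /mu divr_gt0 // lt_min r0.
have mur : 20 * mu <= r by rewrite /mu mulrC divfK // ge_min lexx.
have mud : 20 * mu <= d3 by rewrite /mu mulrC divfK // ge_min lexx orbT.
pose zone x q := near (2 * r) (scale mu q) (p x).
have zdis x y q : zone x q -> zone y q -> x = y.
  move=> zx zy; apply/eqP/negPn/negP => xy; have := Hd1 (x, y) xy.
  by have := near_dist (near_trans (nearC zx) zy); rewrite /=; lra.
have zsnap x : zone x (snap mu (p x)) by apply: near_le (snap_near _ mu0); lra.
have K (e : {set 'I_n}) : exists D : ('I_n * 'I_n) * (pt * seq pt * pt), e \in E ->
   let: (u, w, (a, m, b)) := D in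
   [/\ forall v, (v \in e) = (v == u) || (v == w), zone u a /\ zone w b, path adjz a (rcons m b),
       forall z x, z \in m -> ~ zone x z &
       forall z, z \in m -> exists2 t, 0 <= t <= 1 & near (2 * mu) (scale mu z) (G e t)].
  case eE : (e \in E); last by exists ((x0, x0), ((0, 0), [::], (0, 0))).
  have [u [w [_ me uw gu gw]]] := Hends e eE.
  have [l [pl ll /allP Ql]] := lattice_walk mu0 (cG e eE).
  have e0 : G e 0 = p u by rewrite Gg // lexx ler01.
  have e1 : G e 1 = p w by rewrite Gg // lexx ler01.
  rewrite e0 e1 in pl ll Ql.
  have [|||a [m [b [za zb pm nm sub]]]] := @walk_excursion (zone u) (zone w) _ l pl => //.
  - by rewrite ll.
  - by move=> z zu zw; move: uw; rewrite (zdis _ _ _ zu zw) eqxx.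
  have near_m z : z \in m -> exists2 t, 0 <= t <= 1 & near (2 * mu) (scale mu z) (G e t).
    move=> zm; have /sub /Ql /asboolP [t t01 h] : z \in a :: rcons m b.
      by rewrite inE mem_rcons inE zm !orbT.
    by exists t.
  exists ((u, w), (a, m, b)) => _; split=> // z x zm zx.
  have [nu nw] := nm z zm.
  have xe : x \notin e.
    by rewrite me; apply/negP => /orP [/eqP xu|/eqP xw]; [apply: nu; rewrite -xu|apply: nw; rewrite -xw].
  have [t t01 h] := near_m z zm; have := Hd2 (e, x) eE xe t t01.
  by have := near_dist (near_trans (nearC h) zx); rewrite /=; lra.
have [D HD] := boolp.choice K.
pose src e := (D e).1.1; pose tgt e := (D e).1.2.
pose ea e := (D e).2.1.1; pose em e := (D e).2.1.2; pose eb e := (D e).2.2.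
have {}HD e : e \in E -> [/\ forall v, (v \in e) = (v == src e) || (v == tgt e),
    zone (src e) (ea e) /\ zone (tgt e) (eb e), path adjz (ea e) (rcons (em e) (eb e)),
       forall z x, z \in em e -> ~ zone x z &
       forall z, z \in em e -> exists2 t, 0 <= t <= 1 & near (2 * mu) (scale mu z) (G e t)].
  by move=> /HD; rewrite /src /tgt /ea /em /eb; case: (D e) => [[u w] [[a m] b]].
have blobs x : exists s, [/\ grown s, forall q, q \in s -> zone x q,
    forall e, e \in E -> src e = x -> ea e \in s & forall e, e \in E -> tgt e = x -> eb e \in s].
  pose T := [seq ea e | e <- enum E & src e == x] ++ [seq eb e | e <- enum E & tgt e == x].
  have [||s [gs Qs sub]] := @grown_targets (fun q => `[< zone x q >]) (snap mu (p x)) T.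
  - exact/asboolP.
  - move=> y; rewrite mem_cat => /orP [] /mapP [e]; rewrite mem_filter mem_enum;
    move=> /andP [/eqP ex eE] ->; have [_ [h1 h2] _ _ _] := HD e eE;
    by apply: (conn_box mu0 (zsnap x)); rewrite -ex.
  exists s; split=> //.
  - by move=> q /(allP Qs) /asboolP.
  - move=> e eE ex; apply: sub; rewrite inE mem_cat; apply/orP; right; apply/orP; left.
    by apply/mapP; exists e; rewrite // mem_filter ex eqxx mem_enum.
  - move=> e eE ex; apply: sub; rewrite inE mem_cat; apply/orP; right; apply/orP; right.
    by apply/mapP; exists e; rewrite // mem_filter ex eqxx mem_enum.
have [S HS] := boolp.choice blobs.
have grow x : exists s', grown s' /\ forall z, z \in s' <-> z \in S x \/
    exists2 e, e \in E /\ src e = x & z \in em e.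
  have [gS _ aS _] := HS x.
  have [|s' gs' es'] := @grown_paths (S x) [seq (ea e, em e) | e <- enum E & src e == x] gS.
    move=> y /mapP [e]; rewrite mem_filter mem_enum => /andP [/eqP ex eE] -> /=.
    have [_ _ pe _ _] := HD e eE; split; first exact: aS.
    by move: pe; rewrite rcons_path => /andP [].
  exists s'; split=> // z; rewrite es'; split=> -[zS|]; [by left| |by left|].
    move=> [y /mapP [e]]; rewrite mem_filter mem_enum => /andP [/eqP ex eE] -> /= ze.
    by right; exists e.
  move=> [e [eE ex] ze]; right; exists (ea e, em e) => //.
  by apply/mapP; exists e; rewrite // mem_filter ex eqxx mem_enum.
have [B HB] := boolp.choice grow.
exists B; split.
- by move=> x _; have [] := HB x.
- move=> x y z _ _ /(HB x).2 zx /(HB y).2 zy.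
  have zoneS v : z \in S v -> zone v z by have [_ h _ _] := HS v; apply: h.
  case: zx => [/zoneS zx|[e [eE ex] ze]]; case: zy => [/zoneS zy|[e' [eE' ey] ze']].
  + exact: zdis zx zy.
  + by have [_ _ _ h _] := HD e' eE'; case: (h z x ze').
  + by have [_ _ _ h _] := HD e eE; case: (h z y ze).
  + have [ee|ne] := eqVneq e e'; first by rewrite -ex -ey ee.
    have [_ _ _ nz nt] := HD e eE; have [t t01 ht] := nt z ze.
    have [_ _ _ _ nt'] := HD e' eE'; have [t' t01' ht'] := nt' z ze'.
    have nr v : ~ near r (G e t) (p v).
      by move=> h; apply: (nz z v ze); apply: near_le (near_trans ht h); lra.
    have := Hd3 (e, e') eE eE' ne t t' t01 t01' nr.
    have := near_dist (near_trans (nearC ht) ht'); rewrite /= => h1 h2.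
    by exfalso; clear -h1 h2 mud mu0; lra.
- move=> x y _ _; rewrite /adj => xyE.
  have [me [za zb] pe _ _] := HD _ xyE.
  set e := [set x; y]%SET in xyE me za zb pe.
  have te : touch (B (src e)) (B (tgt e)).
    have eb_in : eb e \in B (tgt e).
      by apply/(HB _).2; left; have [_ _ _ h] := HS (tgt e); apply: h.
    have ea_in : ea e \in B (src e).
      by apply/(HB _).2; left; have [_ _ h _] := HS (src e); apply: h.
    move: pe; rewrite rcons_path => /andP [pe le].
    apply/touchP; exists (last (ea e) (em e)), (eb e); split=> //.
    have := mem_last (ea e) (em e); rewrite inE => /orP [/eqP -> //|lm].
    by apply/(HB _).2; right; exists e.
  have mx : x \in e by rewrite !finset.inE eqxx.
  have my : y \in e by rewrite !finset.inE eqxx orbT.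
  have ms : src e \in e by rewrite me eqxx.
  have mt : tgt e \in e by rewrite me eqxx orbT.
  have [u [w [_ mee uw _ _]]] := Hends e xyE.
  have xy : x != y.
    apply/eqP => xy; have h v : (v \in e) = (v == x) by rewrite !finset.inE -xy orbb.
    have : u \in e by rewrite mee eqxx.
    have : w \in e by rewrite mee eqxx orbT.
    by rewrite !h => /eqP wx /eqP ux; rewrite ux wx eqxx in uw.
  move: mx my; rewrite !me => /orP [/eqP xs|/eqP xt] /orP [/eqP ys|/eqP yt].
  + by rewrite xs ys eqxx in xy.
  + by rewrite xs yt.
  + by rewrite xt ys touchC.
  + by rewrite xt yt eqxx in xy.
Qed.

Local Close Scope classical_set_scope.

(** * Counting planar graphs *)

Lemma adj_sym n (E : edge_set n) : symmetric (adj E).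
Proof. by move=> x y; rewrite /adj finset.setUC. Qed.

Lemma simple_card n (E : edge_set n) e : simple_graph E -> e \in E -> #|e| = 2%N.
Proof. by move=> /forall_inP sE eE; apply/eqP/sE. Qed.

Lemma adj_irr n (E : edge_set n) : simple_graph E -> irreflexive (adj E).
Proof.
move=> sE x; apply/negP => /(simple_card sE).
by rewrite finset.setUid cards1.
Qed.

Definition edges_of n (r : rel 'I_n) : edge_set n :=
  [set [set p.1; p.2]%SET | p in [set p : 'I_n * 'I_n | r p.1 p.2]%SET]%SET.

Lemma set2_eq (T : finType) (a b c d : T) :
  [set a; b]%SET = [set c; d]%SET -> (a = c /\ b = d) \/ (a = d /\ b = c).
Proof.
move=> e.
have : a \in [set c; d]%SET by rewrite -e !finset.inE eqxx.
have : b \in [set c; d]%SET by rewrite -e !finset.inE eqxx orbT.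
have : c \in [set a; b]%SET by rewrite e !finset.inE eqxx.
have : d \in [set a; b]%SET by rewrite e !finset.inE eqxx orbT.
rewrite !finset.inE => /orP [/eqP h1|/eqP h1] /orP [/eqP h2|/eqP h2] /orP [/eqP h3|/eqP h3] /orP [/eqP h4|/eqP h4];
by [left; split; congruence|right; split; congruence] || (left; split; congruence) || (right; split; congruence).
Qed.

Lemma adj_edges_of n (r : rel 'I_n) : symmetric r -> adj (edges_of r) =2 r.
Proof.
move=> sr x y; apply/imsetP/idP => [[[a b]]|rxy]; last by exists (x, y); rewrite ?finset.inE.
by rewrite finset.inE /= => rab /set2_eq [[-> ->]|[-> ->]]; rewrite // sr.
Qed.

Lemma edges_of_simple n (r : rel 'I_n) : irreflexive r -> simple_graph (edges_of r).
Proof.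
move=> ir; apply/forall_inP => e /imsetP [[a b]]; rewrite finset.inE /= => rab ->.
have ab : a != b by apply: contraTneq rab => ->; rewrite ir.
by rewrite cards2 ab.
Qed.

Lemma edges_ofK n (E : edge_set n) : simple_graph E -> edges_of (adj E) = E.
Proof.
move=> sE; apply/finset.setP => e; apply/imsetP/idP => [[[a b]]|eE].
  by rewrite finset.inE /= => h ->.
have /eqP/cards2P [a [b [ab ee]]] := simple_card sE eE.
by exists (a, b); rewrite // finset.inE /adj /= -ee.
Qed.

Lemma arcs_edges n (E : edge_set n) : simple_graph E -> arcs (adj E) = (2 * #|E|)%N.
Proof.
move=> sE; rewrite /arcs -sum1_card (partition_big (fun d => [set d.1; d.2]%SET) (mem E)) /=; last first.
  by move=> d; rewrite finset.inE.
rewrite mulnC -sum_nat_const; apply: eq_bigr => e eE.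
have /eqP/cards2P [a [b [ab ee]]] := simple_card sE eE.
have <- : #|[set (a, b); (b, a)]%SET| = 2%N.
  by rewrite cards2 xpair_eqE (negbTE ab).
rewrite sum1_card; apply: eq_card => -[x y]; rewrite unfold_in !finset.inE /= !xpair_eqE.
apply/andP/orP => [[_ /eqP]|].
  by rewrite ee => /set2_eq [[-> ->]|[-> ->]]; [left|right]; rewrite !eqxx.
case=> /andP [/eqP -> /eqP ->]; rewrite /adj; split.
- by rewrite -ee.
- by rewrite ee.
- by rewrite finset.setUC -ee.
- by rewrite finset.setUC ee.
Qed.

Lemma pl_eq (V : finType) (e e' : rel V) : e =2 e' -> pl e -> pl e'.
Proof. by move=> ee; apply: (pl_sub (k := id)) => // x y; rewrite ee. Qed.

Lemma pl_mono (V : finType) (e e' : rel V) : subrel e' e -> pl e -> pl e'.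
Proof. by move=> ee; apply: (pl_sub (k := id)). Qed.

Definition PG (n m : nat) : {set edge_set n} :=
  [set E : edge_set n | [&& simple_graph E, #|E| == m & `[< pl (adj E) >]]]%SET.

Definition NP n m : nat := #|PG n m|.

Lemma PGP n m (E : edge_set n) :
  reflect [/\ simple_graph E, #|E| = m & pl (adj E)] (E \in PG n m).
Proof.
rewrite finset.inE; apply: (iffP and3P) => [[h1 /eqP h2 /asboolP h3]|[h1 h2 h3]]; split=> //.
  exact/eqP.
exact/asboolP.
Qed.

Lemma planar_graphsE (R : realType) n m : planar_graphs R n m = PG n m.
Proof.
apply/finset.setP => E; rewrite !finset.inE; case sE : (simple_graph E) => //=.
congr (_ && _); apply/asboolP/asboolP; [exact: planar_pl|exact: pl_planar].
Qed.

Lemma double_count (A B : finType) (X : {set A}) (Y : {set B}) (r : A -> B -> bool) (a b : nat) :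
  (forall x, x \in X -> (a <= #|[set y in Y | r x y]%SET|)%N) ->
  (forall y, y \in Y -> (#|[set x in X | r x y]%SET| <= b)%N) -> (a * #|X| <= b * #|Y|)%N.
Proof.
move=> ha hb.
apply: (@leq_trans (\sum_(x in X) \sum_(y in Y | r x y) 1)).
  rewrite mulnC -sum_nat_const; apply: leq_sum => x xX; rewrite sum1_card.
  by apply: leq_trans (ha x xX) _; apply: subset_leq_card; apply/fintype.subsetP => y; rewrite !finset.inE.
rewrite (exchange_big_dep (mem Y)) /=; last by move=> x y _ /andP [].
rewrite mulnC -sum_nat_const; apply: leq_sum => y yY; rewrite sum1_card.
apply: leq_trans (hb y yY); apply: subset_leq_card; apply/fintype.subsetP => x.
by rewrite unfold_in !finset.inE yY.
Qed.

Lemma addable n m (E : edge_set n) : (2 < n)%N -> E \in PG n m ->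
  (3 * n - 6 - m <= #|[set f : {set 'I_n} | (f \notin E) && (f |: E \in PG n m.+1)]|)%N.
Proof.
move=> n2 /PGP [sE cE plE].
have [|T [plT sT iT sub cT]] := pl_extend plE (adj_sym E) (adj_irr sE); first by rewrite card_ord.
rewrite card_ord in cT.
have sET := edges_of_simple iT; have aET := adj_edges_of sT.
have cET : arcs T = (2 * #|edges_of T|)%N.
  by rewrite -arcs_edges //; apply: eq_card => d; rewrite !finset.inE aET.
have ET : E \subset edges_of T.
  apply/fintype.subsetP => e eE; have /eqP/cards2P [a [b [ab ee]]] := simple_card sE eE.
  by rewrite ee -[_ \in _]/(adj (edges_of T) a b) aET; apply: sub; rewrite /adj -ee.
apply: (@leq_trans #|edges_of T :\: E|).
  rewrite finset.cardsD (finset.setIidPr ET) cE; apply: leq_sub2r.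
  by move: cT; rewrite cET; lia.
apply: subset_leq_card; apply/fintype.subsetP => f; rewrite !finset.in_setD => /andP [nf fT].
rewrite finset.inE nf; apply/PGP; split.
- apply/forall_inP => e; rewrite finset.inE => /orP [|/(simple_card sE) ->//].
  by rewrite finset.inE => /eqP ->; apply/eqP/(simple_card sET).
- by rewrite cardsU1 nf cE.
- apply: pl_mono plT => x y; rewrite /adj -aET finset.in_setU1 => /orP [/eqP ef|].
    by rewrite -[adj _ x y]/([set x; y]%SET \in edges_of T) ef.
  exact: (fintype.subsetP ET).
Qed.

Lemma push_edges q n m (X Y : {set edge_set n}) : (0 < q)%N -> (12 * q < n)%N ->
  (q * m + n <= 3 * q * n)%N -> X \subset PG n m ->
  (forall E f, E \in X -> f \notin E -> f |: E \in PG n m.+1 -> f |: E \in Y) ->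
  (#|X| <= 8 * q * #|Y|)%N.
Proof.
move=> q0 nq dom XP XY.
have n2 : (2 < n)%N by lia.
pose r (E E' : edge_set n) := [exists f, [&& f \notin E, E' == f |: E & E' \in PG n m.+1]].
have := @double_count _ _ X Y r (3 * n - 6 - m) m.+1.
move=> H; have {H} : ((3 * n - 6 - m) * #|X| <= m.+1 * #|Y|)%N.
  apply: H => [E EX|E' E'Y].
    apply: leq_trans (addable n2 (fintype.subsetP XP _ EX)) _.
    rewrite -(card_in_imset (f := fun f => f |: E)); last first.
      move=> f f'; rewrite !finset.inE => /andP [nf _] /andP [nf' _] e.
      have : f \in f' |: E by rewrite -e finset.setU11.
      by rewrite finset.in_setU1 (negbTE nf) orbF => /eqP.
    apply: subset_leq_card; apply/fintype.subsetP => E' /imsetP [f].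
    rewrite finset.inE => /andP [nf fP] ->; rewrite finset.inE XY //=.
    by apply/existsP; exists f; rewrite nf eqxx.
  have [/PGP [_ cE' _]|nP] := boolP (E' \in PG n m.+1); last first.
    rewrite (_ : [set x in X | r x E']%SET = finset.set0) ?cards0 //.
    apply/finset.setP => E; rewrite !finset.inE; apply/negP => /andP [_ /existsP [f /and3P [_ _ h]]].
    by rewrite h in nP.
  rewrite -cE'; apply: leq_trans (leq_imset_card (fun f => E' :\ f) _).
  apply: subset_leq_card; apply/fintype.subsetP => E; rewrite finset.inE => /andP [_ /existsP [f /and3P [nf /eqP -> _]]].
  apply/imsetP; exists f; first exact: finset.setU11.
  by rewrite setU1K.
have h1 : (n <= 2 * q * (3 * n - 6 - m))%N by nia.
have h2 : (m.+1 <= 4 * n)%N by nia.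
move=> h3; have : (n * #|X| <= 2 * q * (4 * n * #|Y|))%N.
  apply: leq_trans (leq_mul h1 (leqnn _)) _; rewrite -mulnA leq_mul2l; apply/orP; right.
  by apply: leq_trans h3 _; rewrite leq_mul2r h2 orbT.
rewrite (_ : 2 * q * (4 * n * #|Y|) = n * (8 * q * #|Y|))%N; last by ring.
by rewrite leq_pmul2l //; lia.
Qed.

Lemma card_dep_sum (A B : finType) (S : {set A}) (F : A -> {set B}) :
  #|[set p : A * B | (p.1 \in S) && (p.2 \in F p.1)]%SET| = (\sum_(a in S) #|F a|)%N.
Proof.
rewrite -sum1_card.
rewrite (eq_bigl (fun p : A * B => (p.1 \in S) && (p.2 \in F p.1))); last by move=> p; rewrite finset.inE.
rewrite -(pair_big_dep (mem S) (fun a b => b \in F a) (fun _ _ => 1%N)) /=.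
by apply: eq_bigr => a _; rewrite sum1_card.
Qed.

Lemma card_dep (A B : finType) (S : {set A}) (F : A -> {set B}) (K : nat) :
  (forall a, a \in S -> (#|F a| <= K)%N) ->
  (#|[set p : A * B | (p.1 \in S) && (p.2 \in F p.1)]%SET| <= K * #|S|)%N.
Proof.
by move=> FK; rewrite card_dep_sum mulnC -sum_nat_const; apply: leq_sum.
Qed.

Lemma arcs_sum n (e : rel 'I_n) : arcs e = (\sum_a \sum_b (e a b))%N.
Proof.
rewrite arcsE; apply: eq_bigr => a _; rewrite -sum1_card big_mkcond /=.
by apply: eq_bigr => b _; rewrite finset.inE; case: (e a b).
Qed.

Lemma arcs_lift n (e : rel 'I_n.+1) v : symmetric e -> irreflexive e ->
  arcs e = (arcs (fun a b => e (lift v a) (lift v b)) + 2 * #|nbr e v|)%N.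
Proof.
move=> se ie; rewrite !arcs_sum (bigD1_ord v) //= [X in (X + _)%N](_ : _ = #|nbr e v|); last first.
  rewrite /nbr -sum1_card [RHS]big_mkcond /=; apply: eq_bigr => b _.
  by rewrite finset.inE; case: (e v b).
rewrite addnC mul2n -addnn addnA; congr (_ + _)%N.
rewrite (eq_bigr (fun a => (e (lift v a) v + \sum_b e (lift v a) (lift v b))%N)); last first.
  by move=> a _; rewrite (bigD1_ord v).
rewrite big_split /= addnC; congr (_ + _)%N.
rewrite -sum1_card [RHS]big_mkcond /= [RHS](bigD1_ord v) //= finset.inE ie add0n.
by apply: eq_bigr => b _; rewrite finset.inE se; case: (e v _).
Qed.

Section Contraction.

Variables (n : nat) (e : rel 'I_n.+1) (v : 'I_n.+1) (y : 'I_n).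
Hypotheses (se : symmetric e) (ie : irreflexive e) (vy : e v (lift v y)).

Let L : 'I_n -> 'I_n.+1 := lift v.

Definition contr : rel 'I_n := fun a b =>
  (a != b) && [|| e (L a) (L b), (a == y) && e v (L b) | (b == y) && e v (L a)].

Definition contr_S : {set 'I_n} := [set a | (a != y) && e v (L a)]%SET.
Definition contr_S' : {set 'I_n} := [set a in contr_S | e (L y) (L a)]%SET.

Lemma contr_sym : symmetric contr.
Proof.
move=> a b; rewrite /contr eq_sym (se (L a)); case: (b != a) => //=.
by congr (_ || _); rewrite orbC.
Qed.

Lemma contr_irr : irreflexive contr.
Proof. by move=> a; rewrite /contr eqxx. Qed.

Lemma contr_pl : pl e -> pl contr.
Proof.
move=> ple.
apply: (pl_minor_star (k := L) (f := fun x => if x == v then Some y else unlift v x) ple).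
- by move=> w; rewrite eq_sym (negbTE (neq_lift _ _)) liftK.
- move=> x w; case: eqVneq => [-> [<-]|xv]; first by right; rewrite se.
  by case: unliftP => // j -> [<-]; left.
move=> a b /andP [ab] /or3P [eab|/andP [/eqP -> evb]|/andP [/eqP -> eva]].
- by exists (L a), (L b); rewrite !(eq_sym _ v) !(negbTE (neq_lift _ _)) !liftK.
- by exists v, (L b); rewrite eqxx eq_sym (negbTE (neq_lift _ _)) liftK.
- by exists (L a), v; rewrite eqxx eq_sym (negbTE (neq_lift _ _)) liftK se.
Qed.

Lemma contr_decode a b : e (L a) (L b) =
  contr a b && ~~ ((a == y) && (b \in contr_S) && (b \notin contr_S') ||
                   (b == y) && (a \in contr_S) && (a \notin contr_S')).
Proof.
rewrite /contr !finset.inE.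
case: (eqVneq a b) => [->|ab] /=; first by rewrite ie.
case: (eqVneq a y) => [ay|ay]; case: (eqVneq b y) => [yb|yb] /=.
- by rewrite ay yb eqxx in ab.
- by rewrite ay !orbF; case: (e (L y) (L b)); case: (e v (L b)).
- by rewrite yb (se (L a)); case: (e (L y) (L a)); case: (e v (L a)).
- by rewrite !orbF andbT.
Qed.

Lemma contr_nbr a : e v (L a) = (a == y) || (a \in contr_S).
Proof. by rewrite !finset.inE; case: eqVneq => [->|] //=. Qed.

Lemma contr_sub : contr_S \subset nbr contr y.
Proof.
apply/fintype.subsetP => a; rewrite !finset.inE => /andP [ay va].
by rewrite /contr eq_sym ay eqxx va orbT.
Qed.

Lemma sum_pred (P : pred 'I_n) : (\sum_b (P b) = #|[set b | P b]%SET|)%N.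
Proof.
rewrite -sum1_card big_mkcond [RHS]big_mkcond /=; apply: eq_bigr => b _.
by rewrite finset.inE; case: (P b).
Qed.

Lemma contr_deg : #|nbr e v| = #|contr_S|.+1.
Proof.
have -> : nbr e v = (L @: (y |: contr_S)%SET)%SET.
  apply/finset.setP => x; rewrite finset.inE; apply/idP/imsetP => [evx|[a]].
    case: (unliftP v x) => [a xa|xv]; last by rewrite xv ie in evx.
    by exists a => //; rewrite finset.in_setU1 -contr_nbr /L -xa.
  by rewrite finset.in_setU1 -contr_nbr => h ->.
rewrite card_imset; last exact: lift_inj.
by rewrite cardsU1 finset.inE eqxx.
Qed.

Lemma contr_arcs : arcs e = (arcs contr + 2 + 2 * #|contr_S'|)%N.
Proof.
have h2 : (arcs (fun a b => e (L a) (L b)) + 2 * #|contr_S :\: contr_S'| = arcs contr)%N.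
  pose T := (contr_S :\: contr_S')%SET.
  have hT : (#|T| = \sum_a \sum_b ((a == y) && (b \in T)))%N.
    rewrite (bigD1 y) //= [X in (_ + X)%N]big1; last by move=> a /negbTE ->; rewrite big1.
    rewrite addn0 eqxx sum_pred; apply: eq_card => b.
    by rewrite [in RHS]finset.inE.
  have hT' : (#|T| = \sum_a \sum_b ((b == y) && (a \in T)))%N by rewrite exchange_big.
  rewrite mul2n -addnn [in X in (_ + (X + _))%N]hT hT' addnA !arcs_sum -!big_split /=.
  apply: eq_bigr => a _; rewrite -!big_split /=; apply: eq_bigr => b _.
  rewrite contr_decode !finset.inE /contr.
  case: (eqVneq a b) => [->|ab] /=; first by case: eqVneq.
  case: (eqVneq a y) => [ay|ay]; case: (eqVneq b y) => [yb|yb] /=.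
  - by rewrite ay yb eqxx in ab.
  - by rewrite ay !orbF; case: (e (L y) (L b)); case: (e v (L b)).
  - by rewrite yb (se (L a)); case: (e (L y) (L a)); case: (e v (L a)).
  - by rewrite !orbF andbT addn0; case: (e _ _).
have h3 : (#|contr_S :\: contr_S'| + #|contr_S'| = #|contr_S|)%N.
  rewrite addnC -(cardsID contr_S' contr_S); congr (_ + _)%N.
  rewrite (finset.setIidPr _) //; apply/fintype.subsetP => a.
  by rewrite finset.inE => /andP [].
rewrite (arcs_lift v) // contr_deg -h3 -h2; ring.
Qed.

Lemma contr_nbr_le : (#|nbr contr y| <= #|contr_S| + #|nbr e (L y)|)%N.
Proof.
apply: (@leq_trans #|contr_S :|: [set a | e (L y) (L a)]%SET|).
  apply: subset_leq_card; apply/fintype.subsetP => a; rewrite !finset.inE /contr.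
  rewrite (eq_sym y); case: (a == y); rewrite //= eqxx orbF.
  by rewrite orbC.
rewrite cardsU; apply: leq_trans (leq_subr _ _) _; rewrite leq_add2l.
rewrite -(card_imset _ (@lift_inj _ v)); apply: subset_leq_card.
by apply/fintype.subsetP => x /imsetP [a]; rewrite !finset.inE => h ->.
Qed.

End Contraction.

Lemma small_pairs (T : finType) (N : {set T}) (D : nat) :
  (#|[set p : {set T} * {set T} | [&& p.1 \subset N, p.2 \subset p.1 &
       (#|p.1| <= 1) || (#|N| <= 2 * D)]]%SET| <= 2 * (1 + #|N|) + 16 ^ D)%N.
Proof.
have [ND|ND] := leqP #|N| (2 * D).
  apply: leq_trans (leq_addl _ _).
  apply: (@leq_trans #|finset.setX (powerset N) (powerset N)|).
    apply: subset_leq_card; apply/fintype.subsetP => -[S S']; rewrite !finset.inE /= => /and3P [h1 h2 _].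
    by rewrite h1 (fintype.subset_trans h2).
  rewrite cardsX !card_powerset -expnD (_ : 16 = 2 ^ 4)%N // -expnM leq_exp2l //; lia.
apply: leq_trans (leq_addr _ _).
pose A := [set S : {set T} | (S \subset N) && (#|S| <= 1)%N]%SET.
have cA : (#|A| <= 1 + #|N|)%N.
  apply: (@leq_trans #|(finset.set0 |: [set [set a]%SET | a in N])%SET|).
    apply: subset_leq_card; apply/fintype.subsetP => S; rewrite !finset.inE => /andP [SN].
    rewrite leq_eqVlt ltnS leqn0 cards_eq0 => /orP [/cards1P [a Sa]|/eqP ->]; rewrite ?eqxx //.
    by apply/orP; right; apply/imsetP; exists a => //; rewrite -finset.sub1set -Sa.
  rewrite cardsU1; apply: leq_add; first by case: (_ \in _).
  exact: leq_imset_card.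
apply: leq_trans (_ : 2 * #|A| <= _)%N; last by rewrite leq_mul2l.
apply: leq_trans (card_dep (F := fun S => powerset S) _); last first.
  move=> S; rewrite finset.inE => /andP [_ S1]; rewrite card_powerset.
  by rewrite -[X in (_ <= X)%N]expn1 leq_exp2l.
apply: subset_leq_card; apply/fintype.subsetP => -[S S'].
by rewrite !finset.inE /= => /and3P [-> -> /orP [->//|]].
Qed.

Definition cinfo n (D : nat) (E : edge_set n) : {set 'I_n * ({set 'I_n} * {set 'I_n})} :=
  [set p : 'I_n * ({set 'I_n} * {set 'I_n}) | [&& p.2.1 \subset nbr (adj E) p.1, p.2.2 \subset p.2.1 &
    (#|p.2.1| <= 1)%N || (#|nbr (adj E) p.1| <= 2 * D)%N]]%SET.

Lemma cinfo_card n D (E : edge_set n) : simple_graph E -> pl (adj E) ->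
  (#|cinfo D E| <= (30 + 16 ^ D) * n)%N.
Proof.
move=> sE plE.
pose F y := [set p : {set 'I_n} * {set 'I_n} | [&& p.1 \subset nbr (adj E) y, p.2 \subset p.1 &
       (#|p.1| <= 1)%N || (#|nbr (adj E) y| <= 2 * D)%N]]%SET.
have -> : #|cinfo D E| = (\sum_(y in [set: 'I_n]%SET) #|F y|)%N.
  by rewrite -card_dep_sum; apply: eq_card => p; rewrite !finset.inE.
rewrite (eq_bigl predT); last by move=> y; rewrite finset.inE.
apply: (@leq_trans (\sum_y (2 * (1 + #|nbr (adj E) y|) + 16 ^ D))%N).
  by apply: leq_sum => y _; exact: small_pairs.
rewrite big_split /= -big_distrr /= big_split /= -arcsE !sum_nat_const card_ord.
have := pl_arcs plE (adj_sym E) (adj_irr sE); rewrite card_ord.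
by move: (16 ^ D)%N (arcs _) => c a; nia.
Qed.

Definition good (V : finType) (e : rel V) (D : nat) : {set V} :=
  [set v | [exists y, e v y && ((#|nbr e v| <= 2)%N ||
     (#|nbr e v| <= D)%N && (#|nbr e y| <= D)%N)]]%SET.

Definition isol (V : finType) (e : rel V) : {set V} := [set v | #|nbr e v| == 0%N]%SET.

Lemma many_good (V : finType) (e : rel V) D : (2 * 1184 * 14 <= D.+1)%N ->
  pl e -> symmetric e -> irreflexive e -> (#|V| <= 2 * (#|good e D| + #|isol e|))%N.
Proof.
move=> hD ple se ie.
pose Hi := [set v | (D < #|nbr e v|)%N]%SET.
pose Q := [set v | [&& v \notin Hi, (2 < #|nbr e v|)%N & nbr e v \subset Hi]]%SET.
have QH : (#|Q| <= 1183 * #|Hi|)%N.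
  apply: pl_high ple se ie _ _.
    by rewrite disjoint_sym; apply/pred0P => v /=; rewrite [X in X && _]finset.inE; case: (v \in Hi); rewrite ?andbF.
  by move=> q; rewrite finset.inE => /and3P [_ h2 /finset.setIidPl ->].
have cov : [set: V]%SET \subset ((good e D :|: isol e) :|: (Hi :|: Q))%SET.
  apply/fintype.subsetP => v _; rewrite !finset.in_setU -implyNb; apply/implyP.
  rewrite negb_or => /andP [ng ni]; rewrite -implyNb; apply/implyP => nHi.
  have dv : (0 < #|nbr e v|)%N by rewrite lt0n; move: ni; rewrite finset.inE.
  have dD : (#|nbr e v| <= D)%N by move: nHi; rewrite finset.inE -leqNgt.
  rewrite finset.inE nHi /=; apply/andP; split.
    rewrite ltnNge; apply: contra ng => le2; rewrite finset.inE.
    have /card_gt0P [y] := dv; rewrite finset.inE => vy.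
    by apply/existsP; exists y; rewrite vy le2.
  apply/fintype.subsetP => y; rewrite finset.inE => vy; rewrite finset.inE ltnNge.
  apply: contra ng => yD; rewrite finset.inE; apply/existsP; exists y.
  by rewrite vy dD yD orbT.
have c1 : (#|V| <= #|good e D| + #|isol e| + (#|Hi| + #|Q|))%N.
  rewrite -cardsT; apply: leq_trans (subset_leq_card cov) _.
  by rewrite cardsU; apply: leq_trans (leq_subr _ _) _; apply: leq_add;
     rewrite cardsU; exact: leq_subr.
have c2 : (D.+1 * #|Hi| <= 14 * #|V|)%N.
  apply: leq_trans (pl_arcs ple se ie); rewrite arcsE mulnC -sum_nat_const.
  rewrite [X in (_ <= X)%N](bigID (mem Hi)) /=; apply: leq_trans (leq_addr _ _).
  by apply: leq_sum => v; rewrite finset.inE.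
have c3 : (2 * 1184 * 14 * #|Hi| <= 14 * #|V|)%N.
  by apply: leq_trans c2; rewrite leq_mul2r hD orbT.
move: QH c1 c3; clear.
move: (#|Q|) (#|Hi|) (#|V|) (#|good e D|) (#|isol e|) => x1 x2 x3 x4 x5.
lia.
Qed.

Lemma PG_sub n m (E E' : edge_set n) : E \in PG n m -> E' \subset E -> E' \in PG n #|E'|.
Proof.
move=> /PGP [sE _ plE] /fintype.subsetP sub; apply/PGP; split=> //.
  by apply/forall_inP => e /sub /(simple_card sE) ->.
by apply: pl_mono plE => x y; exact: sub.
Qed.

Lemma adj_ext n (E E' : edge_set n) : simple_graph E -> simple_graph E' ->
  adj E =2 adj E' -> E = E'.
Proof.
move=> sE sE' ee; rewrite -(edges_ofK sE) -(edges_ofK sE').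
rewrite /edges_of (_ : [set p | _]%SET = [set p | adj E' p.1 p.2]%SET) //.
by apply/finset.setP => d; rewrite !finset.inE ee.
Qed.

Lemma pairs_card n : (#|[set f : {set 'I_n} | #|f| == 2%N]%SET| <= n * n)%N.
Proof.
apply: (@leq_trans #|[set [set p.1; p.2]%SET | p in [set: 'I_n * 'I_n]%SET]%SET|).
  apply: subset_leq_card; apply/fintype.subsetP => f; rewrite finset.inE => /cards2P [a [b [_ ->]]].
  by apply/imsetP; exists (a, b).
by apply: leq_trans (leq_imset_card _ _) _; rewrite cardsT card_prod card_ord.
Qed.

Lemma remove_edge n m : (m.+1 * NP n m.+1 <= n * n * NP n m)%N.
Proof.
apply: (double_count (r := fun E E' : edge_set n => [exists f in E, E' == E :\ f])).
  move=> E EP; have /PGP [sE cE plE] := EP; rewrite -{1}cE.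
  rewrite -(card_in_imset (f := fun f => E :\ f)); last first.
    move=> f f' fE f'E ee; apply/eqP; apply: contraT => ff'.
    have : f \in E :\ f' by rewrite finset.in_setD1 ff'.
    by rewrite -ee finset.in_setD1 eqxx.
  apply: subset_leq_card; apply/fintype.subsetP => E' /imsetP [f fE ->].
  rewrite finset.inE; apply/andP; split; last by apply/existsP; exists f; rewrite fE eqxx.
  have := PG_sub EP (finset.subD1set E f).
  by have := cardsD1 f E; rewrite fE cE add1n => -[->].
move=> E' E'P; apply: leq_trans (pairs_card n).
apply: leq_trans (leq_imset_card (fun f => f |: E') _).
apply: subset_leq_card; apply/fintype.subsetP => E; rewrite finset.inE => /andP [EP /existsP [f /andP [fE /eqP ->]]].
apply/imsetP; exists f; last by rewrite finset.setD1K.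
by have /PGP [sE _ _] := EP; rewrite finset.inE (simple_card sE).
Qed.

Lemma push_le q n m : (0 < q)%N -> (12 * q < n)%N -> (q * m + n <= 3 * q * n)%N ->
  (NP n m <= 8 * q * NP n m.+1)%N.
Proof. by move=> q0 nq dom; apply: (push_edges q0 nq dom (fintype.subxx _)). Qed.

Lemma push_le_iter q n m j : (0 < q)%N -> (12 * q < n)%N -> (q * m + n <= 3 * q * n)%N ->
  (j <= m)%N -> (NP n (m - j) <= (8 * q) ^ j * NP n m)%N.
Proof.
move=> q0 nq dom; elim: j => [|j IH] jm; first by rewrite subn0 mul1n.
apply: leq_trans (push_le q0 nq _) _; first by nia.
by rewrite subnSK // expnS -[X in (_ <= X)%N]mulnA leq_mul2l IH ?orbT // ltnW.
Qed.

Lemma adj_lift_det n (E1 E2 : edge_set n.+1) v : simple_graph E1 -> simple_graph E2 ->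
  (forall a b, adj E1 (lift v a) (lift v b) = adj E2 (lift v a) (lift v b)) ->
  (forall a, adj E1 v (lift v a) = adj E2 v (lift v a)) -> E1 = E2.
Proof.
move=> s1 s2 h1 h2; apply: adj_ext => // x z.
case: (unliftP v x) => [a|] ->; case: (unliftP v z) => [b|] ->; rewrite ?h1 ?h2 //.
  by rewrite adj_sym h2 adj_sym.
by rewrite !adj_irr.
Qed.

Lemma isolated_count n m :
  (#|[set p : edge_set n.+1 * 'I_n.+1 | (p.1 \in PG n.+1 m) && (p.2 \in isol (adj p.1))]%SET|
     <= n.+1 * NP n m)%N.
Proof.
pose F (p : edge_set n.+1 * 'I_n.+1) : 'I_n.+1 * edge_set n :=
  (p.2, edges_of (fun a b => adj p.1 (lift p.2 a) (lift p.2 b))).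
have sF (E : edge_set n.+1) v : symmetric (fun a b => adj E (lift v a) (lift v b)).
  by move=> a b /=; rewrite adj_sym.
have iF (E : edge_set n.+1) v : simple_graph E -> irreflexive (fun a b => adj E (lift v a) (lift v b)).
  by move=> sE a /=; rewrite adj_irr.
rewrite -(card_in_imset (f := F)); last first.
  move=> [E1 v1] [E2 v2]; rewrite finset.inE => /andP [/PGP [s1 _ _] i1].
  rewrite finset.inE => /andP [/PGP [s2 _ _] i2].
  move=> [ev ee]; move: s1 i1 s2 i2 ev ee => /= s1 i1 s2 i2 ev ee; subst v2; congr (_, _); apply: (adj_lift_det (v := v1)) => // [a b|a].
    have := adj_edges_of (sF E1 v1) a b; rewrite ee adj_edges_of // => <- //.
  move: i1 i2; rewrite !finset.inE !cards_eq0 => /eqP i1 /eqP i2.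
  have : lift v1 a \notin nbr (adj E1) v1 by rewrite i1 finset.in_set0.
  have : lift v1 a \notin nbr (adj E2) v1 by rewrite i2 finset.in_set0.
  by rewrite !finset.inE => /negbTE -> /negbTE ->.
rewrite -[in X in (_ <= X)%N](card_ord n.+1) -cardsT -cardsX.
apply: subset_leq_card; apply/fintype.subsetP => q /imsetP [[E v]].
rewrite finset.inE /= => /andP [/PGP [sE cE plE] iv] ->.
rewrite /F finset.in_setX finset.in_setT /=; apply/PGP; split.
- exact/edges_of_simple/iF.
- apply/eqP; rewrite -(eqn_pmul2l (isT : 0 < 2)%N) -arcs_edges; last exact/edges_of_simple/iF.
  have := arcs_lift v (adj_sym E) (adj_irr sE); rewrite arcs_edges // cE.
  move: iv; rewrite finset.inE => /eqP ->; rewrite muln0 addn0 => ->; apply/eqP.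
  by apply: eq_card => d; rewrite !finset.inE adj_edges_of.
- apply: (pl_eq (fun a b => esym (adj_edges_of (sF E v) a b))).
  by apply: (pl_sub (k := lift v)) plE => //; exact: lift_inj.
Qed.

Definition near_PG n m D : {set edge_set n} :=
  [set E | [exists j : 'I_D.+1, (j <= m)%N && (E \in PG n (m - j))]]%SET.

Lemma near_PG_card q n m D : (0 < q)%N -> (12 * q < n)%N -> (q * m + n <= 3 * q * n)%N ->
  (#|near_PG n m D| <= D.+1 * (8 * q) ^ D * NP n m)%N.
Proof.
move=> q0 nq dom.
pose F (j : 'I_D.+1) := if (j <= m)%N then PG n (m - j) else finset.set0.
apply: (@leq_trans #|\bigcup_(j : 'I_D.+1) F j|%SET).
  apply: subset_leq_card; apply/fintype.subsetP => E; rewrite finset.inE => /existsP [j /andP [jm jP]].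
  by apply/bigcupP; exists j => //; rewrite /F jm.
apply: (@leq_trans (\sum_(j < D.+1) #|F j|)%N).
  apply: (big_ind2 (fun (A : {set edge_set n}) k => (#|A| <= k)%N)); rewrite ?cards0 //.
  move=> A a B b Aa Bb; rewrite finset.cardsU; apply: leq_trans (leq_subr _ _) _; exact: leq_add.
apply: (@leq_trans (\sum_(j < D.+1) (8 * q) ^ D * NP n m)%N); last first.
  by rewrite sum_nat_const card_ord mulnA.
apply: leq_sum => j _; rewrite /F; case: ifP => jm; last by rewrite cards0.
apply: leq_trans (push_le_iter q0 nq dom jm) _.
by rewrite leq_mul2r leq_pexp2l ?orbT // ?muln_gt0 ?q0 // -ltnS.
Qed.

Lemma good_count n m D : (0 < n)%N -> (0 < D)%N ->
  (#|[set p : edge_set n.+1 * 'I_n.+1 | (p.1 \in PG n.+1 m.+1) && (p.2 \in good (adj p.1) D)]%SET|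
     <= (30 + 16 ^ D) * n * (n.+1 * #|near_PG n m D|))%N.
Proof.
move=> n0 D0.
set X := [set p | _]%SET.
have ex (p : edge_set n.+1 * 'I_n.+1) : exists y : 'I_n, p \in X ->
    [/\ simple_graph p.1, #|p.1| = m.+1, pl (adj p.1), adj p.1 p.2 (lift p.2 y) &
     (#|nbr (adj p.1) p.2| <= 2)%N \/
     (#|nbr (adj p.1) p.2| <= D)%N /\ (#|nbr (adj p.1) (lift p.2 y)| <= D)%N].
  case pX : (p \in X); last by exists (Ordinal n0).
  move: pX; rewrite finset.inE => /andP [/PGP [sE cE plE]]; rewrite finset.inE => /existsP [z /andP [vz hz]].
  move: vz hz; case: (unliftP p.2 z) => [y|] ->; last by rewrite adj_irr.
  move=> vy hz; exists y => _; split=> //.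
  by case/orP: hz => [|/andP []]; [left|right].
have [Y HY] := boolp.choice ex.
pose F (p : edge_set n.+1 * 'I_n.+1) :=
  let e := adj p.1 in let v := p.2 in let y := Y p in
  ((v, edges_of (contr e v y)), (y, (contr_S e v y, contr_S' e v y))).
rewrite -(card_in_imset (f := F)); last first.
  move=> [E1 v1] [E2 v2] /HY /= [s1 _ _ a1 _] /HY /= [s2 _ _ a2 _] [ev ee ey eS eS'].
  subst v2; congr (_, _).
  move: a1 a2 ee ey eS eS'; move: (Y _) (Y _) => y1 y2 a1 a2 ee ey; subst y2 => eS eS'.
  have eC : contr (adj E1) v1 y1 =2 contr (adj E2) v1 y1.
    move=> a b; rewrite -(adj_edges_of (contr_sym v1 y1 (adj_sym E1))) ee adj_edges_of //.
    exact/contr_sym/adj_sym.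
  apply: (adj_lift_det (v := v1)) => // [a b|a].
    rewrite (contr_decode v1 y1 (adj_sym E1) (adj_irr s1)).
    by rewrite (contr_decode v1 y1 (adj_sym E2) (adj_irr s2)) eC eS eS'.
  by rewrite (contr_nbr a1) (contr_nbr a2) eS.
pose T := finset.setX [set: 'I_n.+1]%SET (near_PG n m D).
apply: (@leq_trans ((30 + 16 ^ D) * n * #|T|)%N); last first.
  by rewrite cardsX cardsT card_ord.
apply: leq_trans (card_dep (S := T) (F := fun t => cinfo D t.2) _); last first.
  move=> [v E'] /finset.setXP [_]; rewrite finset.inE => /existsP [j /andP [_ /PGP [s1 _ p1]]].
  exact: cinfo_card.
apply: subset_leq_card; apply/fintype.subsetP => q /imsetP [[E v] pX ->].
have /= [sE cE plE vy deg] := HY _ pX.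
rewrite finset.in_set /F /=; move: (Y _) vy deg => {pX} y vy deg.
have se := adj_sym E; have ie := adj_irr sE.
have sC := contr_sym v y se; have iC := contr_irr (adj E) v y.
have dS := contr_deg ie vy.
have SS : contr_S' (adj E) v y \subset contr_S (adj E) v y.
  by apply/fintype.subsetP => a; rewrite finset.inE => /andP [].
have cSS := subset_leq_card SS.
have nC : nbr (adj (edges_of (contr (adj E) v y))) y = nbr (contr (adj E) v y) y.
  by apply/finset.setP => a; rewrite !finset.inE adj_edges_of.
apply/andP; split.
  apply/finset.setXP; split=> //.
  have cA := contr_arcs se ie vy; rewrite arcs_edges // cE in cA.
  have cA' : arcs (contr (adj E) v y) = (2 * #|edges_of (contr (adj E) v y)|)%N.
    rewrite -arcs_edges; last exact: edges_of_simple.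
    by apply: eq_card => d; rewrite !finset.inE adj_edges_of.
  have SD : (#|contr_S' (adj E) v y| < D.+1)%N.
    rewrite ltnS; apply: leq_trans cSS _.
    case: deg => [|[d1 _]]; first by rewrite dS ltnS => h; exact: leq_trans h D0.
    by apply: leq_trans d1; rewrite dS.
  rewrite finset.inE; apply/existsP; exists (Ordinal SD) => /=.
  rewrite cA' in cA; move: cA; move: #|contr_S' _ _ _| => s cA; apply/andP; split; first by clear -cA; lia.
  apply/PGP; split.
  - exact: edges_of_simple.
  - by move: cA; move: #|_| => k cA; clear -cA; lia.
  - exact: (pl_eq (fun a b => esym (adj_edges_of sC a b)) (contr_pl se vy plE)).
rewrite finset.inE /= nC contr_sub //= SS /=.
case: deg => [|[d1 d2]]; first by rewrite dS ltnS => ->.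
apply/orP; right; apply: leq_trans (contr_nbr_le _ _ _) _.
rewrite mul2n -addnn; apply: leq_add => //.
by apply: leq_trans d1; rewrite dS.
Qed.

(* Removing a vertex and an edge: a vertex of bounded degree is contracted into a
   neighbour, so that the graph is recovered from boundedly many data per vertex. *)
Lemma vertex_le q : (0 < q)%N -> exists C, forall n m, (12 * q < n)%N ->
  (q * m + n <= 3 * q * n)%N -> (n <= q * m.+1)%N -> (NP n.+1 m.+1 <= C * n * NP n m)%N.
Proof.
move=> q0; have [D hD] : exists D, (2 * 1184 * 14 <= D.+1)%N by exists (2 * 1184 * 14)%N.
have D0 : (0 < D)%N by move: hD; clear; case: D.
exists (2 * ((30 + 16 ^ D) * (D.+1 * (8 * q) ^ D) + q))%N => n m nq dom nm.
have n0 : (0 < n)%N by exact: leq_ltn_trans nq.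
have h1 := good_count m n0 D0; have h2 := isolated_count n m.+1.
have h3 := near_PG_card D q0 nq dom.
have h4 : (NP n m.+1 <= q * n * NP n m)%N.
  rewrite -(leq_pmul2l n0).
  apply: (@leq_trans (q * (m.+1 * NP n m.+1))%N); first by rewrite mulnA leq_mul2r nm orbT.
  rewrite (_ : n * (q * n * NP n m) = q * (n * n * NP n m))%N; last by ring.
  by rewrite leq_mul2l remove_edge orbT.
have h5 : (n.+1 * NP n.+1 m.+1 <= 2 * (
    #|[set p : edge_set n.+1 * 'I_n.+1 | (p.1 \in PG n.+1 m.+1) && (p.2 \in good (adj p.1) D)]%SET| +
    #|[set p : edge_set n.+1 * 'I_n.+1 | (p.1 \in PG n.+1 m.+1) && (p.2 \in isol (adj p.1))]%SET|))%N.
  rewrite (card_dep_sum _ (fun E => good (adj E) D)) (card_dep_sum _ (fun E => isol (adj E))).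
  rewrite -big_split big_distrr /= mulnC -sum_nat_const; apply: leq_sum => E /PGP [sE _ plE].
  by rewrite -{1}(card_ord n.+1); apply: many_good => //; [exact: adj_sym|exact: adj_irr].
rewrite -(leq_pmul2l (ltn0Sn n)); apply: leq_trans h5 _.
apply: (@leq_trans (2 * ((30 + 16 ^ D) * n * (n.+1 * (D.+1 * (8 * q) ^ D * NP n m)) +
   n.+1 * (q * n * NP n m))))%N; last first.
  by move: (30 + 16 ^ D)%N (D.+1 * (8 * q) ^ D)%N (NP n m) => x1 x2 x3; apply: eq_leq; ring.
rewrite leq_mul2l /=; apply: leq_add.
  by apply: leq_trans h1 _; rewrite leq_mul2l leq_mul2l h3 !orbT.
by apply: leq_trans h2 _; rewrite leq_mul2l h4 orbT.
Qed.

Definition pendant (V : finType) (e : rel V) (u : V) : rel (option V) := ext e (pred1 u).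

Lemma pl_K2 : pl [rel x y : bool | x != y].
Proof.
exists (fun x : bool => [:: ((x : nat)%:Z, 0 : int)] : seq pt); split=> [[]//|x y z _ _|x y _ _].
  by rewrite !mem_seq1 => /eqP -> /eqP; case: x y => [] [].
by case: x y => [] [].
Qed.

Lemma pl_pendant (V : finType) (e : rel V) u : pl e -> symmetric e -> irreflexive e ->
  pl (pendant e u).
Proof.
move=> ple se ie.
have [/existsP [w euw]|/existsPn iso] := boolP [exists w, e u w].
  have [rot [_ _ H]] := rotation ple se ie.
  apply: (pl_mono _ (H (u, w) euw)) => -[x|] [y|] //= /eqP ->; apply/existsP; exists w;
    by rewrite /= euw connect0.
pose k (x : option V) : V + bool := if x is Some x then (if x == u then inr true else inl x) else inr false.
apply: (pl_sub (k := k) _ _ (pl_union u true ple pl_K2)).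
  move=> [x|] [y|] //=.
  - by case: (eqVneq x u) => [->|_]; case: (eqVneq y u) => [->|_] // [->].
  - by case: (eqVneq x u).
  - by case: (eqVneq y u).
move=> [x|] [y|] //=.
- case: eqVneq => [->|_]; first by rewrite (negbTE (iso y)).
  by case: eqVneq => [->|_] //; rewrite se (negbTE (iso x)).
- by move=> /eqP ->; rewrite eqxx.
- by move=> /eqP ->; rewrite eqxx.
Qed.

Definition Dom q n m : bool := (n <= q * m)%N && (q * m + n <= 3 * q * n)%N.

Lemma Dom_shift q a b n m : (0 < q)%N -> (2 * q * b + 6 * q * a + a + 1 <= n)%N -> Dom q n m ->
  [/\ Dom (2 * q) (n - a) (m - b), (a <= n)%N & (b <= m)%N].
Proof.
move=> q0 h /andP [h1 h2].
have bm : (b <= m)%N.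
  by rewrite -(leq_pmul2l q0); move: h1 h; rewrite -!mulnA; move: (q * b)%N (q * m)%N (q * a)%N => x1 x2 x3; clear; lia.
have an : (a <= n)%N by lia.
split=> //; rewrite /Dom !mulnBr -!mulnA.
have qb : (q * b <= q * m)%N by rewrite leq_mul2l bm orbT.
have qa : (q * a <= q * n)%N by rewrite leq_mul2l an orbT.
move: h1 h2 h qb qa; rewrite -!mulnA.
by move: (q * b)%N (q * m)%N (q * a)%N (q * n)%N => x1 x2 x3 x4; clear; lia.
Qed.

Lemma vertex_le_iter K q : (0 < q)%N -> exists C N, forall n m, (N <= n)%N -> Dom q n m ->
  (NP n m <= C * n ^ K * NP (n - K) (m - K))%N.
Proof.
elim: K q => [|K IH] q q0.
  by exists 1%N, 0%N => n m _ _; rewrite !subn0 !mul1n.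
have q20 : (0 < 2 * q)%N by lia.
have [C HC] := vertex_le q20; have [C' [N' HC']] := IH _ q20.
exists (C * C')%N, (N' + 100 * q + 100)%N => n m nN dom.
have [|dom' n1 m1] := @Dom_shift q 1 1 n m q0 _ dom; first by lia.
case: n n1 nN dom dom' => // n _ nN dom; case: m m1 dom => // m _ dom; rewrite !subSS !subn0 => dom'.
have /andP [d1 d2] := dom'.
have d3 : (n <= 2 * q * m.+1)%N by apply: leq_trans d1 _; rewrite leq_mul2l leqnSn orbT.
apply: leq_trans (HC n m _ d2 d3) _; first by clear -nN; lia.
apply: leq_trans (leq_mul (leqnn _) (HC' n m _ dom')) _; first lia.
rewrite !mulnA leq_mul2r; apply/orP; right.
rewrite (_ : C * n * C' * n ^ K = C * C' * (n ^ K.+1))%N; last by rewrite expnS; ring.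
by rewrite leq_mul2l leq_exp2r // leqnSn orbT.
Qed.

(** * Components *)

Definition isoc h (H : edge_set h) n (E : edge_set n) : {set {set 'I_n}} :=
  [set C in components E | order_iso H E C]%SET.

Lemma connect_local (V W : finType) (f : V -> W) (e : rel V) (e' : rel W) (C : {set V}) :
  (forall a b, a \in C -> e a b -> b \in C) ->
  (forall a z, a \in C -> e' (f a) z = [exists b, (z == f b) && e a b]) ->
  forall x, x \in C ->
  [set z | connect e' (f x) z]%SET = (f @: [set y | connect e x y])%SET.
Proof.
move=> cl loc x xC; apply/finset.setP => z; rewrite finset.inE; apply/idP/imsetP.
  move=> /connectP [p pth ->]; elim: p x xC pth => [|w p IH] x xC /=.
    by exists x; rewrite ?finset.inE ?connect0.
  rewrite loc // => /andP [/existsP [b /andP [/eqP -> xb]] pth].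
  have [y] := IH b (cl _ _ xC xb) pth; rewrite finset.inE => cy ->; exists y => //.
  by rewrite finset.inE; apply: connect_trans (connect1 xb) cy.
case=> y; rewrite finset.inE => /connectP [p pth ->] ->.
elim: p x xC pth => [|w p IH] x xC /=; first by rewrite connect0.
move=> /andP [xw pth]; apply: connect_trans (connect1 _) (IH w (cl _ _ xC xw) pth).
by rewrite loc //; apply/existsP; exists w; rewrite eqxx.
Qed.

Lemma componentsP n (E : edge_set n) C :
  reflect (exists x, C = [set y | connect (adj E) x y]%SET) (C \in components E).
Proof.
by apply: (iffP imsetP) => [[x _ ->]|[x ->]]; exists x.
Qed.

Lemma mono_inj n N (f : 'I_n -> 'I_N) : (forall i j : 'I_n, (i < j)%N -> (f i < f j)%N) -> injective f.
Proof.
move=> mf i j fij; apply/val_inj; case: (ltngtP i j) => // /mf; by rewrite fij ltnn.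
Qed.

Lemma mono_lt n N (f : 'I_n -> 'I_N) : (forall i j : 'I_n, (i < j)%N -> (f i < f j)%N) ->
  forall i j : 'I_n, (f i < f j)%N = (i < j)%N.
Proof.
move=> mf i j; case: (ltngtP i j) => [/mf //|/mf h|/val_inj ->]; last by rewrite ltnn.
by apply/negbTE; rewrite -leqNgt ltnW.
Qed.

Lemma order_isoP h (H : edge_set h) n (E : edge_set n) C :
  reflect (exists f : 'I_h -> 'I_n, [/\ forall i j : 'I_h, (i < j)%N -> (f i < f j)%N,
     (f @: [set: 'I_h])%SET = C & forall i j, adj E (f i) (f j) = adj H i j]) (order_iso H E C).
Proof.
apply: (iffP existsP) => [[f /and3P [h1 /eqP h2 h3]]|[f [h1 h2 h3]]].
  exists f; split.
  - by move=> i j ij; move/forallP/(_ i)/forallP/(_ j)/implyP: h1; apply.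
  - by rewrite -h2; apply/finset.setP => z; apply/imsetP/imsetP => -[i _ ->]; exists i.
  - by move=> i j; move/forallP/(_ i)/forallP/(_ j)/eqP: h3.
exists (finfun f); apply/and3P; split.
- by apply/forallP => i; apply/forallP => j; apply/implyP => ij; rewrite !ffunE; apply: h1.
- rewrite -h2; apply/eqP/finset.setP => z; apply/imsetP/imsetP => -[i _ ->]; exists i => //; by rewrite ffunE.
- by apply/forallP => i; apply/forallP => j; rewrite !ffunE h3.
Qed.

Section Embedding.

Variables (n N : nat) (f : 'I_n -> 'I_N) (E0 : edge_set n) (E : edge_set N).
Hypothesis mf : forall i j : 'I_n, (i < j)%N -> (f i < f j)%N.

Let locally (C : {set 'I_n}) :=
  forall a z, a \in C -> adj E (f a) z = [exists b, (z == f b) && adj E0 a b].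

Lemma adj_local C a b : locally C -> a \in C -> adj E (f a) (f b) = adj E0 a b.
Proof.
move=> loc aC; rewrite loc //; apply/existsP/idP => [[c /andP [/eqP /(mono_inj mf) -> //]]|ab].
by exists b; rewrite eqxx.
Qed.

Lemma isoc_local h (H : edge_set h) (C : {set 'I_n}) :
  (forall a b, a \in C -> adj E0 a b -> b \in C) -> locally C ->
  ((f @: C)%SET \in isoc H E) = (C \in isoc H E0).
Proof.
move=> cl loc; have fi := mono_inj mf.
rewrite [in LHS]finset.inE [in RHS]finset.inE; congr (_ && _).
  apply/componentsP/componentsP => [[z fCz]|[x Cx]].
    have : z \in [set y | connect (adj E) z y]%SET by rewrite finset.inE connect0.
    rewrite -fCz => /imsetP [x xC zx]; exists x; apply: (imset_inj fi).
    by rewrite fCz zx (connect_local cl loc xC).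
  have xC : x \in C by rewrite Cx finset.inE connect0.
  by exists (f x); rewrite {1}Cx (connect_local cl loc xC).
apply/order_isoP/order_isoP => [[g [mg gC ag]]|[g [mg gC ag]]].
  have ex i : exists a, g i = f a /\ a \in C.
    have : g i \in (f @: C)%SET by rewrite -gC; apply/imsetP; exists i.
    by case/imsetP => a aC ->; exists a.
  have [k Hk] := boolp.choice ex; exists k; split.
  - by move=> i j ij; rewrite -(mono_lt mf) -(Hk i).1 -(Hk j).1; apply: mg.
  - apply: (imset_inj fi); rewrite -gC; apply/finset.setP => z; apply/imsetP/imsetP.
      by case=> a /imsetP [i _ ->] ->; exists i => //; rewrite (Hk i).1.
    by case=> i _ ->; exists (k i); rewrite ?(Hk i).1 //; apply/imsetP; exists i.
  - by move=> i j; rewrite -ag (Hk i).1 (Hk j).1 (adj_local _ loc (Hk i).2).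
have gi i : g i \in C by rewrite -gC; apply/imsetP; exists i.
exists (f \o g); split.
- by move=> i j ij; apply/mf/mg.
- by rewrite -gC imset_comp.
- by move=> i j; rewrite /= (adj_local _ loc (gi i)).
Qed.

Lemma component_closed C : C \in components E0 -> forall a b, a \in C -> adj E0 a b -> b \in C.
Proof.
case/componentsP => x -> a b; rewrite !finset.inE => xa ab.
by apply: connect_trans xa (connect1 ab).
Qed.

Lemma isoc_le h (H : edge_set h) (U : {set 'I_n}) : locally (~: U)%SET ->
  (#|isoc H E0| <= #|isoc H E| + #|U|)%N.
Proof.
move=> loc.
pose A := [set C in isoc H E0 | [disjoint C & U]]%SET.
pose cc x := [set y | connect (adj E0) x y]%SET.
apply: (@leq_trans (#|A| + #|(cc @: U)%SET|)).
  apply: leq_trans (_ : #|A :|: (cc @: U)%SET| <= _)%N; last by rewrite cardsU leq_subr.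
  apply: subset_leq_card; apply/fintype.subsetP => C CE; rewrite finset.in_setU finset.inE CE /=.
  have [//|/pred0Pn [u /= /andP [uC uU]]] := boolP [disjoint C & U]; apply/imsetP; exists u => //.
  move: CE; rewrite finset.inE => /andP [/componentsP [x Cx] _].
  move: uC; rewrite Cx finset.inE => xu; apply/finset.setP => y; rewrite !finset.inE.
  have sym := sym_connect_sym (adj_sym E0).
  by apply/idP/idP => xy; apply: connect_trans xy => //; rewrite sym.
apply: leq_add; last exact: leq_imset_card.
rewrite -(card_imset _ (imset_inj (mono_inj mf))).
apply: subset_leq_card; apply/fintype.subsetP => D /imsetP [C]; rewrite finset.inE => /andP [CE CU] ->.
have CC : C \in components E0 by move: CE; rewrite finset.inE => /andP [].
rewrite isoc_local //; first exact: component_closed.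
move=> a z aC; apply: loc; rewrite finset.inE; apply: contraTN CU => aU.
by apply/pred0Pn; exists a; rewrite /= aC.
Qed.

End Embedding.

Lemma lift_max_mono n (i j : 'I_n) : (i < j)%N -> (lift ord_max i < lift ord_max j)%N.
Proof. by rewrite !lift_max. Qed.

Definition add_pendant n (E : edge_set n) (u : 'I_n) : edge_set n.+1 :=
  edges_of (fun x y => pendant (adj E) u (unlift ord_max x) (unlift ord_max y)).

Section Pendant.

Variables (n : nat) (E : edge_set n) (u : 'I_n).
Hypothesis sE : simple_graph E.

Let r : rel 'I_n.+1 := fun x y => pendant (adj E) u (unlift ord_max x) (unlift ord_max y).

Let r_sym : symmetric r.
Proof.
move=> x y; rewrite /r; case: (unlift _ x) => [a|]; case: (unlift _ y) => [b|] //=.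
exact: adj_sym.
Qed.

Let r_irr : irreflexive r.
Proof. by move=> x; rewrite /r; case: (unlift _ x) => [a|] //=; rewrite adj_irr. Qed.

Lemma adj_pendant x y : adj (add_pendant E u) x y =
  pendant (adj E) u (unlift ord_max x) (unlift ord_max y).
Proof. exact: adj_edges_of. Qed.

Lemma add_pendant_PG m : E \in PG n m -> add_pendant E u \in PG n.+1 m.+1.
Proof.
case/PGP => _ cE plE; apply/PGP; split.
- exact: edges_of_simple.
- apply/eqP; rewrite -(eqn_pmul2l (isT : 0 < 2)%N) -arcs_edges; last exact: edges_of_simple.
  rewrite (_ : arcs (adj _) = arcs r); last by apply: eq_card => d; rewrite !finset.inE adj_pendant.
  rewrite (arcs_lift ord_max r_sym r_irr).
  rewrite (_ : nbr r ord_max = [set lift ord_max u]%SET); last first.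
    apply/finset.setP => x; rewrite !finset.inE /r unlift_none.
    case: unliftP => [a|] ->; first by rewrite /= (inj_eq (@lift_inj _ _)).
    by rewrite (negbTE (neq_lift _ _)).
  rewrite cards1 (_ : arcs (fun a b => r (lift ord_max a) (lift ord_max b)) = arcs (adj E)); last first.
    by apply: eq_card => d; rewrite !finset.inE /r !liftK /=.
  by rewrite arcs_edges // cE -mulnDr addn1.
- apply: (pl_sub (k := unlift ord_max) _ _ (pl_pendant u plE (adj_sym E) (adj_irr sE))).
    move=> x y; case: (unliftP ord_max x) => [a|] ->; case: (unliftP ord_max y) => [b|] -> //.
    by move=> [->].
  by move=> x y; rewrite adj_pendant.
Qed.

Lemma isoc_pendant h (H : edge_set h) : (#|isoc H E| <= #|isoc H (add_pendant E u)| + 1)%N.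
Proof.
rewrite -(cards1 u); apply: (isoc_le (@lift_max_mono n)).
move=> a z; rewrite !finset.inE => au; rewrite adj_pendant liftK.
case: (unliftP ord_max z) => [b|] -> /=.
  apply/idP/existsP => [ab|[c /andP [/eqP /lift_inj ->//]]].
  by exists b; rewrite eqxx.
rewrite (negbTE au); apply/esym/existsP => -[c /andP [h1 _]].
by have := neq_lift (@ord_max n) c; rewrite h1.
Qed.

End Pendant.

Lemma pendant_step n m (X : {set edge_set n}) (Y : {set edge_set n.+1}) :
  X \subset PG n m ->
  (forall E E', E \in X -> E' \in PG n.+1 m.+1 ->
     (forall h (H : edge_set h), (#|isoc H E| <= #|isoc H E'| + 1)%N) -> E' \in Y) ->
  (n * #|X| <= #|Y|)%N.
Proof.
move=> /fintype.subsetP XP XY.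
rewrite mulnC -[X in (_ * X <= _)%N]card_ord -cardsT -cardsX.
pose F (p : edge_set n * 'I_n) := add_pendant p.1 p.2.
rewrite -(card_in_imset (f := F)).
  apply: subset_leq_card; apply/fintype.subsetP => E' /imsetP [[E u] /finset.setXP [EX _] ->].
  have EP := XP _ EX; have /PGP [sE _ _] := EP.
  by apply: (XY E) => //; [exact: add_pendant_PG|move=> h H; exact: isoc_pendant].
move=> [E u] [E' u'] /finset.setXP [/XP /PGP [sE _ _] _] /finset.setXP [/XP /PGP [sE' _ _] _].
rewrite /F /= => ee.
have ea x y : pendant (adj E) u (unlift ord_max x) (unlift ord_max y) =
    pendant (adj E') u' (unlift ord_max x) (unlift ord_max y).
  by rewrite -!adj_pendant ee.
congr (_, _).
  by apply: adj_ext => // a b; have := ea (lift ord_max a) (lift ord_max b); rewrite !liftK.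
have := ea ord_max (lift ord_max u); rewrite unlift_none liftK /= eqxx => /esym/eqP ->//.
Qed.

Lemma isoc_edge n (E : edge_set n) (f : {set 'I_n}) h (H : edge_set h) : #|f| = 2%N ->
  (#|isoc H E| <= #|isoc H (f |: E)| + 2)%N /\ (#|isoc H (f |: E)| <= #|isoc H E| + 2)%N.
Proof.
move=> f2; have ad a z : a \notin f -> adj (f |: E) a z = adj E a z.
  move=> af; rewrite /adj finset.in_setU1; case: eqVneq => //= ef.
  by rewrite -ef !finset.inE eqxx in af.
have ex (E' : edge_set n) a z : adj E' a z = [exists b, (z == b) && adj E' a b].
  apply/idP/existsP => [az|[b /andP [/eqP ->]]//]; by exists z; rewrite eqxx.
by split; rewrite -[X in (_ + X)%N]f2; apply: (isoc_le (f := id)) => // a z;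
  rewrite finset.inE => af; rewrite /= -ex ad.
Qed.

Lemma mono_enum N (S : {set 'I_N}) h : #|S| = h ->
  exists f : 'I_h -> 'I_N, (forall i j : 'I_h, (i < j)%N -> (f i < f j)%N) /\
    (f @: [set: 'I_h])%SET = S.
Proof.
move=> cS; case: N S cS => [|N] S cS.
  have h0 : h = 0%N by rewrite -cS; apply/eqP; rewrite cards_eq0; apply/eqP/finset.setP => -[].
  move: h0 {cS} => ->; exists id; split=> [[]//|]; by apply/finset.setP => -[].
exists (fun i : 'I_h => nth ord0 (enum S) i).
have sz : size (enum S) = h by rewrite -cardE.
have so : sorted ltn (map val (enum S)).
  apply: (subseq_sorted ltn_trans (s2 := map val (enum 'I_N.+1))).
    by apply: map_subseq; rewrite [X in subseq _ X]enumT; exact: filter_subseq.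
  by rewrite val_enum_ord iota_ltn_sorted.
split.
  move=> i j ij; have := sorted_ltn_nth ltn_trans 0%N so.
  move=> /(_ i j); rewrite !inE size_map sz !ltn_ord => /(_ isT isT ij).
  by rewrite !(nth_map ord0) // sz.
apply/finset.setP => x; apply/imsetP/idP => [[i _ ->]|xS].
  by rewrite -mem_enum mem_nth // sz.
have xi : (index x (enum S) < h)%N by rewrite -sz index_mem mem_enum.
exists (Ordinal xi); first by rewrite finset.in_setT.
by rewrite /= nth_index // mem_enum.
Qed.

Definition emap n N (f : 'I_n -> 'I_N) (E : edge_set n) : edge_set N :=
  [set (f @: (e : {set 'I_n}))%SET | e in E]%SET.

Lemma adj_emap n N (f : 'I_n -> 'I_N) (E : edge_set n) a z : injective f -> simple_graph E ->
  adj (emap f E) (f a) z = [exists b, (z == f b) && adj E a b].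
Proof.
move=> fi sE; apply/imsetP/existsP => [[e eE ee]|[b /andP [/eqP -> ab]]]; last first.
  by exists [set a; b]%SET; rewrite // imsetU1 imset_set1.
have /eqP/cards2P [c [d [cd ecd]]] := simple_card sE eE; move: ee.
rewrite ecd imsetU1 imset_set1 => /set2_eq [[/fi -> ->]|[/fi -> ->]].
  by exists d; rewrite eqxx /adj -ecd.
by exists c; rewrite eqxx /adj finset.setUC -ecd.
Qed.

Lemma adj_emap_out n N (f : 'I_n -> 'I_N) (E : edge_set n) x z :
  (forall a, x != f a) -> adj (emap f E) x z = false.
Proof.
move=> xf; apply/negP => /imsetP [e _ ee].
have : x \in [set x; z]%SET by rewrite !finset.inE eqxx.
by rewrite ee => /imsetP [a _ xa]; have := xf a; rewrite xa eqxx.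
Qed.

Section Copy.

Variables (n h N : nat) (f : 'I_n -> 'I_N) (g : 'I_h -> 'I_N).
Variables (E0 : edge_set n) (H : edge_set h).
Hypotheses (mf : forall i j : 'I_n, (i < j)%N -> (f i < f j)%N).
Hypotheses (mg : forall i j : 'I_h, (i < j)%N -> (g i < g j)%N).
Hypotheses (fg : forall a i, f a != g i).
Hypotheses (cov : forall x, (exists a, x = f a) \/ (exists i, x = g i)).
Hypotheses (sE0 : simple_graph E0) (sH : simple_graph H).

Let fi := mono_inj mf.
Let gi := mono_inj mg.

Definition add_copy : edge_set N := (emap f E0 :|: emap g H)%SET.

Lemma adj_copy_l a z : adj add_copy (f a) z = [exists b, (z == f b) && adj E0 a b].
Proof.
rewrite /adj finset.in_setU -!/(adj _ _ _) adj_emap //.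
by rewrite [X in _ || X](adj_emap_out _ _ (fg a)) orbF.
Qed.

Lemma adj_copy_r i z : adj add_copy (g i) z = [exists j, (z == g j) && adj H i j].
Proof.
rewrite /adj finset.in_setU -!/(adj _ _ _) adj_emap //.
by rewrite [X in X || _]adj_emap_out // => a; rewrite eq_sym fg.
Qed.

Lemma adj_copy_ll a b : adj add_copy (f a) (f b) = adj E0 a b.
Proof.
rewrite adj_copy_l; apply/existsP/idP => [[c /andP [/eqP /fi -> //]]|ab].
by exists b; rewrite eqxx.
Qed.

Lemma isoc_copy_le k (K : edge_set k) : (#|isoc K E0| <= #|isoc K add_copy|)%N.
Proof.
rewrite -[X in (_ <= X)%N]addn0 -(cards0 'I_n); apply: (isoc_le mf) => a z _.
exact: adj_copy_l.
Qed.

Lemma copy_component : connected_graph H -> (g @: [set: 'I_h])%SET \in isoc H add_copy.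
Proof.
case/andP => h0 /forallP cH.
have cl (a b : 'I_h) : a \in [set: 'I_h]%SET -> adj H a b -> b \in [set: 'I_h]%SET.
  by rewrite !finset.in_setT.
have loc (a : 'I_h) z : a \in [set: 'I_h]%SET ->
    adj add_copy (g a) z = [exists b, (z == g b) && adj H a b].
  by move=> _; exact: adj_copy_r.
rewrite (isoc_local mg H cl loc) finset.inE; apply/andP; split.
  apply/componentsP; exists (Ordinal h0); apply/finset.setP => y; rewrite !finset.inE.
  by rewrite (forallP (cH _)).
by apply/order_isoP; exists id; split=> //; rewrite imset_id.
Qed.

Lemma isoc_copy : connected_graph H -> #|isoc H add_copy| = (#|isoc H E0|).+1.
Proof.
move=> cH.
have loc (C : {set 'I_n}) a z : a \in C ->
    adj add_copy (f a) z = [exists b, (z == f b) && adj E0 a b].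
  by move=> _; exact: adj_copy_l.
have -> : isoc H add_copy = ((g @: [set: 'I_h])%SET |: [set (f @: (C : {set 'I_n}))%SET | C in isoc H E0])%SET.
  apply/finset.setP => D; rewrite finset.in_setU1; apply/idP/orP; last first.
    case=> [/eqP ->|/imsetP [C CE ->]]; first exact: copy_component.
    have CC : C \in components E0 by move: CE; rewrite finset.inE => /andP [].
    by rewrite (isoc_local mf H (component_closed CC) (@loc C)).
  move=> DE; have : D \in components add_copy by move: DE; rewrite finset.inE => /andP [].
  case/componentsP => x; case: (cov x) => [[a ->]|[i ->]] Dx.
    right; have cc : [set y | connect (adj E0) a y]%SET \in components E0 by apply/componentsP; exists a.
    have ca : a \in [set y | connect (adj E0) a y]%SET by rewrite finset.inE connect0.
    have Df := connect_local (component_closed cc) (@loc _) ca.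
    apply/imsetP; exists [set y | connect (adj E0) a y]%SET; last by rewrite Dx Df.
    by rewrite -(isoc_local mf H (component_closed cc) (@loc _)) -Df -Dx.
  left; rewrite Dx (@connect_local _ _ g (adj H) _ [set: 'I_h]%SET); first last.
  - by rewrite finset.in_setT.
  - by move=> a z _; exact: adj_copy_r.
  - by move=> a b _ _; rewrite finset.in_setT.
  rewrite (_ : [set y | connect (adj H) i y]%SET = [set: 'I_h]%SET) //.
  apply/finset.setP => y; rewrite !finset.inE.
  by case/andP: cH => _ /forallP /(_ i)/forallP /(_ y).
rewrite cardsU1 card_imset; last exact: (imset_inj fi).
rewrite [X in (nat_of_bool X + _)%N](_ : _ = true) //; apply/negP => /imsetP [C _ gC].
case/andP: cH => h0 _.
have : g (Ordinal h0) \in (g @: [set: 'I_h])%SET by apply/imsetP; exists (Ordinal h0).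
by rewrite gC => /imsetP [a _ ga]; have := fg a (Ordinal h0); rewrite ga eqxx.
Qed.

Lemma add_copy_PG m (a0 : 'I_n) (i0 : 'I_h) : E0 \in PG n m -> pl (adj H) ->
  add_copy \in PG N (m + #|H|).
Proof.
move=> /PGP [_ cE plE] plH; apply/PGP; split.
- apply/forall_inP => e; rewrite finset.in_setU => /orP [] /imsetP [e' /simple_card h2 ->].
    by rewrite card_imset ?h2.
  by rewrite card_imset ?h2.
- rewrite cardsU !card_imset ?cE; [|exact: imset_inj|exact: imset_inj].
  rewrite (_ : emap f E0 :&: emap g H = finset.set0) ?cards0 ?subn0 //.
  apply/finset.setP => e; rewrite !finset.inE; apply/negP => /andP [/imsetP [e1 E1 ee1] /imsetP [e2 E2 ee2]].
  have /card_gt0P [a ae1] : (0 < #|e1|)%N by rewrite (simple_card sE0 E1).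
  have : f a \in e by rewrite ee1; apply/imsetP; exists a.
  by rewrite ee2 => /imsetP [i _ fai]; have := fg a i; rewrite fai eqxx.
have ex x : exists s : ('I_n + 'I_h)%type, x = match s with inl a => f a | inr i => g i end.
  by case: (cov x) => [[a ->]|[i ->]]; [exists (inl a)|exists (inr i)].
have [k Hk] := boolp.choice ex.
have ki x y : k x = k y -> x = y by move=> kxy; rewrite (Hk x) (Hk y) kxy.
have kf a : k (f a) = inl a.
  have := Hk (f a); case: (k _) => [b /fi ->//|i fai].
  by have := fg a i; rewrite fai eqxx.
have kg i : k (g i) = inr i.
  have := Hk (g i); case: (k _) => [a gia|j /gi -> //].
  by have := fg a i; rewrite gia eqxx.
apply: (pl_sub ki _ (pl_union a0 i0 plE plH)) => x y.
case: (cov x) => [[a ->]|[i ->]].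
  by rewrite adj_copy_l => /existsP [b /andP [/eqP ->]]; rewrite !kf.
by rewrite adj_copy_r => /existsP [b /andP [/eqP ->]]; rewrite !kg.
Qed.

End Copy.

Lemma copy_step n m h (H : edge_set h) (X : {set edge_set n}) (Y : {set edge_set (n + h)}) b :
  (0 < n)%N -> connected_graph H -> simple_graph H -> pl (adj H) -> X \subset PG n m ->
  (forall E E', E \in X -> E' \in PG (n + h) (m + #|H|) ->
     (forall k (K : edge_set k), (#|isoc K E| <= #|isoc K E'|)%N) ->
     #|isoc H E'| = (#|isoc H E|).+1 -> E' \in Y) ->
  (forall E, E \in X -> (#|isoc H E| < b)%N) ->
  ('C(n + h, h) * #|X| <= b * #|Y|)%N.
Proof.
move=> n0 cH sH plH /fintype.subsetP XP XY Xb.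
have ex (S : {set 'I_(n + h)}) : exists k : ('I_n -> 'I_(n + h)) * ('I_h -> 'I_(n + h)), #|S| = h ->
    [/\ forall i j : 'I_n, (i < j)%N -> (k.1 i < k.1 j)%N,
        forall i j : 'I_h, (i < j)%N -> (k.2 i < k.2 j)%N,
        forall a i, k.1 a != k.2 i,
        forall x, (exists a, x = k.1 a) \/ (exists i, x = k.2 i) &
        (k.2 @: [set: 'I_h])%SET = S].
  have [cS|nS] := eqVneq #|S| h; last first.
    by exists (@lshift n h, @rshift n h) => cS; rewrite cS eqxx in nS.
  have [g [mg gS]] := mono_enum cS.
  have cS' : #|(~: S)%SET| = n by rewrite cardsCs finset.setCK cS card_ord addnK.
  have [f [mf fS]] := mono_enum cS'.
  exists (f, g) => _; split=> //=.
    move=> a i; apply/negP => /eqP fg.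
    have : f a \in (~: S)%SET by rewrite -fS; apply/imsetP; exists a.
    have : g i \in S by rewrite -gS; apply/imsetP; exists i.
    by rewrite finset.inE fg => ->.
  move=> x; case xS : (x \in S).
    by right; move: xS; rewrite -gS => /imsetP [i _ ->]; exists i.
  left; have : x \in (~: S)%SET by rewrite finset.inE xS.
  by rewrite -fS => /imsetP [a _ ->]; exists a.
have [k Hk] := boolp.choice ex.
pose D := [set S : {set 'I_(n + h)} | #|S| == h]%SET.
have cD : #|D| = 'C(n + h, h) by rewrite card_draws card_ord.
pose F (p : edge_set n * {set 'I_(n + h)}) := add_copy (k p.2).1 (k p.2).2 p.1 H.
rewrite -cD mulnC -cardsX.
have h0 : (0 < h)%N by case/andP: cH.
have FP E S : E \in X -> S \in D -> [/\ F (E, S) \in PG (n + h) (m + #|H|),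
    forall j (K : edge_set j), (#|isoc K E| <= #|isoc K (F (E, S))|)%N,
    #|isoc H (F (E, S))| = (#|isoc H E|).+1 & S \in isoc H (F (E, S))].
  move=> EX; rewrite finset.inE => /eqP cS; have [mf mg fg cov gS] := Hk S cS.
  have EP := XP _ EX; have /PGP [sE _ _] := EP; rewrite /F /=; split.
  - exact: (add_copy_PG mf mg fg cov sE sH (Ordinal n0) (Ordinal h0) EP plH).
  - by move=> j K; exact: isoc_copy_le.
  - exact: isoc_copy.
  - by rewrite -[X in X \in _]gS; exact: copy_component.
apply: (card_fibers (f := F)).
  by move=> [E S] /finset.setXP [EX SD]; have [h1 h2 h3 _] := FP E S EX SD; apply: (XY E).
move=> E'; set Z := [set _ in _ | _]%SET.
have [->|/set0Pn [[E S]]] := eqVneq Z finset.set0; first by rewrite cards0.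
rewrite finset.inE => /andP [/finset.setXP [EX SD] /eqP FE].
have [_ _ cE _] := FP E S EX SD; rewrite FE in cE.
apply: (@leq_trans #|isoc H E'|); last by rewrite cE; apply: Xb.
rewrite -(card_in_imset (f := fun p : edge_set n * {set 'I_(n + h)} => p.2)).
  apply: subset_leq_card; apply/fintype.subsetP => S' /imsetP [[E1 S1]].
  rewrite finset.inE => /andP [/finset.setXP [E1X S1D] /eqP FE1] -> /=.
  by have [_ _ _] := FP E1 S1 E1X S1D; rewrite FE1.
move=> [E1 S1] [E2 S2]; rewrite finset.inE => /andP [/finset.setXP [E1X S1D] /eqP FE1].
rewrite finset.inE => /andP [/finset.setXP [E2X S2D] /eqP FE2] /= eS; subst S2; congr (_, _).
have /eqP cS : #|S1| == h by move: S1D; rewrite finset.inE.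
have [mf mg fg cov gS] := Hk S1 cS.
have /PGP [s1 _ _] := XP _ E1X; have /PGP [s2 _ _] := XP _ E2X.
apply: adj_ext => // a c; rewrite /= in FE1 FE2.
rewrite -(adj_copy_ll H mf fg s1 a c) -(adj_copy_ll H mf fg s2 a c).
by move: FE1 FE2; rewrite /F /= => -> ->.
Qed.

(** * Graphs with at most one cycle *)

Definition has_cycle (V : finType) (e : rel V) := exists s : seq V, (2 < size s)%N && ucycleb e s.

Lemma close_cycle (V : finType) (e : rel V) x y p : symmetric e -> path e x p -> uniq (x :: p) ->
  e x y -> y \in p -> y != head x p -> has_cycle e.
Proof.
move=> se pth un xy yp; move: pth un; case/path.splitP: yp => p1 p2 pth un yh.
exists (x :: rcons p1 y); apply/andP; split.
  by case: p1 yh {pth un} => [|z p1]; rewrite /= ?eqxx // size_rcons.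
apply/andP; split.
  rewrite /= rcons_path last_rcons (se y) xy andbT.
  by move: pth; rewrite cat_path => /andP [].
by move: un; rewrite -cat_cons cat_uniq => /andP [].
Qed.

Lemma min_degree_cycle (V : finType) (e : rel V) (A : {set V}) a : symmetric e -> irreflexive e ->
  a \in A -> (forall v, v \in A -> (1 < #|nbr e v :&: A|)%N) -> has_cycle e.
Proof.
move=> se ie aA dA.
have H k : has_cycle e \/ exists x p, [/\ size p = k, path e x p, uniq (x :: p) & x \in A].
  elim: k => [|k [|[x [p [sp pth un xA]]]]]; first by right; exists a, [::].
    by left.
  have [y /finset.setIP [xy yA] yh] : exists2 y, y \in nbr e x :&: A & y != head x p.
    have := dA x xA; rewrite (cardsD1 (head x p)).
    case: (_ \in _) => /= h; have /card_gt0P [y] : (0 < #|(nbr e x :&: A) :\ head x p|)%N by lia.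
      by rewrite finset.in_setD1 => /andP [h1 h2]; exists y.
    by rewrite finset.in_setD1 => /andP [h1 h2]; exists y.
  rewrite finset.inE in xy.
  have [yp|yp] := boolP (y \in p); first by left; exact: close_cycle xy yp yh.
  right; exists y, (x :: p); split=> //=; rewrite ?sp //.
    by rewrite se xy.
  rewrite inE negb_or yp andbT -/(uniq (x :: p)) un andbT.
  by apply: contraTneq xy => ->; rewrite ie.
have [//|[x [p [sp _ un _]]]] := H #|V|.
by have := max_card (mem (x :: p)); rewrite (card_uniqP un) /= sp ltnn.
Qed.

Lemma sum_setD1 (V : finType) (e : rel V) (A : {set V}) v : symmetric e -> irreflexive e ->
  v \in A -> (\sum_(u in A) \sum_(w in A) e u w =
    \sum_(u in A :\ v) \sum_(w in A :\ v) e u w + 2 * \sum_(w in A :\ v) e v w)%N.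
Proof.
move=> se ie vA.
have row u : (\sum_(w in A) e u w = e u v + \sum_(w in A :\ v) e u w)%N by rewrite (big_setD1 v vA).
rewrite (big_setD1 v vA). rewrite row ie add0n /=.
rewrite [X in (_ + X)%N = _](eq_bigr (fun u => e v u + \sum_(w in A :\ v) e u w)%N); last first.
  by move=> u _; rewrite row se.
by rewrite big_split /= mul2n -addnn addnA addnC.
Qed.

Lemma many_edges_cycle (V : finType) (e : rel V) : symmetric e -> irreflexive e ->
  (0 < #|V|)%N -> (2 * #|V| <= arcs e)%N -> has_cycle e.
Proof.
move=> se ie V0 eV.
pose S (A : {set V}) := (\sum_(v in A) \sum_(w in A) e v w)%N.
pose P (A : {set V}) := (A != finset.set0) && (2 * #|A| <= S A)%N.
have PT : P [set: V]%SET.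
  apply/andP; split; first by rewrite -card_gt0 cardsT.
  rewrite cardsT; apply: leq_trans eV _; rewrite arcsE /S.
  rewrite [X in (_ <= X)%N]big_mkcond /=; apply: leq_sum => v _; rewrite finset.in_setT.
  rewrite -sum1_card big_mkcond [X in (_ <= X)%N]big_mkcond /=.
  by apply: leq_sum => w _; rewrite !finset.inE; case: (e v w).
case: (arg_minnP (fun A : {set V} => #|A|) PT) => A /andP [A0 SA] minA.
have /set0Pn [a aA] := A0.
apply: (min_degree_cycle se ie aA) => v vA; rewrite ltnNge; apply/negP => dv.
have cA := cardsD1 v A; rewrite vA add1n in cA.
pose dg := (\sum_(w in A :\ v) e v w)%N.
have dgE : (dg <= 1)%N.
  apply: leq_trans dv; rewrite /dg -sum1_card big_mkcond [X in (_ <= X)%N]big_mkcond /=.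
  apply: leq_sum => w _; rewrite !finset.inE; case: (w == v) => //=.
  by case: (w \in A); case: (e v w).
have SE : (S A = S (A :\ v) + 2 * dg)%N by exact: sum_setD1.
have [Av0|Av0] := eqVneq (A :\ v) finset.set0.
  by move: SA dgE; rewrite SE cA Av0 cards0 /dg /S Av0 !big_set0.
have := minA (A :\ v); rewrite /P Av0 cA ltnn /= => H.
have: (2 * #|A :\ v| <= S (A :\ v))%N by rewrite SE cA in SA; lia.
by move/H.
Qed.

Lemma one_cycle_edges n (E : edge_set n) : simple_graph E -> at_most_one_cycle E ->
  (#|E| <= n)%N.
Proof.
move=> sE c1; rewrite leqNgt; apply/negP => nE.
have n0 : (0 < n)%N.
  have /card_gt0P [e eE] : (0 < #|E|)%N by exact: leq_ltn_trans nE.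
  have := simple_card sE eE; case: n E e {sE c1 nE eE} => // E e.
  have -> : e = finset.set0 by apply/finset.setP => -[].
  by rewrite cards0.
have cyc (E' : edge_set n) : simple_graph E' -> (n <= #|E'|)%N -> has_cycle (adj E').
  move=> sE' nE'; apply: many_edges_cycle; rewrite ?card_ord //.
  - exact: adj_sym.
  - exact: adj_irr.
  - by rewrite arcs_edges // leq_mul2l.
have [s1 hs1] := cyc E sE (ltnW nE); have /and3P [sz1 cs1 us1] := hs1.
have [x xs1] : exists x, x \in s1 by case: s1 sz1 {hs1 cs1 us1} => // x s _; exists x; rewrite mem_head.
pose f := [set x; next s1 x]%SET.
have fE : f \in E by exact: next_cycle cs1 xs1.
have sE' : simple_graph (E :\ f).
  by apply/forall_inP => e; rewrite finset.in_setD1 => /andP [_ /(simple_card sE) ->].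
have cE' : (n <= #|E :\ f|)%N by move: nE; rewrite (cardsD1 f E) fE add1n ltnS.
have [s2 /and3P [sz2 cs2 us2]] := cyc _ sE' cE'.
have hs2 : is_cycle E s2.
  apply/and3P; split=> //; apply: sub_cycle cs2 => a b.
  by rewrite /adj finset.in_setD1 => /andP [].
have : f \in cycle_edges s1 by apply/imsetP; exists x.
rewrite (c1 s1 s2 hs1 hs2) => /imsetP [z zs2 fz].
have : adj (E :\ f) z (next s2 z) by exact: next_cycle cs2 zs2.
by rewrite /adj -fz finset.in_setD1 eqxx.
Qed.

(** * The number of graphs with many given components *)

Lemma exp_le_bin n h : (n ^ h <= h`! * 'C(n + h, h))%N.
Proof.
rewrite mulnC bin_ffact.
have H k : (k <= h -> n ^ k <= (n + h) ^_ k)%N.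
  elim: k => [|k IH] kh; first by rewrite ffactn0.
  rewrite expnSr ffactnSr; apply: leq_mul; first by apply: IH; exact: ltnW.
  by rewrite -addnBA ?leq_addr // ltnW.
exact: H.
Qed.

Lemma PG0 n m q : (0 < q)%N -> (12 * q < n)%N -> (q * m + n <= 3 * q * n)%N -> (0 < NP n m)%N.
Proof.
move=> q0 nq dom; have := push_le_iter q0 nq dom (leqnn m); rewrite subnn => H.
have : (0 < NP n 0)%N.
  apply/card_gt0P; exists finset.set0; apply/PGP; split; rewrite ?cards0 //.
    by apply/forall_inP => e; rewrite finset.inE.
  exists (fun i : 'I_n => [:: ((i : nat)%:Z, 0 : int)] : seq pt); split=> // [i j x _ _|i j _ _].
    by rewrite !mem_seq1 => /eqP -> /eqP [] /val_inj.
  by rewrite /adj finset.inE.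
by move=> h; have := leq_trans h H; case: (NP n m) => //; rewrite muln0.
Qed.

Section Components.

Variables (l : nat) (h : 'I_l -> nat) (H : forall i, edge_set (h i)).
Hypotheses (sH : forall i, simple_graph (H i)) (cH : forall i, connected_graph (H i)).
Hypotheses (plH : forall i, pl (adj (H i))) (eH : forall i, (#|H i| <= h i)%N).

Definition many (k a n m : nat) : {set edge_set n} :=
  [set E in PG n m | [forall i : 'I_l, (i < k)%N ==> (a <= #|isoc (H i) E|)%N]]%SET.

Definition window (i0 : 'I_l) (a lo c n m : nat) : {set edge_set n} :=
  [set E in many i0 a n m | (lo <= #|isoc (H i0) E| <= c)%N]%SET.

Definition large (i0 : 'I_l) (a lo n m : nat) : {set edge_set n} :=
  [set E in many i0 a n m | (lo <= #|isoc (H i0) E|)%N]%SET.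

Lemma manyP k a n m E :
  reflect (E \in PG n m /\ forall i : 'I_l, (i < k)%N -> (a <= #|isoc (H i) E|)%N) (E \in many k a n m).
Proof.
rewrite [E \in many _ _ _ _]finset.inE; apply: (iffP andP) => -[h1 h2]; split=> //.
  by move=> i ik; move/forallP/(_ i)/implyP: h2; apply.
by apply/forallP => i; apply/implyP; exact: h2.
Qed.

Lemma largeP (i0 : 'I_l) a lo n m E :
  reflect (E \in many i0 a n m /\ (lo <= #|isoc (H i0) E|)%N) (E \in large i0 a lo n m).
Proof. by rewrite [E \in large _ _ _ _ _]finset.inE; exact: andP. Qed.

Lemma windowP (i0 : 'I_l) a lo c n m E :
  reflect [/\ E \in many i0 a n m, (lo <= #|isoc (H i0) E|)%N & (#|isoc (H i0) E| <= c)%N]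
    (E \in window i0 a lo c n m).
Proof. by rewrite [E \in window _ _ _ _ _ _]finset.inE; exact: and3P. Qed.

Lemma large_pendant i0 a lo n m : (n * #|large i0 a.+1 lo.+1 n m| <= #|large i0 a lo n.+1 m.+1|)%N.
Proof.
apply: (@pendant_step n m).
  by apply/fintype.subsetP => E /largeP [/manyP [EP _] _].
move=> E E' /largeP [/manyP [_ Ek] lE] E'P le; apply/largeP; split.
  by apply/manyP; split=> // i ik; have := leq_trans (Ek i ik) (le _ (H i)); rewrite addn1 ltnS.
by have := leq_trans lE (le _ (H i0)); rewrite addn1 ltnS.
Qed.

Lemma large_pendants i0 a lo j n m :
  (n ^ j * #|large i0 (a + j) (lo + j) n m| <= #|large i0 a lo (n + j) (m + j)|)%N.
Proof.
elim: j n m => [|j IH] n m; first by rewrite !addn0 mul1n.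
rewrite -!addSnnS; apply: leq_trans (IH n.+1 m.+1).
rewrite expnSr -mulnA; apply: leq_mul; first by case: j {IH} => // j; rewrite leq_exp2r.
by rewrite !addSn; exact: large_pendant.
Qed.

Lemma window_push i0 a c q n m : (0 < q)%N -> (12 * q < n)%N -> (q * m + n <= 3 * q * n)%N ->
  (#|window i0 (a + 2) 0 c n m| <= 8 * q * #|window i0 a 0 (c + 2) n m.+1|)%N.
Proof.
move=> q0 nq dom; apply: (push_edges q0 nq dom).
  by apply/fintype.subsetP => E /windowP [/manyP [EP _] _ _].
move=> E f /windowP [/manyP [EP Ek] _ cE] nf fP.
have f2 : #|f| = 2%N.
  by have /PGP [sf _ _] := fP; apply: (simple_card sf); rewrite finset.setU11.
apply/windowP; split=> //.
  apply/manyP; split=> // i ik; have [h1 _] := isoc_edge E (H i) f2.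
  by have := leq_trans (Ek i ik) h1; rewrite leq_add2r.
have [_ h1] := isoc_edge E (H i0) f2.
by apply: leq_trans h1 _; rewrite leq_add2r.
Qed.

Lemma window_pushes i0 a c q j n m : (0 < q)%N -> (12 * q < n)%N ->
  (q * (m + j) + n <= 3 * q * n)%N ->
  (#|window i0 (a + 2 * j) 0 c n m| <= (8 * q) ^ j * #|window i0 a 0 (c + 2 * j) n (m + j)|)%N.
Proof.
move=> q0 nq; elim: j c m => [|j IH] c m dom; first by rewrite !addn0 mul1n.
have dom' : (q * m + n <= 3 * q * n)%N.
  by apply: leq_trans dom; rewrite leq_add2r leq_mul2l leq_addr orbT.
rewrite (_ : a + 2 * j.+1 = a + 2 * j + 2)%N; last by ring.
apply: leq_trans (window_push i0 _ c q0 nq dom') _.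
rewrite expnS -[X in (_ <= X)%N]mulnA leq_mul2l; apply/orP; right.
rewrite (_ : c + 2 * j.+1 = c + 2 + 2 * j)%N; last by ring.
by rewrite -(addSnnS m j); apply: (IH (c + 2)%N m.+1); rewrite addSnnS.
Qed.

Lemma window_copy i0 a lo c n m : (0 < n)%N ->
  (n ^ h i0 * #|window i0 a lo c n m| <=
   (h i0)`! * c.+1 * #|window i0 a lo.+1 c.+1 (n + h i0) (m + #|H i0|)|)%N.
Proof.
move=> n0; apply: leq_trans (leq_mul (exp_le_bin n (h i0)) (leqnn _)) _.
rewrite -!mulnA leq_mul2l; apply/orP; right.
apply: (copy_step (m := m) n0 (cH i0) (sH i0) (plH i0)).
- by apply/fintype.subsetP => E /windowP [/manyP [EP _] _ _].
- move=> E E' /windowP [/manyP [EP Ek] loE cE] E'P le eq.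
  apply/windowP; rewrite eq !ltnS; split=> //; apply/manyP; split=> // i ik.
  exact: leq_trans (Ek i ik) (le _ _).
- by move=> E /windowP [_ _ cE]; rewrite ltnS.
Qed.

Lemma window_copies i0 a lo c j n m : (0 < n)%N ->
  (n ^ (h i0 * j) * #|window i0 a lo c n m| <=
   ((h i0)`! * (c + j)) ^ j * #|window i0 a (lo + j) (c + j) (n + h i0 * j) (m + #|H i0| * j)|)%N.
Proof.
elim: j lo c n m => [|j IH] lo c n m n0; first by rewrite !muln0 !addn0 !mul1n.
have -> : #|window i0 a (lo + j.+1) (c + j.+1) (n + h i0 * j.+1) (m + #|H i0| * j.+1)| =
    #|window i0 a (lo.+1 + j) (c.+1 + j) (n + h i0 + h i0 * j) (m + #|H i0| + #|H i0| * j)|.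
  by rewrite -!addSnnS !mulnS !addnA.
have h1 := window_copy i0 a lo c m n0.
have h2 := IH lo.+1 c.+1 (n + h i0)%N (m + #|H i0|)%N (ltn_addr _ n0).
have h3 : (n ^ (h i0 * j) <= (n + h i0) ^ (h i0 * j))%N.
  by case: (h i0 * j)%N => // e; rewrite leq_exp2r // leq_addr.
move: h1 h2; move: #|window _ _ _ _ _ _| #|window _ _ _ _ _ _| #|window _ _ _ _ _ _| => w2 w1 w0.
move=> h1 h2; rewrite [(h i0 * j.+1)%N]mulnS expnD.
have cj : (c.+1 <= c + j.+1)%N by rewrite addnS ltnS leq_addr.
have h4 : (n ^ (h i0 * j) * w1 <= ((h i0)`! * (c + j.+1)) ^ j * w2)%N.
  by rewrite -(addSnnS c j); apply: leq_trans h2; rewrite leq_mul2r h3 orbT.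
apply: (@leq_trans (n ^ (h i0 * j) * ((h i0)`! * (c + j.+1) * w1))%N).
  rewrite mulnAC mulnC leq_mul2l; apply/orP; right; apply: leq_trans h1 _.
  by rewrite leq_mul2r leq_mul2l cj !orbT.
by rewrite mulnCA expnS -[X in (_ <= X)%N]mulnA leq_mul2l h4 orbT.
Qed.

Lemma many_mono k a b n m : (a <= b)%N -> many k b n m \subset many k a n m.
Proof.
move=> ab; apply/fintype.subsetP => E /manyP [EP Eb]; apply/manyP; split=> // i ik.
exact: leq_trans ab (Eb i ik).
Qed.

Lemma large_many (i0 : 'I_l) a n m : large i0 a a n m \subset many i0.+1 a n m.
Proof.
apply/fintype.subsetP => E /largeP [/manyP [EP Ek] aE]; apply/manyP; split=> // i.
by rewrite ltnS leq_eqVlt => /orP [/eqP /val_inj -> //|]; apply: Ek.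
Qed.

(* Among the graphs obtained from the previous step on a few vertices less,
   those with many components [H i0] absorb the missing vertices as leaves,
   the others as new components [H i0]; in the second case the number of
   components [H i0], hence of preimages, is bounded. *)
Lemma many_step (i0 : 'I_l) t : (forall a q, (0 < q)%N -> exists C N, forall n m, (N <= n)%N ->
    Dom q n m -> (NP n m <= C * #|many i0 a n m|)%N) ->
  forall q, (0 < q)%N -> exists C N, forall n m, (N <= n)%N ->
    Dom q n m -> (NP n m <= C * #|many i0.+1 t n m|)%N.
Proof.
move=> IH q q0; have q20 : (0 < 2 * q)%N by lia.
pose K := (h i0 * t)%N; pose J := ((h i0 - #|H i0|) * t)%N.
have JK : (J + #|H i0| * t = K)%N by rewrite /J -mulnDl subnK.
have [C1 [N1 H1]] := vertex_le_iter K q0.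
have [C2 [N2 H2]] := IH (t + 2 * K)%N _ q20.
pose b := ((8 * (2 * q)) ^ J * ((h i0)`! * (t + K + 2 * J + t)) ^ t)%N.
exists (C1 * C2 * 2 ^ K * (1 + b))%N, (N1 + N2 + 2 * q * K + 6 * q * K + 3 * K + 24 * q + 10)%N.
move=> n m nN dom.
have [|dom' Kn Km] := @Dom_shift q K K n m q0 _ dom; first by clear -nN; move: (q * K)%N nN => x; lia.
have [|/andP [_ dom0] _ _] := @Dom_shift q K 0 n m q0 _ dom; first by clear -nN; lia.
rewrite subn0 in dom0.
apply: leq_trans (H1 n m _ dom) _; first by clear -nN; lia.
have := H2 (n - K)%N (m - K)%N; move=> /(_ _ dom') H2'.
apply: leq_trans (leq_mul (leqnn _) (H2' _)) _; first by clear -nN; lia.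
set n' := (n - K)%N; set m' := (m - K)%N; set Z := many _ _ n m.
have n'0 : (0 < n')%N by rewrite /n'; clear -nN; lia.
have nE : (n' + K = n)%N by rewrite subnK.
have mE : (m' + K = m)%N by rewrite subnK.
have hL : (n' ^ K * #|large i0 (t + K) (t + K) n' m'| <= #|Z|)%N.
  apply: leq_trans (large_pendants i0 t t K n' m') _; rewrite nE mE.
  exact/subset_leq_card/large_many.
have hS : (n' ^ K * #|window i0 (t + 2 * J) 0 (t + K) n' m'| <= b * #|Z|)%N.
  have JmK : (m' + J <= m)%N by rewrite -mE leq_add2l -JK leq_addr.
  have h1 : (2 * q * (m' + J) + n' <= 3 * (2 * q) * n')%N.
    by apply: leq_trans dom0; rewrite leq_add2r leq_mul2l JmK orbT.
  have nq : (12 * (2 * q) < n')%N by rewrite /n'; clear -nN; lia.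
  have h2 := window_pushes i0 t (t + K) q20 nq h1.
  have h3 := window_copies i0 t 0 (t + K + 2 * J) t (m' + J) n'0.
  apply: leq_trans (leq_mul (leqnn _) h2) _.
  rewrite mulnCA /b -mulnA leq_mul2l; apply/orP; right.
  apply: leq_trans h3 _; rewrite leq_mul2l; apply/orP; right.
  rewrite add0n -/K -(addnA m' J) JK nE mE.
  apply: subset_leq_card; apply/fintype.subsetP => E /windowP [h4 h5 _].
  by apply: (fintype.subsetP (large_many i0 t n m)); apply/largeP.
have JK' : (J <= K)%N by rewrite -JK leq_addr.
have hG : (#|many i0 (t + 2 * K) n' m'| <= #|large i0 (t + K) (t + K) n' m'| +
    #|window i0 (t + 2 * J) 0 (t + K) n' m'|)%N.
  apply: leq_trans (_ : #|large i0 (t + K) (t + K) n' m' :|: window i0 (t + 2 * J) 0 (t + K) n' m'| <= _)%N;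
    last by rewrite cardsU leq_subr.
  apply: subset_leq_card; apply/fintype.subsetP => E hE; rewrite finset.in_setU.
  have aK : (t + K <= t + 2 * K)%N by rewrite leq_add2l leq_pmull.
  have aJ : (t + 2 * J <= t + 2 * K)%N by rewrite leq_add2l leq_mul2l JK' orbT.
  have [cE|cE] := leqP (t + K) #|isoc (H i0) E|; apply/orP; [left|right].
    by apply/largeP; split=> //; exact: (fintype.subsetP (many_mono _ _ _ aK) _ hE).
  by apply/windowP; split; [exact: (fintype.subsetP (many_mono _ _ _ aJ) _ hE)|by []|exact: ltnW].
have n2 : (n <= 2 * n')%N by rewrite /n'; clear -nN Kn; lia.
have hn : (n ^ K <= 2 ^ K * n' ^ K)%N.
  by rewrite -expnMn; case: (K) => // k; rewrite leq_exp2r.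
move: hL hS hG hn; move: #|large _ _ _ _ _| #|window _ _ _ _ _ _| #|Z| #|many _ _ _ _| => x1 x2 x3 x4.
move: (n' ^ K)%N (n ^ K)%N (2 ^ K)%N => y1 y2 y3 hL hS hG hn.
have h4 : (y1 * x4 <= (1 + b) * x3)%N.
  apply: leq_trans (leq_mul (leqnn _) hG) _.
  by rewrite mulnDr mulnDl mul1n leq_add.
apply: (@leq_trans (C1 * C2 * (y3 * y1 * x4))%N).
  rewrite (_ : C1 * y2 * (C2 * x4) = C1 * C2 * (y2 * x4))%N; last by ring.
  by rewrite leq_mul2l leq_mul2r hn !orbT.
rewrite -!mulnA !leq_mul2l; do 3 (apply/orP; right).
by [].
Qed.

End Components.

Lemma many_all l (h : 'I_l -> nat) (H : forall i, edge_set (h i)) :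
  (forall i, simple_graph (H i)) -> (forall i, connected_graph (H i)) ->
  (forall i, pl (adj (H i))) -> (forall i, (#|H i| <= h i)%N) ->
  forall k a q, (k <= l)%N -> (0 < q)%N -> exists C N, forall n m, (N <= n)%N ->
    Dom q n m -> (NP n m <= C * #|many H k a n m|)%N.
Proof.
move=> sH cH plH eH; elim=> [|k IH] a q kl q0.
  exists 1%N, 0%N => n m _ _; rewrite mul1n; apply: subset_leq_card.
  by apply/fintype.subsetP => E EP; apply/manyP.
apply: (many_step sH cH plH eH (i0 := Ordinal kl)) => //.
by move=> b p; apply: IH; exact: ltnW.
Qed.

Theorem theorem6p3 (R : realType) (c B : R) (m : nat -> nat)
    (l : nat) (h : 'I_l -> nat) (H : forall i : 'I_l, edge_set (h i)) (t : nat)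
    (c_gt0 : 0 < c) (B_lt3 : B < 3)
    (m_bounds : exists N0 : nat, forall n : nat, (N0 <= n)%N ->
      c * n%:R <= (m n)%:R <= B * n%:R)
    (H_simple : forall i, simple_graph (H i))
    (H_connected : forall i, connected_graph (H i))
    (H_planar : forall i, planar R (H i))
    (H_cycle : forall i, at_most_one_cycle (H i)) :
  exists (eps : R) (N : nat), 0 < eps /\
    forall n : nat, (N <= n)%N ->
      eps <= @Pr_planar R n (m n)
        (fun E => [forall i : 'I_l, (t <= num_order_iso_components (H i) E)%N]).
Proof.
have [N0 mB] := m_bounds.
have B3 : 0 < 3 - B by rewrite subr_gt0.
have [q q1 q2] : exists2 q, 1 <= q%:R * c & 1 <= q%:R * (3 - B).
  exists (Num.bound c^-1 + Num.bound (3 - B)^-1)%N;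
    rewrite -ler_pdivrMr // mul1r natrD ltW //; [apply: ltr_wpDr|apply: ltr_wpDl] => //;
    by apply: archi_boundP; rewrite invr_ge0 ltW.
have q0 : (0 < q)%N by case: q q1 {q2} => // ; rewrite mul0r ler10.
have dom n : (N0 <= n)%N -> Dom q n (m n).
  move=> /mB /andP [h1 h2]; apply/andP; split; rewrite -(ler_nat R) ?natrD !natrM.
    apply: le_trans (_ : q%:R * (c * n%:R) <= _); last by apply: ler_wpM2l.
    by rewrite mulrA ler_peMl.
  apply: le_trans (_ : q%:R * (B * n%:R) + n%:R <= _).
    by rewrite lerD2r; apply: ler_wpM2l.
  have : 1 * n%:R <= q%:R * (3 - B) * n%:R by apply: ler_wpM2r.
  by rewrite mul1r; move: (q%:R : R) (n%:R : R) => x y; clear; lra.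
have [C [N HC]] := @many_all l h H H_simple H_connected (fun i => planar_pl (H_planar i))
  (fun i => one_cycle_edges (H_simple i) (@H_cycle i)) l t q (leqnn l) q0.
exists (C.+1%:R^-1), (N0 + N + 12 * q + 1)%N; split; first by rewrite invr_gt0 ltr0n.
move=> n nN; have dn : Dom q n (m n) by apply: dom; clear -nN; lia.
have /andP [_ d2] := dn.
have NP0 : (0 < NP n (m n))%N by apply: PG0 q0 _ d2; clear -nN; lia.
have HP := HC n (m n); rewrite /Pr_planar planar_graphsE.
have -> : #|[set E in PG n (m n) | [forall i, (t <= num_order_iso_components (H i) E)%N]]%SET| =
    #|many H l t n (m n)|.
  apply: eq_card => E; apply/idP/manyP; rewrite [E \in finset _]finset.inE.
    by move=> /andP [EP /forallP Ei]; split=> // i _; exact: Ei.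
  by move=> [EP Ei]; rewrite EP; apply/forallP => i; exact: Ei.
rewrite ler_pdivlMr ?ltr0n // mulrC ler_pdivrMr ?ltr0n // -natrM ler_nat mulnC.
have H1 : (NP n (m n) <= C * #|many H l t n (m n)|)%N by apply: HP dn; clear -nN; lia.
by apply: leq_trans H1 _; rewrite leq_mul2r leqnSn orbT.
Qed.
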